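(* Let $\mathcal{M}=(M_2(\mathbb{C}),\frac12 Tr)*(M_2(\mathbb{C}),\frac12 Tr)$ with its faithful normal trace $\tau$, let $W_1=E_{11}-E_{22}$, and let $\mu_{(W_1+F_{12})}$ be the Brown measure of $W_1+F_{12}\in\mathcal{M}$. Then the support of $\mu_{(W_1+F_{12})}$ is $\left\{z\in\mathbb{C}: |z^2-1|\leq\frac{1}{\sqrt2}\right\}$.
   Context: $\mathcal{M}$ is the reduced free product von Neumann algebra of two copies of $M_2(\mathbb{C})$ with respect to the normalized trace $\frac12 Tr$; it is a type $II_1$ factor with faithful normal trace $\tau$. $(E_{ij})_{i,j=1,2}$ and $(F_{ij})_{i,j=1,2}$ are the standard matrix units of the first copy $(M_2(\mathbb{C}),\frac12 Tr)*1$ and of the second copy $1*(M_2(\mathbb{C}),\frac12 Tr)$ inside $\mathcal{M}$, respectively. For $T\in\mathcal{M}$ the Fuglede–Kadison determinant is $\Delta(T)=\exp[\tau(\ln (T^*T)^{1/2})]$, and the Brown measure $\mu_T$ is the distribution $\mu_T=\frac{1}{2\pi}\left(\frac{\partial^2}{\partial x^2}+\frac{\partial^2}{\partial y^2}\right)\ln\Delta[T-(x+iy)I]$ on $\mathbb{C}$; equivalently the unique compactly supported (probability) measure on $\mathbb{C}$ with $\ln\Delta(T-\lambda I)=\int_{\mathbb{C}}\ln|z-\lambda|\,d\mu_T(z)$ for all $\lambda\in\mathbb{C}$. *)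

(* Defs.v *)
From HB Require Import structures.
From mathcomp Require Import all_boot all_order all_algebra.
From mathcomp Require Import complex.
From mathcomp Require Import all_classical all_reals all_analysis.
Set Implicit Arguments.
Unset Strict Implicit.
Unset Printing Implicit Defensive.
Import Order.TTheory GRing.Theory Num.Theory.
Import numFieldNormedType.Exports.
Local Open Scope classical_set_scope.
Local Open Scope ring_scope.
Local Open Scope complex_scope.

(* A complex Hilbert space is a Banach space H over R[i] with an inner product
   dot (linear in its first argument) satisfying [hilbert_norm dot].  Operators
   are bare functions H -> H; A + B and c *: A are the pointwise operations. *)
Section Operators.
Variables (R : realType) (H : completeNormedModType R[i]).
Variable dot : {dot H for Num.conj}.
Implicit Types (A B S T : H -> H) (M D : set (H -> H)).

Definition hilbert_norm : Prop := forall x : H, dot x x = `|x| ^+ 2.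

Definition bounded_operator A : Prop := linear A /\ continuous A.

Definition adjoint A B : Prop := forall x y : H, dot (A x) y = dot x (B y).

Definition positive_operator A : Prop := forall x : H, 0 <= dot (A x) x.

(* On R[i], u <= v means that v - u is a nonnegative real, so B - A is then
   positive, hence self-adjoint. *)
Definition loewner A B : Prop := positive_operator (B - A).

Definition commutant D : set (H -> H) :=
  [set A | bounded_operator A /\ forall B, D B -> A \o B = B \o A].

Record von_neumann_algebra M : Prop := VonNeumannAlgebra {
  vn_adjoint : forall A, M A -> exists2 B, M B & adjoint A B;
  vn_bicommutant : commutant (commutant M) = M }.

Definition loewner_lub M D A : Prop :=
  [/\ M A, forall B, D B -> loewner B A
    & forall B, M B -> (forall B', D B' -> loewner B' B) -> loewner A B].

(* Normality: tau preserves suprema of increasing nets of positive operators;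
   as tau is monotone, this says that tau B comes arbitrarily close to the
   value of tau at the supremum. *)
Definition normal_functional M (tau : (H -> H) -> R[i]) : Prop :=
  forall D A, D !=set0 -> D `<=` M -> (forall B, D B -> positive_operator B) ->
    (forall B B', D B -> D B' ->
       exists2 B'', D B'' & loewner B B'' /\ loewner B' B'') ->
    loewner_lub M D A ->
    forall eps : R[i], 0 < eps -> exists2 B, D B & tau A - tau B < eps.

(* Only the values of tau on M are meaningful. *)
Record faithful_normal_trace M (tau : (H -> H) -> R[i]) : Prop :=
  FaithfulNormalTrace {
  tr_linear : forall (c : R[i]) A B,
    M A -> M B -> tau (c *: A + B) = c * tau A + tau B;
  tr_unit : tau id = 1;
  tr_positive : forall A, M A -> positive_operator A -> 0 <= tau A;
  tr_trace : forall A B, M A -> M B -> tau (A \o B) = tau (B \o A);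
  tr_faithful : forall A,
    M A -> positive_operator A -> tau A = 0 -> forall x : H, A x = 0;
  tr_normal : normal_functional M tau }.

(* Freeness of a family of unital subalgebras: alternating products of
   centered elements are centered. *)
Definition free_family (I : eqType) (tau : (H -> H) -> R[i])
    (N : I -> set (H -> H)) : Prop :=
  forall (n : nat) (i : nat -> I) (A : nat -> H -> H),
    (0 < n)%N ->
    (forall k, (k < n)%N -> N (i k) (A k) /\ tau (A k) = 0) ->
    (forall k, (k.+1 < n)%N -> i k != i k.+1) ->
    tau (\big[(fun B B' : H -> H => B \o B')/id]_(k < n) A k) = 0.

(* Unital *-homomorphism from 'M_m into M that carries tau back to the
   normalized trace. *)
Record trace_preserving_embedding (m : nat) M (tau : (H -> H) -> R[i])
    (iota : 'M[R[i]]_m -> H -> H) : Prop := TracePreservingEmbedding {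
  emb_in : forall a, M (iota a);
  emb_linear : forall (c : R[i]) a b, iota (c *: a + b) = c *: iota a + iota b;
  emb_unit : iota 1%:M = id;
  emb_mul : forall a b, iota (a *m b) = iota a \o iota b;
  emb_adjoint : forall a, adjoint (iota a) (iota (map_mx Num.conj a)^T);
  emb_trace : forall a, tau (iota a) = m%:R^-1 * \tr a }.

(* (M, tau) is the reduced free product von Neumann algebra of copies, indexed
   by I, of 'M_m with its normalized trace.  These properties determine
   (M, tau, iota) up to a trace-preserving isomorphism. *)
Record reduced_free_product (I : eqType) (m : nat) M (tau : (H -> H) -> R[i])
    (iota : I -> 'M[R[i]]_m -> H -> H) : Prop := ReducedFreeProduct {
  rfp_vn : von_neumann_algebra M;
  rfp_trace : faithful_normal_trace M tau;
  rfp_emb : forall i, trace_preserving_embedding M tau (iota i);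
  rfp_free : free_family tau (fun i => range (iota i));
  rfp_generated :
    commutant (commutant (\bigcup_(i in [set: I]) range (iota i))) = M }.

(* S = (T^* T)^(1/2) *)
Definition absolute_value M T S : Prop :=
  [/\ M S, positive_operator S &
      exists2 T', adjoint T T' & S \o S = T' \o T].

(* The distribution of a self-adjoint S with respect to tau: the compactly
   supported probability measure on the line with the moments of S. *)
Definition spectral_distribution (tau : (H -> H) -> R[i]) S
    (nu : probability (measurableTypeR R) R) : Prop :=
  (exists r : R, nu [set t | - r <= t <= r] = 1%E) /\
  forall n : nat, tau (iter n S) = (\int[nu]_(t in setT) (t ^+ n))%:C.

(* d = Delta(T) = exp (tau (ln |T|)), where tau (ln |T|) is the integral of the
   extended logarithm (lne 0 = -oo, expeR -oo = 0) against the distribution of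
   |T|. *)
Definition FK_determinant M tau T (d : R) : Prop :=
  exists S (nu : probability (measurableTypeR R) R),
    [/\ absolute_value M T S, spectral_distribution tau S nu &
        d%:E = expeR (\int[nu]_(t in `[0%R, +oo[) lne t%:E)%E].

End Operators.

(* R[i]^o is R[i] with its usual topology; borelC is R[i] with its Borel sets. *)
Definition borelC (R : realType) := g_sigma_algebraType (@open R[i]^o).

Definition measure_support (R : realType) (mu : probability (borelC R) R) :
    set R[i] :=
  [set z | forall U : set R[i]^o, open U -> U z -> (0 < mu U)%E].

(* Both sides of the identity may be -oo. *)
Definition Brown_measure (R : realType) (H : completeNormedModType R[i])
    (dot : {dot H for Num.conj}) (M : set (H -> H)) (tau : (H -> H) -> R[i])
    (T : H -> H) (mu : probability (borelC R) R) : Prop :=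
  (exists2 K : set R[i]^o, compact K & mu K = 1%E) /\
  forall lambda : R[i], exists2 d : R,
    FK_determinant dot M tau (T - lambda *: (id : H -> H)) d &
    lne d%:E = (\int[mu]_z lne (complex.Re `|(z : R[i]) - lambda|)%:E)%E.

(* Main.v *)
Require Import Defs.
From HB Require Import structures.
From mathcomp Require Import all_boot all_order all_algebra.
From mathcomp Require Import complex.
From mathcomp Require Import all_classical all_reals all_analysis.
From mathcomp Require Import measurable_realfun ring lra.
From Stdlib Require Ncring Ncring_tac.
Set Implicit Arguments.
Unset Strict Implicit.
Unset Printing Implicit Defensive.
Import Order.TTheory GRing.Theory Num.Theory.
Import numFieldNormedType.Exports.
Local Open Scope classical_set_scope.
Local Open Scope ring_scope.
Local Open Scope complex_scope.

(* Write W = W_1, N = F_12 and T_z = W + N - z.  After a regularization, the tracial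
   logarithm of T_z^* T_z + e reduces, through Schur complements, to that of a pencil in
   free skew involutions, which freeness determines; hence ln Delta(T_z) depends only on
   r = |1 - z^2| and equals (ln r) / 2 if r^2 >= 1/2 and
   - (ln 2) / 2 - ln (1 - r^2) / 4 if 0 < r^2 < 1/2.  The logarithmic potential of mu is
   this function: it is harmonic where r^2 > 1/2 and strictly subharmonic where r^2 < 1/2,
   away from r = 0. *)

(** The inverse of a pencil in free skew involutions is a weighted sum over all reduced words, so
    freeness gives the traces that make up the derivative of its log-determinant when the weights
    are scaled. A pencil is a real scalar plus a skew element, hence its square modulus is a
    regularised square. The regularisation reached this way depends on a parameter q, and
    monotonicity in the regularisation replaces solving for q. Derivatives appear only as linear
    approximations whose quadratic error is uniform along a path, for a tracial logarithm given by
    its power series.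

    The factorisation divides by 1 - z^2, so the potential is obtained only away from z = 1 and z =
    -1, and only through its values; its Laplacian is never formed. Instead ln |P| is integrated for
    polynomials P with roots off these two points, which sums the potential over the roots. Roots
    along a level curve of |1 - z^2| exclude mass further out; four roots around a point detect mass
    near it. *)

Section NoncommutativeRing.
Variable A : nzRingType.

Definition nc_ring_ops : @Ncring.Ring_ops A 0 1 +%R *%R (fun x y => x - y) -%R eq.
Proof. by constructor. Defined.

Lemma nc_ring : @Ncring.Ring A 0 1 +%R *%R (fun x y => x - y) -%R eq nc_ring_ops.
Proof.
split.
- exact: RelationClasses.eq_equivalence.
- by move=> x y -> a b ->.
- by move=> x y -> a b ->.
- by move=> x y -> a b ->.
- by move=> x y ->.
- exact: (@add0r A).
- exact: (@addrC A).
- exact: (@addrA A).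
- exact: (@mul1r A).
- exact: (@mulr1 A).
- exact: (@mulrA A).
- exact: (@mulrDl A).
- by move=> x y z; exact: mulrDr.
- by [].
- exact: (@subrr A).
Qed.
End NoncommutativeRing.

#[local] Existing Instance nc_ring_ops.
#[local] Existing Instance nc_ring.

Ltac scale_ring :=
  rewrite ?(scalerBr, scalerDr, scalerBl, scalerDl, scalerA, scalerN, scaleNr,
    mulrDl, mulrBl, mulrDr, mulrBr, mulNr, mulrN, mulr1, mul1r, scale1r);
  Ncring_tac.non_commutative_ring.

(** * Monotonicity and constancy from second-order bounds *)

Lemma le_of_eq (R : realType) (x y : R) : x = y -> x <= y.
Proof. by move->. Qed.

(** A derivative test without derivatives: over a subdivision of the unit interval into n equal
    pieces the errors add up to K / n, which becomes arbitrarily small. *)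
Lemma quadratic_le (R : realType) (f : R -> R) (K : R) :
  (forall x y, 0 <= x -> x <= y -> y <= 1 -> f x - f y <= K * (y - x) ^+ 2) ->
  f 0 <= f 1.
Proof.
move=> hf; rewrite -subr_le0.
have step (n : nat) (m : nat) : (m <= n.+1)%N ->
    f 0 - f (m%:R / n.+1%:R) <= m%:R * (K / n.+1%:R ^+ 2).
  elim: m => [|m IH] hm; first by rewrite !mul0r subrr.
  rewrite -natr1 [(_ + 1) * (_ / _)]mulrDl mul1r.
  have -> : f 0 - f ((m%:R + 1) / n.+1%:R) = (f 0 - f (m%:R / n.+1%:R)) +
     (f (m%:R / n.+1%:R) - f ((m%:R + 1) / n.+1%:R)) by ring.
  apply: lerD; first exact: IH (ltnW hm).
  have n0 : (0 : R) < n.+1%:R by rewrite ltr0n.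
  apply: le_trans (hf _ _ _ _ _) _.
  - by rewrite divr_ge0.
  - by rewrite ler_pM2r ?invr_gt0// lerDl.
  - by rewrite ler_pdivrMr// mul1r natr1 ler_nat.
  - rewrite -mulrBl addrC addKr mul1r exprVn; exact: lexx.
have fin n : f 0 - f 1 <= K / n.+1%:R.
  have := step n n.+1 (leqnn _).
  have n0 : (n.+1%:R : R) != 0 by rewrite pnatr_eq0.
  rewrite divff//.
  suff -> : n.+1%:R * (K / n.+1%:R ^+ 2) = K / n.+1%:R by [].
  by field; rewrite addrC natr1.
rewrite leNgt; apply/negP => h.
have := fin (Num.truncn (K / (f 0 - f 1))).
rewrite ler_pdivlMr ?ltr0n// leNgt => /negP; apply.
by rewrite mulrC -ltr_pdivrMr//; exact: truncnS_gt.
Qed.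

Lemma quadratic_cst (R : realType) (f : R -> R) (K : R) :
  (forall x y, 0 <= x -> x <= y -> y <= 1 -> `|f y - f x| <= K * (y - x) ^+ 2) ->
  f 1 = f 0.
Proof.
move=> hf; apply/eqP; rewrite eq_le; apply/andP; split; last first.
  apply: (@quadratic_le _ _ K) => x y x0 xy y1; apply: le_trans (hf _ _ x0 xy y1).
  by rewrite distrC ler_norm.
rewrite -lerN2; apply: (@quadratic_le _ (fun x => - f x) K) => x y x0 xy y1.
by apply: le_trans (hf _ _ x0 xy y1); rewrite opprK addrC ler_norm.
Qed.

(** * Real star-algebras with a positive trace *)

Record pretracial (R : realType) (A : algType R) := Pretracial {
  star : {linear A -> A};
  tr : {scalar A};
  pos : A -> Prop;
  starM : forall a b, star (a * b) = star b * star a;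
  starK : forall a, star (star a) = a;
  tr1 : tr 1 = 1;
  trC : forall a b, tr (a * b) = tr (b * a);
  tr_star : forall a, tr (star a) = tr a;
  pos1 : pos 1;
  posD : forall a b, pos a -> pos b -> pos (a + b);
  pos_conj : forall a x, pos a -> pos (star x * a * x);
  pos_tr : forall a, pos a -> 0 <= tr a;
  pos_star : forall a, pos a -> star a = a;
  tracial_bounded : forall a, exists2 K : R, 0 <= K & pos (K ^+ 2 *: 1 - star a * a) }.

(** Invertibility of elements bounded below is kept apart from [pretracial] because its verification
    for operators uses the order estimates that follow from the other axioms. *)
Record tracial (R : realType) (A : algType R) := Tracial {
  tracial_base :> pretracial A;
  tracial_inv : forall a (d : R), 0 < d -> pos tracial_base (a - d *: 1) ->
    exists2 b, a * b = 1 & b * a = 1 }.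

Section Tracial.
Variables (R : realType) (A : algType R) (T : pretracial A).
Local Notation st := (star T).
Local Notation t := (tr T).
Local Notation pos := (pos T).
Implicit Types (a b x y u : A) (c d e : R).

Lemma trZ c a : t (c *: a) = c * t a. Proof. exact: linearZ. Qed.
Lemma trMZ c a b : t (a * (c *: b)) = c * t (a * b).
Proof. by rewrite -scalerAr trZ. Qed.
Lemma trD a b : t (a + b) = t a + t b. Proof. exact: linearD. Qed.
Lemma trN a : t (- a) = - t a. Proof. exact: linearN. Qed.
Lemma trB a b : t (a - b) = t a - t b. Proof. exact: linearB. Qed.
Lemma starZ c a : st (c *: a) = c *: st a. Proof. exact: linearZ. Qed.
Lemma starD a b : st (a + b) = st a + st b. Proof. exact: linearD. Qed.
Lemma starN a : st (- a) = - st a. Proof. exact: linearN. Qed.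
Lemma starB a b : st (a - b) = st a - st b. Proof. exact: linearB. Qed.

Lemma tr_sum (I : Type) (r : seq I) (P : pred I) (F : I -> A) :
  t (\sum_(i <- r | P i) F i) = \sum_(i <- r | P i) t (F i).
Proof. exact: raddf_sum. Qed.
Lemma star_sum (I : Type) (r : seq I) (P : pred I) (F : I -> A) :
  st (\sum_(i <- r | P i) F i) = \sum_(i <- r | P i) st (F i).
Proof. exact: raddf_sum. Qed.

Lemma star1 : st 1 = 1.
Proof. by rewrite -[LHS]mulr1 -{2}(starK T 1) -starM mulr1 starK. Qed.

Lemma starX a n : st (a ^+ n) = st a ^+ n.
Proof. by elim: n => [|n IH]; rewrite ?star1// exprS starM IH exprSr. Qed.

Lemma posZ c a : 0 <= c -> pos a -> pos (c *: a).
Proof.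
move=> c0 /(pos_conj (Num.sqrt c *: 1)).
rewrite starZ star1 -scalerAl mul1r -scalerAr mulr1 scalerA.
by rewrite -expr2 sqr_sqrtr.
Qed.

Lemma pos_sq x : pos (st x * x).
Proof. by have := pos_conj x (pos1 T); rewrite mulr1. Qed.

Lemma pos_sq' x : pos (x * st x).
Proof. by have := pos_sq (st x); rewrite starK. Qed.

Lemma pos_selfsq x : st x = x -> pos (x * x).
Proof. by move=> {1}<-; exact: pos_sq. Qed.

Lemma pos_scalar c : 0 <= c -> pos (c *: 1).
Proof. by move=> c0; apply: posZ => //; exact: pos1. Qed.

Lemma pos0 : pos 0.
Proof. by have := pos_scalar (lexx 0); rewrite scale0r. Qed.

Lemma pos_trans y x z : pos (y - x) -> pos (z - y) -> pos (z - x).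
Proof. by move=> h1 h2; have := posD h2 h1; rewrite addrA subrK. Qed.

Lemma tr_conj_ge0 a x : pos a -> 0 <= t (st x * a * x).
Proof. by move=> ha; apply: pos_tr; apply: pos_conj. Qed.

Lemma tr_sq_ge0 x : 0 <= t (st x * x).
Proof. by apply: pos_tr; exact: pos_sq. Qed.

Lemma cauchy_schwarz a b : t (st a * b) ^+ 2 <= t (st a * a) * t (st b * b).
Proof.
set p : R := t (st a * b).
have sym : t (st b * a) = p by rewrite -tr_star starM starK.
have key (s : R) : 0 <= t (st a * a) - 2 * s * p + s ^+ 2 * t (st b * b).
  have := tr_sq_ge0 (a - s *: b); set r := (X in _ -> 0 <= X).
  rewrite starB starZ mulrBl !mulrBr -!(scalerAl, scalerAr) !(trB, trZ) sym -/p.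
  by move=> h; apply: le_trans h _; rewrite /r; lra.
have [b0|b0] := eqVneq (t (st b * b)) 0.
  rewrite b0 mulr0.
  have [->|p0] := eqVneq p 0; first by rewrite expr0n.
  have := key ((t (st a * a) + 1) / (2 * p)).
  rewrite b0 mulr0 addr0.
  have -> : 2 * ((t (st a * a) + 1) / (2 * p)) * p = t (st a * a) + 1.
    by field.
  by lra.
have b1 : 0 < t (st b * b) by rewrite lt0r b0 tr_sq_ge0.
have := key (p / t (st b * b)).
have -> : t (st a * a) - 2 * (p / t (st b * b)) * p +
    (p / t (st b * b)) ^+ 2 * t (st b * b) = t (st a * a) - p ^+ 2 / t (st b * b).
  by field.
by rewrite subr_ge0 ler_pdivrMr.
Qed.

(** The operator norm of [a] is at most [K], expressed through the order since the abstract algebra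
    carries no norm. *)
Definition nb a (K : R) := 0 <= K /\ pos (K ^+ 2 *: 1 - st a * a).

Lemma nbM a b K L : nb a K -> nb b L -> nb (a * b) (K * L).
Proof.
move=> [K0 hK] [L0 hL]; split; first exact: mulr_ge0.
have h1 := pos_conj b hK; have h2 := posZ (sqr_ge0 K) hL.
rewrite mulrBr mulrBl -scalerAr -scalerAl mulr1 in h1.
rewrite scalerBr scalerA -exprMn in h2.
by have := pos_trans h1 h2; rewrite starM !mulrA.
Qed.

Lemma nb1 : nb 1 1.
Proof. by split=> //; rewrite star1 mulr1 expr1n scale1r subrr; exact: pos0. Qed.

Lemma nbX a K n : nb a K -> nb (a ^+ n) (K ^+ n).
Proof.
by move=> h; elim: n => [|n IH]; [exact: nb1|rewrite !exprS; exact: nbM].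
Qed.

Lemma nb_tr a K : nb a K -> `|t a| <= K.
Proof.
move=> [K0 hK].
have := pos_tr hK; rewrite trB trZ tr1 mulr1 subr_ge0 => h.
have := cauchy_schwarz 1 a.
rewrite star1 !mul1r tr1 mul1r => h2.
have : t a ^+ 2 <= K ^+ 2 by exact: le_trans h2 h.
by rewrite -real_normK ?num_real// ler_sqr ?nnegrE.
Qed.

Lemma nb_le a K L : K <= L -> nb a K -> nb a L.
Proof.
move=> KL [K0 hK]; split; first exact: le_trans KL.
have : pos ((L ^+ 2 - K ^+ 2) *: 1).
  by apply: pos_scalar; rewrite subr_ge0 ler_sqr ?nnegrE// (le_trans K0).
by rewrite scalerBl => h; exact: (pos_trans hK h).
Qed.

Lemma nbN a K : nb a K -> nb (- a) K.
Proof. by rewrite /nb starN mulrNN. Qed.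

Lemma nbZ c a K : nb a K -> nb (c *: a) (`|c| * K).
Proof.
move=> [K0 hK]; split; first by rewrite mulr_ge0.
rewrite starZ -scalerAl -scalerAr scalerA exprMn real_normK ?num_real//.
by rewrite -expr2 -scalerA -scalerBr; apply: posZ => //; exact: sqr_ge0.
Qed.

Lemma nb_bounded a : exists2 K : R, 0 <= K & nb a K.
Proof. by have [K K0 h] := tracial_bounded T a; exists K. Qed.

(* a^2 <= c a for 0 <= a <= c, by sandwiching c - a and a. *)
Lemma pos_le_nb a c : 0 < c -> pos a -> pos (c *: 1 - a) -> nb a c.
Proof.
move=> c0 pa pc; split; first exact: ltW.
have sa := pos_star pa.
have sc : st (c *: 1 - a) = c *: 1 - a by exact: pos_star.
have h1 : pos (c^-1 *: (a * (c *: 1 - a) * a + (c *: 1 - a) * a * (c *: 1 - a))).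
  apply: posZ; first by rewrite invr_ge0 ltW.
  apply: posD; first by rewrite -{1}sa; exact: pos_conj.
  by rewrite -{1}sc; exact: pos_conj.
have h2 : pos (c *: a - a * a).
  suff <- : c^-1 *: (a * (c *: 1 - a) * a + (c *: 1 - a) * a * (c *: 1 - a))
     = c *: a - a * a by [].
  have -> : a * (c *: 1 - a) * a + (c *: 1 - a) * a * (c *: 1 - a) =
     c *: (c *: a - a * a).
    rewrite !(mulrBl, mulrBr) -!(scalerAl, scalerAr) !(mulr1, mul1r) !scalerBr.
    rewrite !scalerA.
    by Ncring_tac.non_commutative_ring.
  by rewrite scalerA mulVf ?gt_eqF// scale1r.
have h3 : pos (c *: (c *: 1 - a)) by apply: posZ => //; exact: ltW.
rewrite sa; apply: (pos_trans h2).
by move: h3; rewrite scalerBr scalerA -expr2.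
Qed.

(** Both summands on the left of (K - a)^2 + (K^2 - a^2) = 2 K (K - a) are positive. *)
Lemma nb_le_scalar a K : 0 < K -> pos a -> nb a K -> pos (K *: 1 - a).
Proof.
move=> K0 pa [_ hK]; have sa := pos_star pa.
have h : pos ((2 * K)^-1 *: ((K *: 1 - a) * (K *: 1 - a) + (K ^+ 2 *: 1 - a * a))).
  apply: posZ; first by rewrite invr_ge0 mulr_ge0// ltW.
  apply: posD; last by move: hK; rewrite sa.
  by apply: pos_selfsq; rewrite starB starZ star1 sa.
move: h; have -> : (K *: 1 - a) * (K *: 1 - a) + (K ^+ 2 *: 1 - a * a) =
   (2 * K) *: (K *: 1 - a).
  rewrite !(mulrBl, mulrBr) -!(scalerAl, scalerAr) !(mulr1, mul1r) !scalerBr.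
  rewrite mulr2n mulrDl !mul1r !scalerDl !scalerA expr2.
  by Ncring_tac.non_commutative_ring.
by rewrite scalerA mulVf ?scale1r// mulf_neq0// ?pnatr_eq0// gt_eqF.
Qed.

Lemma nb_pos_bounded a : exists2 K : R, 1 <= K & nb a K.
Proof.
have [K K0 hK] := nb_bounded a; exists (K + 1); first by rewrite lerDr.
by apply: nb_le hK; rewrite lerDl.
Qed.

Lemma pos_upper a : pos a -> exists2 C : R, 1 <= C & pos (C *: 1 - a).
Proof.
move=> pa; have [K K1 hK] := nb_pos_bounded a; exists K => //.
by apply: nb_le_scalar => //; apply: lt_le_trans K1.
Qed.

Lemma pos_ge_scalar c d a : d <= c -> pos (a - c *: 1) -> pos (a - d *: 1).
Proof.
move=> cd h; apply: (pos_trans _ h).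
by rewrite -scalerBl; apply: pos_scalar; rewrite subr_ge0.
Qed.

(** Halving d keeps the norm bound strictly positive even when d = C, so that later estimates may
    divide by it. *)
Lemma gap_contraction C d a : 0 < d -> d <= C -> pos (a - d *: 1) -> pos (C *: 1 - a) ->
  [/\ 0 < 1 - d / (2 * C), 1 - d / (2 * C) < 1 &
    nb (1 - C^-1 *: a) (1 - d / (2 * C))].
Proof.
move=> d0 dC h1 h2; have C0 : 0 < C by exact: lt_le_trans dC.
have r1 : 1 - d / (2 * C) < 1 by rewrite gtrBl divr_gt0// mulr_gt0.
have r0 : 0 < 1 - d / (2 * C).
  by rewrite subr_gt0 ltr_pdivrMr ?mulr_gt0// mul1r; lra.
split => //; apply: pos_le_nb => //.
  have : pos (C^-1 *: (C *: 1 - a)) by apply: posZ => //; rewrite invr_ge0 ltW.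
  by rewrite scalerBr scalerA mulVf ?scale1r// gt_eqF.
have : pos (C^-1 *: (a - (d / 2) *: 1)).
  apply: posZ; first by rewrite invr_ge0 ltW.
  by apply: pos_ge_scalar h1; lra.
rewrite scalerBr scalerA.
suff -> : (1 - d / (2 * C)) *: 1 - (1 - C^-1 *: a) = C^-1 *: a - (C^-1 * (d / 2)) *: 1 by [].
rewrite scalerBl scale1r opprB addrCA [X in _ + X]addrAC subrr sub0r.
by congr (_ - _ *: _); field; rewrite gt_eqF.
Qed.

Lemma pos_sq_lower d a : 0 <= d -> pos (a - d *: 1) -> pos (a * a - d ^+ 2 *: 1).
Proof.
move=> d0 h; have : pos ((a - d *: 1) * (a - d *: 1) + (2 * d) *: (a - d *: 1)).
  apply: posD; first exact: pos_selfsq (pos_star h).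
  by apply: posZ => //; apply: mulr_ge0.
suff -> : (a - d *: 1) * (a - d *: 1) + (2 * d) *: (a - d *: 1) =
   a * a - d ^+ 2 *: 1 by [].
rewrite !(mulrBl, mulrBr) -!(scalerAl, scalerAr) !(mulr1, mul1r) !scalerBr.
rewrite mulr2n mulrDl !mul1r !scalerDl !scalerA expr2.
by Ncring_tac.non_commutative_ring.
Qed.

End Tracial.

(** * Inverses, two-sided bounds and traces of products of positive elements *)

Section Inverses.
Variables (R : realType) (A : algType R) (T : tracial A).
Local Notation st := (star T).
Local Notation t := (tr T).
Local Notation pos := (pos T).
Local Notation nb := (nb T).
Implicit Types (a b x y u : A) (c d e : R).

Definition isinv a b := a * b = 1 /\ b * a = 1.

Lemma isinv_sym a b : isinv a b -> isinv b a. Proof. by case. Qed.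

Lemma isinvM a a' b b' : isinv a a' -> isinv b b' -> isinv (a * b) (b' * a').
Proof.
move=> [h1 h2] [h3 h4]; split.
  by rewrite mulrA -(mulrA a) h3 mulr1.
by rewrite mulrA -(mulrA b') h2 mulr1.
Qed.

Lemma isinv_star a b : isinv a b -> isinv (st a) (st b).
Proof. by move=> [h1 h2]; split; rewrite -starM ?h1 ?h2 star1. Qed.

Lemma isinv_unique a b x : isinv a b -> isinv a x -> b = x.
Proof. by move=> [h1 h2] [h3 h4]; rewrite -[b]mulr1 -h3 mulrA h2 mul1r. Qed.

Lemma isinv_pos a b : pos a -> isinv a b -> pos b.
Proof.
move=> pa ab; have := isinv_star ab; rewrite (pos_star pa) => sab.
have sb : st b = b by exact: isinv_unique sab ab.
by have := pos_conj b pa; rewrite sb -mulrA; case: ab => -> _; rewrite mulr1.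
Qed.

Definition bnd d C a := [/\ 0 < d, pos (a - d *: 1) & pos (C *: 1 - a)].

Lemma bnd_pos d C a : bnd d C a -> pos a.
Proof.
move=> [d0 h _]; have := posD h (pos_scalar T (ltW d0)); by rewrite subrK.
Qed.

Lemma scalar_pos_ge0 c : pos (c *: 1) -> 0 <= c.
Proof. by move/pos_tr; rewrite trZ tr1 mulr1. Qed.

Lemma bnd_le d C a : bnd d C a -> d <= C.
Proof.
move=> [d0 h1 h2]; have := pos_trans h1 h2.
by rewrite -scalerBl => /scalar_pos_ge0; rewrite subr_ge0.
Qed.

Lemma bnd_gt0 d C a : bnd d C a -> 0 < C.
Proof. by move=> h; have := bnd_le h; case: h => d0 _ _; apply: lt_le_trans. Qed.

Lemma pos_le_scalar c d a : c <= d -> pos (c *: 1 - a) -> pos (d *: 1 - a).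
Proof.
move=> cd h; apply: (pos_trans h).
by rewrite -scalerBl; apply: pos_scalar; rewrite subr_ge0.
Qed.

Lemma bnd_weak d C d' C' a : 0 < d' -> d' <= d -> C <= C' -> bnd d C a -> bnd d' C' a.
Proof.
move=> d'0 dd CC [d0 h1 h2]; split => //.
  exact: pos_ge_scalar h1.
exact: pos_le_scalar h2.
Qed.

Lemma bnd_inv d C a : bnd d C a -> exists a', isinv a a'.
Proof. by move=> [d0 h _]; have [b] := tracial_inv d0 h; exists b. Qed.

Lemma inv_nb d C a a' : bnd d C a -> isinv a a' -> nb a' d^-1.
Proof.
move=> bA ia; have [d0 h1 h2] := bA.
have pa := bnd_pos bA; have pa' := isinv_pos pa ia.
split; first by rewrite invr_ge0 ltW.
have sa' := pos_star pa'.
have h3 := pos_sq_lower (ltW d0) h1.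
have := pos_conj a' h3; rewrite sa' mulrBr mulrBl.
have -> : a' * (a * a) * a' = 1 by case: ia => i1 i2; rewrite mulrA i2 mul1r i1.
rewrite -!(scalerAr, scalerAl) mulr1 => /(posZ (sqr_ge0 d^-1)).
by rewrite scalerBr scalerA exprVn mulVf ?scale1r// sqrf_eq0 gt_eqF.
Qed.

(* With 0 <= P <= 1 and P_{n+1} = P_n - P_n^2, P is the sum of the squares P_n^2
   up to the remainder P_N, which tends to 0 in the 2-norm. *)
Lemma tr_mul_pos P H : pos P -> pos H -> 0 <= t (P * H).
Proof.
move=> pP pH.
have [C C1 hC] := pos_upper pP.
have C0 : 0 < C by apply: lt_le_trans C1.
suff main Q : pos Q -> pos (1 - Q) -> 0 <= t (Q * H).
  have := main (C^-1 *: P).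
  rewrite -scalerAl trZ pmulr_rge0 ?invr_gt0//; apply.
    by apply: posZ => //; rewrite invr_ge0 ltW.
  have : pos (C^-1 *: (C *: 1 - P)) by apply: posZ => //; rewrite invr_ge0 ltW.
  by rewrite scalerBr scalerA mulVf ?scale1r// gt_eqF.
move=> pQ pQ1.
have [q [q0 qS]] : exists q : nat -> A, q 0%N = Q /\ forall n, q n.+1 = q n - q n * q n.
  by exists (fun n => iter n (fun x => x - x * x) Q).
have inv n : pos (q n) /\ pos (1 - q n).
  elim: n => [|n [h1 h2]]; first by rewrite q0.
  have s1 := pos_star h1; have s2 := pos_star h2; rewrite !qS; split.
    have -> : q n - q n * q n =
        q n * (1 - q n) * q n + (1 - q n) * q n * (1 - q n).
      by Ncring_tac.non_commutative_ring.
    apply: posD.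
      by rewrite -{1}s1; exact: pos_conj.
    by rewrite -{1}s2; exact: pos_conj.
  rewrite opprB addrCA addrC; apply: posD => //; exact: pos_selfsq.
have dec n : t (q n * H) <= t (Q * H).
  elim: n => [|n IH]; first by rewrite q0.
  apply: le_trans IH; rewrite qS mulrBl trB lerBlDr lerDl.
  have [h1 _] := inv n.
  rewrite -mulrA trC -{1}(pos_star h1); exact: tr_conj_ge0.
have sum N : \sum_(n < N) t (q n * q n) = t Q - t (q N).
  elim: N => [|N IH]; first by rewrite big_ord0 q0 subrr.
  by rewrite big_ord_recr /= IH qS trB; ring.
have small e : 0 < e -> exists n, t (q n * q n) < e.
  move=> e0; apply: contrapT => hn.
  have ge n : e <= t (q n * q n) by rewrite leNgt; apply/negP => h; apply: hn; exists n.
  have bound N : N%:R * e <= t Q.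
    have : \sum_(n < N) e <= \sum_(n < N) t (q n * q n) by apply: ler_sum.
    rewrite sumr_const card_ord sum => h; rewrite mulr_natl; apply: le_trans h _.
    by rewrite gerBl; apply: pos_tr; case: (inv N).
  have := bound (Num.truncn (t Q / e)).+1; rewrite leNgt => /negP; apply.
  by rewrite -ltr_pdivrMr//; exact: truncnS_gt.
rewrite leNgt; apply/negP => neg.
have hh : 0 <= t (st H * H) by exact: tr_sq_ge0.
have e0 : 0 < t (Q * H) ^+ 2 / (t (st H * H) + 1).
  by apply: divr_gt0; [rewrite exprn_even_gt0//= lt_eqF|rewrite ltr_wpDl].
have [n hn] := small _ e0.
have [h1 _] := inv n.
have := cauchy_schwarz T (q n) H; rewrite (pos_star h1) => cs.
have : t (Q * H) ^+ 2 <= t (q n * H) ^+ 2.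
  have := dec n; nra.
rewrite leNgt => /negP; apply; apply: le_lt_trans cs _.
rewrite ltr_pdivlMr ?ltr_wpDl// in hn; apply: le_lt_trans hn.
apply: ler_wpM2l; first by apply: pos_tr; exact: pos_selfsq (pos_star h1).
by rewrite lerDl.
Qed.

End Inverses.

(** * The tracial logarithm as a power series, and its gradient *)

Section LogDet.
Variables (R : realType) (A : algType R) (T : tracial A).
Local Notation st := (star T).
Local Notation t := (tr T).
Local Notation pos := (pos T).
Local Notation nb := (nb T).
Local Notation bnd := (bnd T).
Implicit Types (a b x y u : A) (c d e : R).

Definition gap (C : R) a : A := 1 - C^-1 *: a.

Definition ldser C a : R^nat := series (fun k => t (gap C a ^+ k.+1) / k.+1%:R).

(** The trace of ln a, expanded as ln C + ln (1 - g) with g = 1 - a / C; the scale [C] is an upper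
    bound of [a], which makes g a strict contraction when [a] is also bounded below. *)
Definition ldC C a : R := ln C - limn (ldser C a).

Lemma gap_nb d C a : bnd d C a ->
  [/\ 0 < 1 - d / (2 * C), 1 - d / (2 * C) < 1 & nb (gap C a) (1 - d / (2 * C))].
Proof.
move=> bA; have dC := bnd_le bA; case: bA => d0 h1 h2.
exact: gap_contraction.
Qed.

Lemma tr_gapX d C a n : bnd d C a -> `|t (gap C a ^+ n)| <= (1 - d / (2 * C)) ^+ n.
Proof. by case/gap_nb => _ _ h; apply: nb_tr; exact: nbX. Qed.

Lemma cvg_ldser d C a : bnd d C a -> cvgn (ldser C a).
Proof.
move=> bA; have [r0 r1 _] := gap_nb bA; set r := 1 - d / (2 * C) in r0 r1.
apply: normed_cvg; apply: (@series_le_cvg _ _ (geometric 1 r)).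
- by move=> k; exact: normr_ge0.
- by move=> k /=; rewrite mul1r exprn_ge0// ltW.
- move=> k /=; rewrite mul1r normrM normfV.
  have k1 : (0 : R) < k.+1%:R by rewrite ltr0n.
  rewrite (gtr0_norm k1) ler_pdivrMr//.
  apply: le_trans (tr_gapX _ bA) _; rewrite -/r exprS.
  have rk : 0 <= r ^+ k by rewrite exprn_ge0// ltW.
  rewrite mulrC; apply: ler_wpM2l => //.
  by apply: (le_trans (ltW r1)); rewrite ler1n.
- by apply: is_cvg_geometric_series; rewrite gtr0_norm.
Qed.

Section SecondOrder.
Variables (X Y : A) (r h : R).
Hypotheses (r0 : 0 < r) (nX : nb X r) (nY : nb Y r) (nH : nb (Y - X) h).

Lemma power_diff1 k Z z : nb Z z ->
  `|t ((Y ^+ k - X ^+ k) * Z)| <= k%:R * r ^+ k * (h / r) * z.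
Proof.
elim: k Z z => [|k IH] Z z nZ.
  by rewrite !expr0 subrr mul0r raddf0 normr0 !mul0r.
have -> : (Y ^+ k.+1 - X ^+ k.+1) * Z =
    Y ^+ k * ((Y - X) * Z) + (Y ^+ k - X ^+ k) * (X * Z).
  by rewrite !exprSr; Ncring_tac.non_commutative_ring.
rewrite trD; apply: le_trans (ler_normD _ _) _.
have h1 := nb_tr (nbM (nbX k nY) (nbM nH nZ)).
have h2 := IH _ _ (nbM nX nZ).
apply: le_trans (lerD h1 h2) _.
by rewrite -natr1 exprS; apply: le_of_eq; field; rewrite gt_eqF.
Qed.

(** Replace the factors of [X ^+ k] by [Y] one at a time; cyclicity collects the first-order terms
    into a single trace. The additional factor [X ^+ m] is what the induction on [k] needs; only m =
    0 is used later. *)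
Lemma power_diff2 k m :
  `|t ((Y ^+ k - X ^+ k) * X ^+ m) - k%:R * t (X ^+ (k + m).-1 * (Y - X))|
    <= k%:R ^+ 2 * r ^+ (k + m) * (h / r) ^+ 2.
Proof.
elim: k m => [|k IH] m.
  by rewrite !expr0 subrr mul0r raddf0 !mul0r subrr normr0 expr0n /= !mul0r.
have -> : (Y ^+ k.+1 - X ^+ k.+1) * X ^+ m =
    Y ^+ k * (Y - X) * X ^+ m + (Y ^+ k - X ^+ k) * X ^+ m.+1.
  by rewrite exprSr (exprSr X) (exprS X m); Ncring_tac.non_commutative_ring.
have -> : Y ^+ k * (Y - X) * X ^+ m =
    (Y ^+ k - X ^+ k) * ((Y - X) * X ^+ m) + X ^+ k * (Y - X) * X ^+ m.
  by Ncring_tac.non_commutative_ring.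
have cyc : t (X ^+ k * (Y - X) * X ^+ m) = t (X ^+ (k + m) * (Y - X)).
  by rewrite trC mulrA -exprD addnC.
rewrite !trD cyc.
have -> : t ((Y ^+ k - X ^+ k) * ((Y - X) * X ^+ m)) + t (X ^+ (k + m) * (Y - X)) +
   t ((Y ^+ k - X ^+ k) * X ^+ m.+1) - k.+1%:R * t (X ^+ (k.+1 + m).-1 * (Y - X)) =
   t ((Y ^+ k - X ^+ k) * ((Y - X) * X ^+ m)) +
   (t ((Y ^+ k - X ^+ k) * X ^+ m.+1) - k%:R * t (X ^+ (k + m.+1).-1 * (Y - X))).
  by rewrite addnS addSn /= -natr1; ring.
apply: le_trans (ler_normD _ _) _.
have h1 := power_diff1 k (nbM nH (nbX m nX)).
apply: le_trans (lerD h1 (IH m.+1)) _.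
have -> : k%:R * r ^+ k * (h / r) * (h * r ^+ m) =
   k%:R * r ^+ (k.+1 + m) * (h / r) ^+ 2.
  by rewrite exprD exprS; field; rewrite gt_eqF.
rewrite addnS addSn -!mulrDl; apply: ler_wpM2r; first exact: sqr_ge0.
apply: ler_wpM2r; first by rewrite exprn_ge0// ltW.
by rewrite -natr1 sqrrD1; have : (0 : R) <= k%:R by []; lra.
Qed.

End SecondOrder.

Lemma sum_arith_geom (r : R) n : 0 <= r -> r < 1 ->
  \sum_(k < n) k.+1%:R * r ^+ k <= (1 - r) ^- 2.
Proof.
move=> r0 r1; have r2 : 0 < (1 - r) ^+ 2 by rewrite exprn_gt0// subr_gt0.
rewrite -[leRHS]mul1r ler_pdivlMr//.
have -> : (\sum_(k < n) k.+1%:R * r ^+ k) * (1 - r) ^+ 2 =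
   1 - r ^+ n * (1 + n%:R * (1 - r)).
  elim: n => [|n IH]; first by rewrite big_ord0 expr0; ring.
  by rewrite big_ord_recr /= mulrDl IH (exprS r) -natr1; ring.
rewrite lerBlDr lerDl mulr_ge0 ?exprn_ge0// addr_ge0// mulr_ge0//.
by rewrite subr_ge0 ltW.
Qed.

(** The gradient of the tracial logarithm at [a] is the inverse of [a]. The constant depends on the
    bounds [d] and [C] alone, which makes the estimate uniform along paths. *)
Lemma ldC_grad d C : exists2 K : R, 0 <= K & forall a b a' h,
  bnd d C a -> bnd d C b -> isinv a a' -> nb (b - a) h ->
  `|ldC C b - ldC C a - t (a' * (b - a))| <= K * h ^+ 2.
Proof.
have [[C0 d0 dC]|none] := pselect [/\ 0 < C, 0 < d & d <= C]; last first.
  exists 0 => // a b a' h bA; exfalso; apply: none.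
  by split; [exact: bnd_gt0 bA|case: bA|exact: bnd_le bA].
set r := 1 - d / (2 * C).
have r1 : r < 1 by rewrite gtrBl divr_gt0// mulr_gt0.
have r0 : 0 < r by rewrite subr_gt0 ltr_pdivrMr ?mulr_gt0// mul1r; lra.
exists (r * (1 - r) ^- 2 / r ^+ 2 / C ^+ 2).
  do 2 (apply: divr_ge0; last exact: sqr_ge0).
  by apply: divr_ge0; [exact: ltW|exact: sqr_ge0].
move=> a b a' h bA bB ia nh.
have [_ _ nX] := gap_nb bA; have [_ _ nY] := gap_nb bB; rewrite -/r in nX nY.
set X := gap C a in nX *; set Y := gap C b in nY *.
have Hd : Y - X = - (C^-1 *: (b - a)).
  by rewrite /Y /X /gap opprB addrC addrA subrK scalerBr opprB.
have nH : nb (Y - X) (h / C).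
  rewrite Hd; apply: nbN; have := nbZ C^-1 nh.
  by rewrite gtr0_norm ?invr_gt0// mulrC.
(* The first-order part of the series. It telescopes because (1 - X) a' = 1 / C, so that the
   geometric series of [X] sums to C a'. *)
pose lin := series (fun k => t (X ^+ k * (Y - X))).
have linE n : lin n = C * t (a' * (Y - X)) - C * t (X ^+ n * (a' * (Y - X))).
  rewrite /lin /series /=; elim: n => [|n IH].
    by rewrite big_geq// expr0 mul1r subrr.
  rewrite big_nat_recr//= IH.
  suff -> : t (X ^+ n * (Y - X)) =
      C * t (X ^+ n * (a' * (Y - X))) - C * t (X ^+ n.+1 * (a' * (Y - X))) by ring.
  rewrite exprSr -mulrBr -trB -trZ; congr (t _).
  have -> : X ^+ n * (a' * (Y - X)) - X ^+ n * X * (a' * (Y - X)) =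
     X ^+ n * ((1 - X) * a') * (Y - X) by Ncring_tac.non_commutative_ring.
  have -> : 1 - X = C^-1 *: a by rewrite /X /gap opprB addrC subrK.
  case: ia => i1 i2; rewrite -scalerAl i1 -scalerAr -scalerAl scalerA divff ?gt_eqF//.
  by rewrite scale1r mulr1.
have [k k0 nk] := nb_bounded T (a' * (Y - X)).
have rn0 : (fun n => r ^+ n) @ \oo --> (0 : R).
  by apply: cvg_expr; rewrite gtr0_norm.
have tail0 : (fun n => t (X ^+ n * (a' * (Y - X)))) @ \oo --> (0 : R).
  apply/norm_cvg0P.
  apply: (@squeeze_cvgr _ _ _ _ (fun=> 0) (fun n => r ^+ n * k)).
  - near=> n; rewrite normr_ge0 /=; apply: nb_tr; apply: nbM => //; exact: nbX.
  - exact: cvg_cst.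
  - by rewrite -[X in _ --> X](mul0r k); apply: cvgMl.
have linL : lin @ \oo --> - t (a' * (b - a)).
  have -> : lin = fun n => C * t (a' * (Y - X)) - C * t (X ^+ n * (a' * (Y - X))).
    by apply/funext => n; exact: linE.
  have -> : - t (a' * (b - a)) = C * t (a' * (Y - X)) - C * 0.
    by rewrite Hd mulrN -scalerAr trN trZ mulrN mulrA divff ?gt_eqF// mul1r mulr0 subr0.
  by apply: cvgB; [exact: cvg_cst|apply: cvgMr].
have cX := cvg_ldser bA; have cY := cvg_ldser bB.
rewrite /ldC.
have -> : ln C - limn (ldser C b) - (ln C - limn (ldser C a)) - t (a' * (b - a)) =
   - (limn (ldser C b) - limn (ldser C a) - - t (a' * (b - a))) by ring.
rewrite normrN.
have L : (fun n => `|ldser C b n - ldser C a n - lin n|) @ \oo -->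
    `|limn (ldser C b) - limn (ldser C a) - - t (a' * (b - a))|.
  by apply: cvg_norm; apply: cvgB => //; exact: cvgB.
rewrite -(cvg_lim _ L)//; apply: limr_le; first by apply/cvg_ex; eexists; exact: L.
near=> n; rewrite /ldser /lin /series /= -!sumrB.
apply: le_trans (ler_norm_sum _ _ _) _.
apply: (@le_trans _ _ (\sum_(0 <= i < n) (i.+1%:R * r ^+ i) * (r * ((h / C) / r) ^+ 2))).
  apply: ler_sum_nat => i _; rewrite -/X -/Y.
  have := power_diff2 r0 nX nY nH i.+1 0; rewrite expr0 mulr1 addn0 /= trB => pd.
  have i0 : (i.+1%:R : R) != 0 by rewrite pnatr_eq0.
  set p := t (Y ^+ i.+1) in pd *; set q := t (X ^+ i.+1) in pd *.
  set v := t (X ^+ i * _) in pd *.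
  have -> : p / i.+1%:R - q / i.+1%:R - v = (p - q - i.+1%:R * v) / i.+1%:R.
    by rewrite !mulrBl -mulrA mulrCA divff// mulr1.
  rewrite normrM normfV (ger0_norm (ler0n _ i.+1)) ler_pdivrMr ?ltr0n//.
  apply: le_trans pd _; rewrite (exprS r i); apply: le_of_eq; ring.
rewrite -mulr_suml big_mkord.
have -> : r * (1 - r) ^- 2 / r ^+ 2 / C ^+ 2 * h ^+ 2 =
   (1 - r) ^- 2 * (r * ((h / C) / r) ^+ 2).
  field; by rewrite (gt_eqF r0) (gt_eqF C0) subr_eq0 (gt_eqF r1).
apply: ler_wpM2r; first by rewrite mulr_ge0 ?sqr_ge0// ltW.
apply: sum_arith_geom => //; exact: ltW.
Unshelve. all: by end_near.
Qed.

End LogDet.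

(** The tangent inequalities at [x] and at [y] enclose the error; they differ by (y - x)^2 / (x
    y). *)
Lemma ln_quadratic (R : realType) (d x y : R) : 0 < d -> d <= x -> d <= y ->
  `|ln y - ln x - x^-1 * (y - x)| <= d ^- 2 * (y - x) ^+ 2.
Proof.
move=> d0 dx dy; have x0 : 0 < x by exact: lt_le_trans dx.
have y0 : 0 < y by exact: lt_le_trans dy.
have up (a b : R) : 0 < a -> 0 < b -> ln b - ln a <= a^-1 * (b - a).
  move=> a0 b0; rewrite -ln_div ?posrE//.
  have -> : b / a = 1 + (a^-1 * (b - a)) by field; rewrite gt_eqF.
  apply: le_ln1Dx.
  have -> : a^-1 * (b - a) = b / a - 1 by field; rewrite gt_eqF.
  by rewrite ltrBDl subrr divr_gt0.
have h1 := up x y x0 y0; have h2 := up y x y0 x0.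
rewrite ler0_norm; last by rewrite subr_le0.
apply: (@le_trans _ _ ((x * y)^-1 * (y - x) ^+ 2)).
  have -> : (x * y)^-1 * (y - x) ^+ 2 = x^-1 * (y - x) + y^-1 * (x - y).
    by field; rewrite !gt_eqF.
  by move: h2; lra.
apply: ler_wpM2r; first exact: sqr_ge0.
rewrite lef_pV2 ?posrE ?mulr_gt0 ?exprn_gt0//.
by rewrite expr2; apply: ler_pM => //; exact: ltW.
Qed.

(** * The log-determinant: scale independence, multiplicativity, monotonicity, corners *)

Section LogDetTheory.
Variables (R : realType) (A : algType R) (T : tracial A).
Local Notation st := (star T).
Local Notation t := (tr T).
Local Notation pos := (pos T).
Local Notation nb := (nb T).
Local Notation bnd := (bnd T).
Local Notation ldC := (ldC T).
Implicit Types (a b x y u : A) (c d e : R).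

(** The linear terms of [ldC_grad] for the two paths cancel, so [quadratic_cst] applies to the
    difference. Independence of the scale and the conjugation formula are both instances. *)
Lemma ldC_affine d C d' C' (p0 p1 q0 q1 : A) :
  (forall s, 0 <= s -> s <= 1 -> bnd d C (p0 + s *: p1)) ->
  (forall s, 0 <= s -> s <= 1 -> bnd d' C' (q0 + s *: q1)) ->
  (forall s x y, 0 <= s -> s <= 1 -> isinv (p0 + s *: p1) x ->
     isinv (q0 + s *: q1) y -> t (x * p1) = t (y * q1)) ->
  ldC C (p0 + p1) - ldC C p0 = ldC C' (q0 + q1) - ldC C' q0.
Proof.
move=> hp hq hpq.
have [K K0 hK] := ldC_grad T d C; have [L L0 hL] := ldC_grad T d' C'.
have [h h0 nh] := nb_bounded T p1; have [k k0 nk] := nb_bounded T q1.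
have := @quadratic_cst _ (fun s => ldC C (p0 + s *: p1) - ldC C' (q0 + s *: q1))
  (K * h ^+ 2 + L * k ^+ 2).
rewrite !scale1r !scale0r !addr0 => main.
suff : ldC C (p0 + p1) - ldC C' (q0 + q1) = ldC C p0 - ldC C' q0 by lra.
apply: main => x y x0 xy y1.
have y0 := le_trans x0 xy; have x1 := le_trans xy y1.
have bp := hp _ x0 x1; have bq := hq _ x0 x1.
have [p' ip] := bnd_inv bp; have [q' iq] := bnd_inv bq.
have e := hpq _ _ _ x0 x1 ip iq.
have dp : p0 + y *: p1 - (p0 + x *: p1) = (y - x) *: p1.
  by rewrite opprD addrACA subrr add0r scalerBl.
have dq : q0 + y *: q1 - (q0 + x *: q1) = (y - x) *: q1.
  by rewrite opprD addrACA subrr add0r scalerBl.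
have := hK _ _ p' (`|y - x| * h) bp (hp _ y0 y1) ip.
rewrite dp => /(_ (nbZ _ nh)) g1.
have := hL _ _ q' (`|y - x| * k) bq (hq _ y0 y1) iq.
rewrite dq => /(_ (nbZ _ nk)) g2.
move: g1 g2; rewrite !trMZ e !exprMn !real_normK ?num_real//.
set u := ldC _ _ - _; set v := ldC _ _ - _; set w := _ * t _ => g1 g2.
have -> : forall X Y Z W : R, X - Y - (Z - W) = (X - Z - w) - (Y - W - w).
  by move=> X Y Z W; ring.
apply: le_trans (ler_normB _ _) _; apply: le_trans (lerD g1 g2) _.
by apply: le_of_eq; ring.
Qed.

Lemma bnd_scalar d C c : 0 < d -> d <= c -> c <= C -> bnd d C (c *: 1).
Proof.
move=> d0 dc cC; split => //; rewrite -scalerBl; apply: pos_scalar;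
  by rewrite subr_ge0.
Qed.

(** At [C] every term of the series vanishes; along the scalars from [C] down to [c] both sides have
    the same derivative. *)
Lemma ldC_scalar C c : 0 < c -> c <= C -> ldC C (c *: 1) = ln c.
Proof.
move=> c0 cC; have C0 := lt_le_trans c0 cC.
have top : ldC C (C *: 1) = ln C.
  rewrite /ldC; suff -> : ldser T C (C *: 1) = fun=> 0 by rewrite lim_cst// subr0.
  apply/funext => n; rewrite /ldser /series /=.
  rewrite big1// => k _; rewrite /gap scalerA mulVf ?gt_eqF// scale1r subrr.
  by rewrite expr0n /= raddf0 mul0r.
have [K K0 hK] := ldC_grad T c C.
have := @quadratic_cst _ (fun s => ldC C ((C + s * (c - C)) *: 1) - ln (C + s * (c - C)))
  ((K + c ^- 2) * (c - C) ^+ 2).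
rewrite !mul1r !mul0r addr0 top subrr addrCA subrr addr0 => main.
apply/eqP; rewrite -subr_eq0; apply/eqP; apply: main => x y x0 xy y1.
have y0 := le_trans x0 xy; have x1 := le_trans xy y1.
have r1 (s : R) : 0 <= s -> s <= 1 -> c <= C + s * (c - C) /\ C + s * (c - C) <= C.
  by move=> s0 s1; split; nra.
have [cx Cx] := r1 _ x0 x1; have [cy Cy] := r1 _ y0 y1.
set X := C + x * _ in cx Cx *; set Y := C + y * _ in cy Cy *.
have ix : isinv (X *: 1 : A) (X^-1 *: 1).
  have X0 : X != 0 by rewrite gt_eqF// (lt_le_trans c0).
  by split; rewrite -scalerAl mul1r scalerA ?mulfV ?mulVf// scale1r.
have n1 : nb (Y *: 1 - X *: 1) (`|Y - X| * 1).
  by rewrite -scalerBl; apply: nbZ; exact: nb1.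
have := hK _ _ _ _ (bnd_scalar c0 cx Cx) (bnd_scalar c0 cy Cy) ix n1.
rewrite -scalerBl -scalerAl mul1r !trZ tr1 !mulr1 real_normK ?num_real// => g1.
have g2 := ln_quadratic c0 cx cy.
have e : Y - X = (y - x) * (c - C) by rewrite /X /Y; ring.
have -> : ldC C (Y *: 1) - ln Y - (ldC C (X *: 1) - ln X) =
   (ldC C (Y *: 1) - ldC C (X *: 1) - X^-1 * (Y - X)) -
   (ln Y - ln X - X^-1 * (Y - X)) by ring.
apply: le_trans (ler_normB _ _) _; apply: le_trans (lerD g1 g2) _.
by apply: le_of_eq; rewrite e; ring.
Qed.

Lemma bnd_segment d C a s : d <= 1 -> 1 <= C -> bnd d C a -> 0 <= s -> s <= 1 ->
  bnd d C (1 + s *: (a - 1)).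
Proof.
move=> d1 C1 [d0 h1 h2] s0 s1; have s1' : 0 <= 1 - s by rewrite subr_ge0.
split=> //.
  have -> : 1 + s *: (a - 1) - d *: 1 = (1 - s) *: ((1 - d) *: 1) + s *: (a - d *: 1).
    by scale_ring.
  apply: posD; apply: posZ => //; apply: pos_scalar; by rewrite subr_ge0.
have -> : C *: 1 - (1 + s *: (a - 1)) = (1 - s) *: ((C - 1) *: 1) + s *: (C *: 1 - a).
  by scale_ring.
by apply: posD; apply: posZ => //; apply: pos_scalar; rewrite subr_ge0.
Qed.

(** Both scales give 0 at 1, and the derivative along the segment from 1 to [a] does not involve the
    scale. *)
Lemma ldC_indep1 d C a : 1 <= C -> bnd d C a -> forall C', C <= C' -> ldC C a = ldC C' a.
Proof.
move=> C1 h C' CC'; have [d0 _ _] := h.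
have h1 : bnd (Num.min d 1) C a.
  by apply: bnd_weak h; rewrite ?lt_min ?d0 ?ltr01 ?ge_min ?lexx.
have h2 : bnd (Num.min d 1) C' a by have [h0 _ _] := h1; apply: bnd_weak h1.
have m1 : Num.min d 1 <= 1 by rewrite ge_min lexx orbT.
have C'1 := le_trans C1 CC'.
have := @ldC_affine (Num.min d 1) C (Num.min d 1) C' 1 (a - 1) 1 (a - 1).
rewrite addrCA subrr addr0 -[X in ldC C X]scale1r -[X in ldC C' X]scale1r.
have E D : 1 <= D -> ldC D 1 = 0.
  by move=> D1; have := @ldC_scalar D 1 ltr01 D1; rewrite scale1r ln1.
rewrite !scale1r !E// !subr0; apply.
- by move=> s s0 s1; exact: bnd_segment.
- by move=> s s0 s1; exact: bnd_segment.
- by move=> s x y _ _ i1 i2; rewrite (isinv_unique i1 i2).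
Qed.

Definition spos a := exists2 d : R, 0 < d & pos (a - d *: 1).

(** [xget] picks some scale; one exists for positive [a], and for strictly positive [a] the value
    does not depend on it ([ldetE]). *)
Definition ldet a := ldC (xget 1 [set C : R | 1 <= C /\ pos (C *: 1 - a)]) a.

Lemma spos_bnd a : spos a -> exists d C, [/\ d <= 1, 1 <= C & bnd d C a].
Proof.
move=> [d d0 h].
have pa : pos a by have := posD h (pos_scalar T (ltW d0)); rewrite subrK.
have [C C1 hC] := pos_upper pa.
exists (Num.min d 1), C; split => //; first by rewrite ge_min lexx orbT.
by apply: (@bnd_weak _ _ _ d C); rewrite ?lt_min ?d0 ?ltr01 ?ge_min ?lexx.
Qed.

Lemma bnd_spos d C a : bnd d C a -> spos a.
Proof. by case=> d0 h _; exists d. Qed.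

Lemma spos_pos a : spos a -> pos a.
Proof. by move=> /spos_bnd [d [C [_ _]]] /bnd_pos. Qed.

Lemma ldetE d C a : 1 <= C -> bnd d C a -> ldet a = ldC C a.
Proof.
move=> C1 h; rewrite /ldet.
have [D1 hD] : [set C : R | 1 <= C /\ pos (C *: 1 - a)]
    (xget 1 [set C : R | 1 <= C /\ pos (C *: 1 - a)]).
  by apply: xgetPex; exists C; split => //; case: h.
set D := xget _ _ in D1 hD *.
have h2 : bnd d D a by case: h.
have [CD|/ltW DC] := leP C D; first by rewrite (ldC_indep1 C1 h CD).
by rewrite (ldC_indep1 D1 h2 DC).
Qed.

Lemma ldet_scalar c : 0 < c -> ldet (c *: 1) = ln c.
Proof.
move=> c0; have h : bnd c (Num.max c 1) (c *: 1).
  by apply: bnd_scalar; rewrite ?le_max ?lexx.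
have C1 : 1 <= Num.max c 1 by rewrite le_max lexx orbT.
by rewrite (ldetE C1 h) ldC_scalar// le_max lexx.
Qed.

Lemma ldet1 : ldet 1 = 0.
Proof. by have := ldet_scalar ltr01; rewrite scale1r ln1. Qed.

Lemma spos1 : spos 1.
Proof. by exists 1; rewrite ?scale1r ?subrr//; exact: pos0. Qed.

Lemma spos_addl a c : 0 < c -> pos a -> spos (a + c *: 1).
Proof. by move=> c0 pa; exists c => //; rewrite addrK. Qed.

Lemma isinv_sq_ge u u' : isinv u u' ->
  exists2 k : R, 0 < k & pos (u * st u - k *: 1).
Proof.
move=> [h1 h2]; have [K K1 [_ hK]] := nb_pos_bounded T (st u').
have K0 : 0 < K by apply: lt_le_trans K1.
exists (K ^- 2); first by rewrite invr_gt0 exprn_gt0.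
have := pos_conj (st u) hK; rewrite !starK mulrBr mulrBl -scalerAr mulr1 -scalerAl.
have -> : u * (u' * st u') * st u = 1.
  by rewrite mulrA h1 mul1r -starM h1 star1.
have K2 : 0 < K ^+ 2 by rewrite exprn_gt0.
move/(posZ (ltW (_ : 0 < (K ^+ 2)^-1))); rewrite invr_gt0 => /(_ K2).
by rewrite scalerBr scalerA mulVf ?scale1r// gt_eqF.
Qed.

Lemma spos_conj u u' a : isinv u u' -> spos a -> spos (u * a * st u).
Proof.
move=> iu [d d0 h]; have [k k0 hk] := isinv_sq_ge iu.
exists (d * k); first exact: mulr_gt0.
have h1 := pos_conj (st u) h; rewrite starK mulrBr mulrBl -scalerAr mulr1 -scalerAl in h1.
have h2 := posZ (ltW d0) hk; rewrite scalerBr scalerA in h2.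
exact: (pos_trans h2 h1).
Qed.

Lemma spos_sq u u' : isinv u u' -> spos (u * st u).
Proof. by move=> iu; have := spos_conj iu spos1; rewrite mulr1. Qed.

Lemma bnd_conj u u' d C : isinv u u' -> 0 < d -> exists d' C', 1 <= C' /\
  forall a, bnd d C a -> bnd d' C' (u * a * st u).
Proof.
move=> iu d0; have [k k0 hk] := isinv_sq_ge iu.
have [L L1 [_ hL]] := nb_pos_bounded T (st u); rewrite starK in hL.
exists (d * k), (Num.max (C * L ^+ 2) 1); split; first by rewrite le_max lexx orbT.
move=> a ha; have C0 := bnd_gt0 ha; case: ha => _ h1 h2; split.
- exact: mulr_gt0.
- have h3 := pos_conj (st u) h1.
  rewrite starK mulrBr mulrBl -scalerAr mulr1 -scalerAl in h3.
  have h4 := posZ (ltW d0) hk; rewrite scalerBr scalerA in h4.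
  exact: (pos_trans h4 h3).
- have h3 := pos_conj (st u) h2.
  rewrite starK mulrBr mulrBl -scalerAr mulr1 -scalerAl in h3.
  have h4 := posZ (ltW C0) hL; rewrite scalerBr scalerA in h4.
  apply: (pos_le_scalar (_ : C * L ^+ 2 <= _)); first by rewrite le_max lexx.
  exact: (pos_trans h3 h4).
Qed.

(** Along the segment from 1 to [a], cyclicity of the trace gives the segment and its conjugate the
    same logarithmic derivative; at 1 the conjugate is [u * st u]. *)
Lemma ldet_conj u u' a : isinv u u' -> spos a ->
  ldet (u * a * st u) = ldet a + ldet (u * st u).
Proof.
move=> iu pa; have [d [C [d1 C1 ba]]] := spos_bnd pa.
have d0 : 0 < d by case: ba.
have [d' [C' [C'1 hC']]] := bnd_conj C iu d0.
have seg s : 0 <= s -> s <= 1 -> bnd d C (1 + s *: (a - 1)) by exact: bnd_segment.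
have b1 : bnd d C 1 by have := seg 0 (lexx _) ler01; rewrite scale0r addr0.
have b2 := hC' _ b1; rewrite mulr1 in b2.
rewrite (ldetE C1 ba) (ldetE C'1 (hC' _ ba)) (ldetE C'1 b2).
have := @ldC_affine d C d' C' 1 (a - 1) (u * st u) (u * (a - 1) * st u).
have E1 : u * st u + u * (a - 1) * st u = u * a * st u.
  by Ncring_tac.non_commutative_ring.
have E s : u * st u + s *: (u * (a - 1) * st u) = u * (1 + s *: (a - 1)) * st u.
    by rewrite (mulrDr u 1) mulr1 (mulrDl u) -scalerAr -scalerAl.
rewrite addrCA subrr addr0 E1 -(ldetE C1 b1) ldet1 subr0.
move=> -> //; first by ring.
  by move=> s s0 s1; rewrite E; apply: hC'; exact: seg.
move=> s x y s0 s1 ix; rewrite E => iy.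
have iq : isinv (u * (1 + s *: (a - 1)) * st u) (st u' * (x * u')).
  by apply: isinvM; [exact: isinvM|exact: isinv_star].
rewrite (isinv_unique iy iq).
have -> : st u' * (x * u') * (u * (a - 1) * st u) =
   st u' * (x * (u' * u) * (a - 1) * st u) by Ncring_tac.non_commutative_ring.
case: iu => i1 i2; rewrite i2 mulr1 (trC T (st u')) -!mulrA -starM i2.
by rewrite star1 mulr1.
Qed.

(** [ldet (u * st u)] plays the role of 2 ln Delta(u), and this is the multiplicativity of Delta. *)
Lemma ldet_mul u u' v v' : isinv u u' -> isinv v v' ->
  ldet (u * v * st (u * v)) = ldet (u * st u) + ldet (v * st v).
Proof.
move=> iu iv; rewrite starM.
have -> : u * v * (st v * st u) = u * (v * st v) * st u.
  by Ncring_tac.non_commutative_ring.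
by rewrite (ldet_conj iu (spos_sq iv)) addrC.
Qed.

Lemma ldet_unitary u : u * st u = 1 -> ldet (u * st u) = 0.
Proof. by move=> ->; exact: ldet1. Qed.

(** The derivative along the segment is the trace of a product of two positive elements, nonnegative
    by [tr_mul_pos]. *)
Lemma ldet_le a b : spos a -> pos (b - a) -> ldet a <= ldet b.
Proof.
move=> pa ab; have [d [C [d1 C1 ba]]] := spos_bnd pa.
have [D D1 hD] := pos_upper (posD (spos_pos pa) ab).
rewrite (addrC a) subrK in hD.
have d0 : 0 < d by case: ba.
have [K K0 hK] := ldC_grad T d (Num.max C D).
have [h h0 nh] := nb_bounded T (b - a).
have M1 : 1 <= Num.max C D by rewrite le_max C1.
have seg s : 0 <= s -> s <= 1 -> bnd d (Num.max C D) (a + s *: (b - a)).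
  move=> s0 s1; case: ba => _ g1 g2; split => //.
    by rewrite addrAC; apply: posD => //; exact: posZ.
  apply: (pos_le_scalar (_ : D <= _)); first by rewrite le_max lexx orbT.
  have -> : D *: 1 - (a + s *: (b - a)) = (D *: 1 - b) + (1 - s) *: (b - a).
    by scale_ring.
  by apply: posD => //; apply: posZ => //; rewrite subr_ge0.
have := seg 1 ler01 (lexx _); have := seg 0 (lexx _) ler01.
rewrite scale0r scale1r addr0 addrCA subrr addr0 => s0' s1'.
rewrite (ldetE M1 s0') (ldetE M1 s1').
have := @quadratic_le _ (fun s => ldC (Num.max C D) (a + s *: (b - a))) (K * h ^+ 2).
rewrite scale0r scale1r addr0 (addrCA a) subrr addr0; apply => x y x0 xy y1.
have bx := seg _ x0 (le_trans xy y1); have by' := seg _ (le_trans x0 xy) y1.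
have [p ip] := bnd_inv bx.
have dp : a + y *: (b - a) - (a + x *: (b - a)) = (y - x) *: (b - a).
  by rewrite opprD addrACA subrr add0r -scalerBl.
have := hK _ _ p (`|y - x| * h) bx by' ip.
rewrite dp => /(_ (nbZ _ nh)); rewrite trMZ exprMn real_normK ?num_real//.
have g : 0 <= (y - x) * t (p * (b - a)).
  apply: mulr_ge0; first by rewrite subr_ge0.
  by apply: tr_mul_pos => //; apply: isinv_pos ip; exact: bnd_pos bx.
rewrite ler_norml => /andP[g1 g2].
by move: g1 g; rewrite (mulrC (_ ^+ 2)) mulrA; lra.
Qed.

(** The element [x] intertwines the polynomials in [st x * x] with those in [x * st x], so cyclicity
    makes all their moments agree. *)
Lemma tr_gap_swap x (c d : R) n :
  t ((c *: 1 - d *: (st x * x)) ^+ n) = t ((c *: 1 - d *: (x * st x)) ^+ n).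
Proof.
have inter k : x * (c *: 1 - d *: (st x * x)) ^+ k = (c *: 1 - d *: (x * st x)) ^+ k * x.
  elim: k => [|k IH]; first by rewrite !expr0 mulr1 mul1r.
  rewrite exprSr mulrA IH exprSr -!mulrA; congr (_ * _).
  by rewrite mulrBr mulrBl -!(scalerAl, scalerAr) mulr1 mul1r !mulrA.
elim: n => [|n IH]; first by rewrite !expr0.
rewrite !exprS !mulrBl !trB -!scalerAl !mul1r !trZ IH; congr (_ - _ * _).
by rewrite -mulrA inter trC -mulrA trC.
Qed.

Lemma ldet_swap x e : 0 < e -> ldet (st x * x + e *: 1) = ldet (x * st x + e *: 1).
Proof.
move=> e0.
have h1 : spos (st x * x + e *: 1) by apply: spos_addl => //; exact: pos_sq.
have h2 : spos (x * st x + e *: 1) by apply: spos_addl => //; exact: pos_sq'.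
have [d [C [_ C1 b1]]] := spos_bnd h1; have [d' [C' [_ C1' b2]]] := spos_bnd h2.
have b1' : bnd d (Num.max C C') (st x * x + e *: 1).
  by have [h0 _ _] := b1; apply: bnd_weak b1; rewrite ?le_max ?lexx.
have b2' : bnd d' (Num.max C C') (x * st x + e *: 1).
  by have [h0 _ _] := b2; apply: bnd_weak b2; rewrite ?le_max ?lexx ?orbT.
have M1 : 1 <= Num.max C C' by rewrite le_max C1.
rewrite (ldetE M1 b1') (ldetE M1 b2') /ldC; congr (_ - limn _).
apply/funext => n; rewrite /ldser /series /=; apply: eq_bigr => k _; congr (_ / _).
set M := Num.max _ _.
have E y : gap M (y + e *: 1) = (1 - M^-1 * e) *: 1 - M^-1 *: y.
  by rewrite /gap scalerDr scalerA scalerBl scale1r opprD addrA addrAC.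
by rewrite !E tr_gap_swap.
Qed.

(* Invertible factors pass through the regularisation at the cost of rescaling it. *)
Lemma ldet_sandwich u u' x : isinv u u' -> pos x -> exists2 K : R, 1 <= K &
  forall e, 0 < e ->
    ldet (x + (e / K) *: 1) + ldet (u * st u) <= ldet (u * x * st u + e *: 1) /\
    ldet (u * x * st u + e *: 1) <= ldet (x + (e * K) *: 1) + ldet (u * st u).
Proof.
move=> iu px; have [k k0 hk] := isinv_sq_ge iu.
have [L L1 [_ hL]] := nb_pos_bounded T (st u); rewrite starK in hL.
pose K := Num.max (L ^+ 2) k^-1.
have L21 : 1 <= L ^+ 2 by rewrite expr_ge1// (le_trans ler01).
have K1 : 1 <= K by rewrite le_max L21.
have K0 : 0 < K by apply: lt_le_trans K1.
exists K => // e e0.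
have eK : 0 < e / K by exact: divr_gt0.
have eK' : 0 < e * K by exact: mulr_gt0.
have E c : u * (x + c *: 1) * st u = u * x * st u + c *: (u * st u).
  by rewrite mulrDr mulrDl -scalerAr mulr1 -scalerAl.
split; rewrite -(ldet_conj iu) ?E; try exact: spos_addl.
  apply: ldet_le; first by rewrite -E; apply: (spos_conj iu); exact: spos_addl.
  rewrite opprD addrACA subrr add0r.
  have -> : e *: 1 - (e / K) *: (u * st u) = (e / K) *: (K *: 1 - u * st u).
    by rewrite scalerBr scalerA divfK ?gt_eqF.
  apply: posZ; first exact: ltW.
  by apply: (pos_le_scalar _ hL); rewrite le_max lexx.
apply: ldet_le.
  apply: spos_addl => //; by have := pos_conj (st u) px; rewrite starK.
rewrite opprD addrACA subrr add0r.
have -> : (e * K) *: (u * st u) - e *: 1 = (e * K) *: (u * st u - K^-1 *: 1).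
  by rewrite scalerBr scalerA mulfK ?gt_eqF.
apply: posZ; first exact: ltW.
apply: pos_ge_scalar hk; rewrite -[leRHS]invrK lef_pV2 ?posrE ?invr_gt0//.
by rewrite le_max lexx orbT.
Qed.

(** The gap of [1 - f + f * a] is the direct sum of the gaps of 1 and [a], hence each term of its
    series is the mean of the two. The trace hypothesis says that [f] has trace 1/2 and that [a] has
    the same moments in the corner of [f] as in the whole algebra. *)
Lemma ldet_corner f a : f * f = f -> st f = f -> f * a = a * f ->
  (forall C n, t (f * gap C a ^+ n) = t (gap C a ^+ n) / 2) -> spos a ->
  spos (1 - f + f * a) /\ ldet (1 - f + f * a) = ldet a / 2.
Proof.
move=> ff sf fa tf pa; have [d [C [d1 C1 ba]]] := spos_bnd pa.
have d0 : 0 < d by case: ba.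
have sf' : st (1 - f) = 1 - f by rewrite starB star1 sf.
have ff' : (1 - f) * (1 - f) = 1 - f.
  have -> : (1 - f) * (1 - f) = 1 - f - f + f * f by Ncring_tac.non_commutative_ring.
  by rewrite ff subrK.
have bZ : bnd d C (1 - f + f * a).
  case: ba => _ h1 h2; split => //.
    have -> : 1 - f + f * a - d *: 1 = (1 - d) *: (st (1 - f) * (1 - f)) +
        st f * (a - d *: 1) * f.
      rewrite sf' ff' sf mulrBr mulrBl -scalerAr mulr1 -scalerAl ff -mulrA -fa mulrA ff.
      rewrite !scalerBl !scale1r !scalerBr.
      by Ncring_tac.non_commutative_ring.
    apply: posD; last exact: pos_conj.
    by apply: posZ; [rewrite subr_ge0|exact: pos_sq].
  have -> : C *: 1 - (1 - f + f * a) = (C - 1) *: (st (1 - f) * (1 - f)) +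
      st f * (C *: 1 - a) * f.
    rewrite sf' ff' sf mulrBr mulrBl -scalerAr mulr1 -scalerAl ff -mulrA -fa mulrA ff.
    rewrite !scalerBl !scale1r !scalerBr.
    by Ncring_tac.non_commutative_ring.
  apply: posD; last exact: pos_conj.
  by apply: posZ; [rewrite subr_ge0|exact: pos_sq].
split; first exact: bnd_spos bZ.
have b1 : bnd d C 1.
  by have := @bnd_segment d C a 0 d1 C1 ba (lexx _) ler01; rewrite scale0r addr0.
have E1 := ldet1; rewrite (ldetE C1 b1) in E1.
rewrite (ldetE C1 bZ) (ldetE C1 ba).
suff -> : ldC C (1 - f + f * a) = (ldC C 1 + ldC C a) / 2 by rewrite E1 add0r.
have c1 := cvg_ldser b1; have c2 := cvg_ldser ba.
rewrite /ldC.
have -> : ldser T C (1 - f + f * a) = fun n => 2^-1 * ldser T C 1 n + 2^-1 * ldser T C a n.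
  apply/funext => n; rewrite /ldser /series /= -mulrDr -big_split /= mulr_sumr.
  apply: eq_bigr => k _.
  have prod p q p' q' : p * f = f * p -> q * f = f * q ->
      ((1 - f) * p + f * q) * ((1 - f) * p' + f * q') = (1 - f) * (p * p') + f * (q * q').
    move=> pf qf.
    have -> : ((1 - f) * p + f * q) * ((1 - f) * p' + f * q') =
        (1 - f) * (p - p * f) * p' + (1 - f) * (p * f) * q' +
        f * (q - q * f) * p' + f * (q * f) * q' by Ncring_tac.non_commutative_ring.
    rewrite pf qf.
    have -> : (1 - f) * (p - f * p) * p' + (1 - f) * (f * p) * q' +
        f * (q - f * q) * p' + f * (f * q) * q' =
        (1 - f) * (1 - f) * (p * p') + (f - f * f) * (p * q') +
        (f - f * f) * (q * p') + f * f * (q * q') by Ncring_tac.non_commutative_ring.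
    by rewrite ff' ff subrr !mul0r !addr0.
  have gf x : x * f = f * x -> gap C x * f = f * gap C x.
    by move=> xf; rewrite /gap mulrBr mulrBl mulr1 mul1r -scalerAr -scalerAl xf.
  have gZ m : gap C (1 - f + f * a) ^+ m = (1 - f) * gap C 1 ^+ m + f * gap C a ^+ m.
    elim: m => [|m IH]; first by rewrite !expr0 !mulr1 subrK.
    have g0 : gap C (1 - f + f * a) = (1 - f) * gap C 1 + f * gap C a.
      rewrite /gap mulrBr (mulrBr f) !mulr1 -!scalerAr mulr1 scalerDr.
      by Ncring_tac.non_commutative_ring.
    rewrite exprS IH g0 prod; first by rewrite -!exprS.
      by apply: gf; rewrite mulr1 mul1r.
    by apply: gf; rewrite fa.
  have tf1 : t f = 2^-1.
    by have := tf C 0%N; rewrite expr0 mulr1 tr1 mul1r.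
  have g1 m : gap C 1 ^+ m = ((1 - C^-1) ^+ m) *: 1 :> A.
    have -> : gap C 1 = (1 - C^-1) *: 1 :> A by rewrite /gap scalerBl scale1r.
    by rewrite exprZn expr1n.
  rewrite gZ trD tf g1 -scalerAr mulr1 !trZ trB tr1 tf1.
  by field; rewrite nat1r pnatr_eq0.
have -> : limn (fun n => 2^-1 * ldser T C 1 n + 2^-1 * ldser T C a n) =
   2^-1 * limn (ldser T C 1) + 2^-1 * limn (ldser T C a).
  by apply: cvg_lim => //; apply: cvgD; apply: cvgMr.
by field.
Qed.

End LogDetTheory.

(** * The resolvent of a pencil in free skew involutions *)

Lemma cvg_sum0 (R : realType) (I : Type) (r : seq I) (F : I -> nat -> R) :
  (forall i, F i n @[n --> \oo] --> (0 : R)) ->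
  (\sum_(i <- r) F i n) @[n --> \oo] --> (0 : R).
Proof.
move=> hF; elim: r => [|i r IH].
  by under eq_fun do rewrite big_nil; exact: cvg_cst.
under eq_fun do rewrite big_cons.
suff : F i n + \sum_(j <- r) F j n @[n --> \oo] --> (0 + 0 : R) by rewrite addr0.
by apply: cvgD.
Qed.

Section FreeRotations.
Variables (R : realType) (A : algType R) (T : tracial A).
Local Notation st := (star T).
Local Notation t := (tr T).
Local Notation pos := (pos T).
Local Notation nb := (nb T).
Local Notation bnd := (bnd T).
Implicit Types (a b x y u : A) (c d e : R).

(** The constant is not sharp; it comes from the parallelogram identity, which needs only the order
    and no triangle inequality. *)
Lemma nbD a b K L : nb a K -> nb b L -> nb (a + b) (2 * (K + L)).
Proof.
move=> [K0 hK] [L0 hL]; split; first by rewrite mulr_ge0// addr_ge0.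
have h1 := posZ (ler0n R 2) (posD hK hL).
have h2 := pos_sq T (a - b).
have h3 : pos ((2 * K ^+ 2 + 8 * K * L + 2 * L ^+ 2) *: 1).
  by apply: pos_scalar; rewrite !addr_ge0 ?mulr_ge0 ?sqr_ge0.
have := posD (posD h1 h2) h3.
have -> : (2 * (K + L)) ^+ 2 =
    2 * K ^+ 2 + 2 * L ^+ 2 + (2 * K ^+ 2 + 8 * K * L + 2 * L ^+ 2) by ring.
congr pos; rewrite starB starD !scalerDr !scalerN !scalerA.
have two x : 2 *: x = x + x by rewrite scaler_nat mulr2n.
rewrite !two [in RHS]scalerDl [in RHS](scalerDl 1 (2 * K ^+ 2)).
by Ncring_tac.non_commutative_ring.
Qed.

Lemma nb_tr_sq x K : nb x K -> t (x * st x) <= K ^+ 2.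
Proof.
by move=> [K0 /pos_tr]; rewrite trB trZ tr1 mulr1 subr_ge0 (trC T x).
Qed.

Lemma isinv_two_sided x y z : x * y = 1 -> z * x = 1 -> isinv x y.
Proof.
move=> xy zx; split => //.
have -> : y = z by rewrite -[z]mulr1 -xy mulrA zx mul1r.
exact: zx.
Qed.

Variables (I : finType) (s : I -> A).
Hypothesis s_sq : forall i, s i * s i = -1.
Hypothesis s_star : forall i, st (s i) = - s i.
Hypothesis s_free : forall w : seq I, w != [::] -> sorted (fun i j => i != j) w ->
  t (\prod_(i <- w) s i) = 0.

Lemma nb_comb : exists2 K : R, 0 <= K & forall (c : I -> R) (d : R),
  0 <= d -> (forall i, `|c i| <= d) -> nb (\sum_i c i *: s i) (K * d).
Proof.
have main (r : seq I) : exists2 K : R, 0 <= K & forall (c : I -> R) (d : R),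
    0 <= d -> (forall i, `|c i| <= d) -> nb (\sum_(i <- r) c i *: s i) (K * d).
  elim: r => [|i r [K K0 IH]].
    exists 0 => // c d _ _; rewrite big_nil mul0r.
    by split => //; rewrite mulr0 subr0 expr0n /= scale0r; exact: pos0.
  exists (2 * (1 + K)); first by rewrite mulr_ge0// addr_ge0.
  move=> c d d0 hc; rewrite big_cons -mulrA (mulrDl 1 K) mul1r.
  apply: nbD; last exact: IH.
  rewrite -[d]mulr1; apply: (@nb_le _ _ _ _ (`|c i| * 1)).
    by rewrite !mulr1.
  apply: nbZ; split => //; rewrite s_star mulNr s_sq opprK expr1n scale1r subrr.
  exact: pos0.
exact: main.
Qed.

Section Resolvent.
Variable k : I -> R.

(** The sum of the reduced words of length n + 1 beginning with [s i], each weighted by the product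
    of the [- k] of its letters. All layers together with 1 form the inverse of [pencil], in the
    weak sense of [tr_pencil_limit]. *)
Fixpoint layer n i : A :=
  if n is n'.+1 then - k i *: (s i * \sum_(j | j != i) layer n' j) else - k i *: s i.

Lemma layerS n i : layer n.+1 i = - k i *: (s i * \sum_(j | j != i) layer n j).
Proof. by []. Qed.

Local Notation word w := (\prod_(i <- w) s i).
Local Notation reduced := (sorted (fun i j : I => i != j)).

Lemma word_rcons w i : word (rcons w i) = word w * s i.
Proof. by rewrite -cats1 big_cat big_seq1. Qed.

Lemma word_layer n w i : reduced (rcons w i) -> t (word w * layer n i) = 0.
Proof.
elim: n w i => [|n IH] w i wi.
  by rewrite /= -scalerAr trZ -word_rcons s_free ?mulr0//; case: (w).
rewrite layerS -scalerAr trZ mulrA mulr_sumr raddf_sum big1 ?mulr0// => j ji.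
rewrite -word_rcons; apply: IH; move: wi; rewrite -!cats1; case: w => [|a w] /=.
  by rewrite andbT eq_sym.
by rewrite !cat_path /= => /andP[-> /andP[-> _]]; rewrite last_cat /= eq_sym ji.
Qed.

Lemma layer_word_layer n m w i j : reduced (i :: rcons w j) ->
  t (st (layer n i) * word w * layer m j) = 0.
Proof.
elim: n w i => [|n IH] w i iwj.
  rewrite /= starZ s_star scalerN scaleNr opprK -!scalerAl trZ.
  have -> : s i * word w = word (i :: w) by rewrite big_cons.
  by rewrite word_layer// mulr0.
rewrite layerS starZ starM s_star mulrN scalerN scaleNr opprK -!scalerAl trZ.
rewrite raddf_sum !mulr_suml raddf_sum big1 ?mulr0// => l li.
have e : word (i :: w) = s i * word w by rewrite big_cons.
by rewrite -(mulrA _ (s i)) -e; apply: IH; move: iwj; rewrite /= li.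
Qed.

Lemma layer_orth n i j : i != j -> t (st (layer n i) * layer n j) = 0.
Proof.
move=> ij; have := @layer_word_layer n n [::] i j.
by rewrite big_nil mulr1; apply; rewrite /= ij.
Qed.

Definition weight n i : R := t (st (layer n i) * layer n i).

Lemma weight_ge0 n i : 0 <= weight n i.
Proof. exact: tr_sq_ge0. Qed.

(** Left multiplication by [s i] preserves the 2-norm, and layers with different first letters are
    orthogonal. *)
Lemma weightS n i : weight n.+1 i = k i ^+ 2 * (\sum_j weight n j - weight n i).
Proof.
rewrite /weight layerS starZ -scalerAl -scalerAr !trZ mulrA mulrNN -expr2.
congr (_ * _); rewrite starM s_star.
set P := \sum_(j | _) _.
have -> : st P * - s i * (s i * P) = st P * P.
  have -> : st P * - s i * (s i * P) = st P * (- (s i * s i)) * P.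
    by Ncring_tac.non_commutative_ring.
  by rewrite s_sq opprK mulr1.
rewrite /P raddf_sum mulr_suml raddf_sum.
rewrite [X in _ = X - _](bigD1 i)//= [in RHS]addrAC subrr add0r.
apply: eq_bigr => j ji; rewrite mulr_sumr raddf_sum (bigD1 j)//= big1 ?addr0//.
by move=> l /andP[li lj]; rewrite layer_orth// eq_sym.
Qed.

Let m i := k i ^+ 2.
Let p i := m i / (1 + m i).
Let sig := \sum_i p i.
Hypothesis sig1 : sig < 1.

Let m0 i : 0 < 1 + m i. Proof. by rewrite ltr_wpDr// sqr_ge0. Qed.

Let p1 i : 1 - p i = (1 + m i)^-1.
Proof. by rewrite /p; field; rewrite gt_eqF. Qed.

Let p0 i : 0 <= p i. Proof. by rewrite /p divr_ge0// ?sqr_ge0// ltW. Qed.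

Let sig0 : 0 <= sig. Proof. exact: sumr_ge0. Qed.

Let total n := \sum_i (1 - p i) * weight n i.

(** The weights 1 - p_i are chosen so that the recursion contracts by [sig]: one step yields the
    coefficients sig - p_i, and sig - p_i <= sig (1 - p_i) because sig < 1. *)
Lemma total_decay n : total n <= sig ^+ n * total 0.
Proof.
elim: n => [|n IH]; first by rewrite expr0 mul1r.
rewrite exprS -mulrA; apply: le_trans (ler_wpM2l sig0 IH).
have -> : total n.+1 = \sum_i (sig - p i) * weight n i.
  rewrite /total; under eq_bigr => i _.
    rewrite weightS mulrA p1 -/(m i) [(_ + _)^-1 * _]mulrC -/(p i) mulrBr; over.
  rewrite sumrB -mulr_suml -/sig mulr_sumr -sumrB.
  by apply: eq_bigr => i _; rewrite mulrBl.
rewrite /total mulr_sumr; apply: ler_sum => i _; rewrite mulrA.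
apply: ler_wpM2r; first exact: weight_ge0.
have s1 : 0 <= 1 - sig by rewrite subr_ge0 ltW.
have := mulr_ge0 (p0 i) s1; rewrite !mulrBr !mulr1 (mulrC sig); lra.
Qed.

Lemma tr_layer_cvg0 a i : (fun n => t (a * layer n i)) @ \oo --> (0 : R).
Proof.
apply/norm_cvg0P.
have cs n : `|t (a * layer n i)| ^+ 2 <=
    sig ^+ n * (t (a * st a) * (1 + m i) * total 0).
  rewrite real_normK ?num_real//; have := cauchy_schwarz T (st a) (layer n i).
  rewrite starK => h; apply: le_trans h _.
  rewrite -mulrA mulrCA; apply: ler_wpM2l; first by have := tr_sq_ge0 T (st a); rewrite starK.
  rewrite mulrCA -ler_pdivrMl// -p1; apply: le_trans (total_decay n).
  rewrite /total (bigD1 i)//= -/(weight n i) lerDl sumr_ge0// => j _.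
  by rewrite mulr_ge0 ?weight_ge0// p1 invr_ge0 ltW.
set c := t (a * st a) * (1 + m i) * total 0 in cs.
have sn : (fun n => sig ^+ n * c) @ \oo --> (0 : R).
  rewrite -[X in _ --> X](mul0r c); apply: cvgMl; apply: cvg_expr.
  by rewrite ger0_norm.
have sq : (fun n => `|t (a * layer n i)| ^+ 2) @ \oo --> (0 : R).
  apply: (@squeeze_cvgr _ _ _ _ (fun=> 0) (fun n => sig ^+ n * c)) => //.
    by near=> n; apply/andP; split; [exact: sqr_ge0|exact: cs].
  exact: cvg_cst.
have := continuous_cvg _ (@sqrt_continuous R 0) sq; rewrite sqrtr0.
have -> : Num.sqrt \o (fun n => `|t (a * layer n i)| ^+ 2) =
  (fun n => `|t (a * layer n i)|).
  by apply/funext => n /=; rewrite sqrtr_sqr normr_id.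
by apply.
Unshelve. all: by end_near.
Qed.

Let tau i := k i / (1 + m i).

Definition skewsum : A := \sum_i tau i *: s i.

(** For a single generator (1 - p + tau s) (1 - k s) = 1, since s^2 = -1. In general 1 - sig is the
    constant term for which the product with the sum over reduced words telescopes to 1. *)
Definition pencil : A := (1 - sig) *: 1 + skewsum.

Lemma tau_k i : tau i * k i = p i.
Proof. by rewrite /tau /p /m expr2 mulrAC. Qed.

Let S n := \sum_i layer n i.

Lemma skewsum_one : skewsum = - \sum_i (1 - p i) *: layer 0 i.
Proof.
rewrite /skewsum -sumrN; apply: eq_bigr => i _ /=.
by rewrite scalerA p1 -scaleNr mulrN opprK /tau mulrC.
Qed.

Lemma tau_layer0 i : tau i *: (s i * layer 0 i) = p i *: 1.
Proof. by rewrite /= -scalerAr s_sq scalerN scaleNr opprK scalerA tau_k. Qed.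

Lemma S_rest n i : S n - layer n i = \sum_(j | j != i) layer n j.
Proof. by rewrite /S (bigD1 i)//= addrAC subrr add0r. Qed.

Lemma tau_layerS n i : tau i *: (s i * layer n.+1 i) = p i *: (S n - layer n i).
Proof.
rewrite layerS -scalerAr mulrA s_sq mulN1r scalerN scaleNr opprK scalerA tau_k.
by rewrite S_rest.
Qed.

Lemma tau_rest n i : tau i *: (s i * (S n - layer n i)) = - ((1 - p i) *: layer n.+1 i).
Proof.
rewrite S_rest layerS scalerA p1 mulrN scaleNr opprK; congr (_ *: _).
by rewrite /tau mulrC.
Qed.

Lemma skewsum_S0 : skewsum * S 0 = sig *: 1 - \sum_i (1 - p i) *: layer 1 i.
Proof.
rewrite /skewsum mulr_suml /sig scaler_suml -sumrB; apply: eq_bigr => i _.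
have -> : S 0 = layer 0 i + (S 0 - layer 0 i) by rewrite addrC subrK.
by rewrite -scalerAl mulrDr scalerDr tau_layer0 tau_rest.
Qed.

Lemma skewsum_SS n : skewsum * S n.+1 =
  \sum_i ((sig - p i) *: layer n i - (1 - p i) *: layer n.+2 i).
Proof.
transitivity (\sum_i (p i *: (S n - layer n i) - (1 - p i) *: layer n.+2 i)).
  rewrite /skewsum mulr_suml; apply: eq_bigr => i _.
  have -> : S n.+1 = layer n.+1 i + (S n.+1 - layer n.+1 i) by rewrite addrC subrK.
  by rewrite -scalerAl mulrDr scalerDr tau_layerS tau_rest.
rewrite !sumrB; congr (_ - _).
under eq_bigr do rewrite scalerBr; under [RHS]eq_bigr do rewrite scalerBl.
by rewrite !sumrB -scaler_suml -/sig /S scaler_sumr.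
Qed.

Definition partial n : A := 1 + \sum_(l < n) S l.

Lemma scale_S n : (1 - sig) *: S n =
  \sum_i (1 - p i) *: layer n i - \sum_i (sig - p i) *: layer n i.
Proof.
rewrite /S scaler_sumr -sumrB; apply: eq_bigr => i _.
by rewrite -scalerBl; congr (_ *: _); ring.
Qed.

(** A letter meeting a word either cancels its first letter or lengthens it; these contributions
    compensate between neighbouring layers, except in the layers n and n + 1 at the edge. *)
Lemma pencil_partial n : pencil * partial n.+1 =
  1 - (\sum_i (1 - p i) *: layer n.+1 i + \sum_i (sig - p i) *: layer n i).
Proof.
elim: n => [|n IH].
  rewrite /partial big_ord1 /pencil.
  rewrite mulrDl !mulrDr !mulr1 skewsum_S0 -scalerAl mul1r scale_S {1}skewsum_one.
  by rewrite scalerBl scale1r; Ncring_tac.non_commutative_ring.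
have -> : partial n.+2 = partial n.+1 + S n.+1.
  by rewrite /partial big_ord_recr /= addrA.
rewrite mulrDr IH {1}/pencil mulrDl skewsum_SS -scalerAl mul1r scale_S sumrB.
by Ncring_tac.non_commutative_ring.
Qed.

Lemma tr_partial n : t (partial n) = 1.
Proof.
rewrite /partial trD tr1 raddf_sum big1 ?addr0// => l _.
rewrite raddf_sum big1// => i _.
by have := @word_layer l [::] i isT; rewrite big_nil mul1r.
Qed.

Lemma tr_rot_layer n i j : i != j -> t (s i * layer n j) = 0.
Proof.
by move=> ij; have := @word_layer n [:: i] j; rewrite big_seq1 /= ij; apply.
Qed.

(** Of all reduced words only the one-letter word [s i] is cancelled to a scalar, and s_i^2 = -1
    turns its weight -k_i into k_i. *)
Lemma tr_rot_partial n i : t (s i * partial n.+1) = k i.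
Proof.
have tl l j : t (layer l j) = 0.
  by have := @word_layer l [::] j isT; rewrite big_nil mul1r.
rewrite /partial mulrDr mulr1 trD mulr_sumr raddf_sum big_ord_recl /=.
have -> : t (s i) = 0.
  by have := s_free (w := [:: i]); rewrite big_seq1; apply.
have E l : t (s i * S l) = t (s i * layer l i).
  rewrite /S mulr_sumr raddf_sum (bigD1 i)//= big1 ?addr0// => j ji.
  by rewrite tr_rot_layer// eq_sym.
rewrite E /= -scalerAr s_sq trZ trN tr1 mulrNN mulr1 add0r big1 ?addr0// => l _.
rewrite E layerS -scalerAr mulrA s_sq mulN1r trZ trN.
by rewrite raddf_sum big1 ?oppr0 ?mulr0// => j _; exact: tl.
Qed.

Lemma skewsum_star : st skewsum = - skewsum.
Proof.
rewrite /skewsum star_sum -sumrN; apply: eq_bigr => i _.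
by rewrite starZ s_star scalerN.
Qed.

Lemma pencil_star : st pencil = (1 - sig) *: 1 - skewsum.
Proof. by rewrite /pencil starD starZ star1 skewsum_star. Qed.

Lemma pencil_normal : st pencil * pencil = pencil * st pencil.
Proof.
rewrite pencil_star /pencil !(mulrDl, mulrBl, mulrDr, mulrBr) -!(scalerAl, scalerAr).
by rewrite !(mul1r, mulr1); Ncring_tac.non_commutative_ring.
Qed.

(** The cross terms of a real scalar and a skew element cancel. This identity is what turns the
    pencil into a regularised square, with regularisation (1 - sig)^2. *)
Lemma pencil_sq : pencil * st pencil = skewsum * st skewsum + ((1 - sig) ^+ 2) *: 1.
Proof.
rewrite pencil_star skewsum_star /pencil; set e := 1 - sig.
rewrite mulrDl !mulrBr -!(scalerAl, scalerAr) !(mul1r, mulr1) scalerA -expr2 mulrN.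
by Ncring_tac.non_commutative_ring.
Qed.

Lemma pencil_sq_ge : pos (pencil * st pencil - ((1 - sig) ^+ 2) *: 1).
Proof. by rewrite pencil_sq addrK; exact: pos_sq'. Qed.

Lemma pencil_inv : exists b, isinv pencil b.
Proof.
have e0 : 0 < (1 - sig) ^+ 2 by rewrite exprn_gt0// subr_gt0.
have [c h1 h2] := tracial_inv e0 pencil_sq_ge.
exists (st pencil * c); apply: (@isinv_two_sided _ _ (c * st pencil)).
  by rewrite mulrA.
by rewrite -mulrA pencil_normal.
Qed.

(** The series over words is never summed in the algebra: the edge layers need to vanish only when
    traced against [a * b], which the decay of their 2-norms provides. *)
Lemma tr_pencil_limit b a v : isinv pencil b ->
  (forall n, t (a * partial n.+1) = v) -> t (a * b) = v.
Proof.
move=> [_ bP] hv.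
pose err n := \sum_i (1 - p i) *: layer n.+1 i + \sum_i (sig - p i) *: layer n i.
have E n : v = t (a * b) - t (a * b * err n).
  rewrite -(hv n) -[partial n.+1]mul1r -bP -(mulrA b) pencil_partial -/(err n) mulrA.
  by rewrite mulrBr mulr1 trB.
have lay j i : (fun n => t (a * b * layer (n + j)%N i)) @ \oo --> (0 : R).
  by have := tr_layer_cvg0 (a * b) i; rewrite -(cvg_shiftn j).
have cv : (fun n => t (a * b * err n)) @ \oo --> (0 : R).
  have -> : (fun n => t (a * b * err n)) =
     (fun n => \sum_i (1 - p i) * t (a * b * layer (n + 1)%N i)) \+
     (fun n => \sum_i (sig - p i) * t (a * b * layer (n + 0)%N i)).
    apply/funext => n; rewrite /err /= mulrDr trD !mulr_sumr !tr_sum addn1 addn0 /=.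
    by congr (_ + _); apply: eq_bigr => i _; rewrite trMZ.
  have cz (c : I -> R) j :
      (fun n => \sum_i c i * t (a * b * layer (n + j)%N i)) @ \oo --> (0 : R).
    apply: (@cvg_sum0 R I _ (fun i n => c i * t (a * b * layer (n + j)%N i))) => i.
    by rewrite -[X in _ --> X](mulr0 (c i)); apply: cvgMr; exact: lay.
  by rewrite -[X in _ --> X]addr0; apply: cvgD; exact: cz.
have : (fun n => t (a * b) - t (a * b * err n)) @ \oo --> t (a * b) - 0.
  by apply: cvgB => //; exact: cvg_cst.
under eq_fun do rewrite -E.
by rewrite subr0 => /cvg_lim <-//; rewrite lim_cst.
Qed.

Lemma tr_pencil_inv b : isinv pencil b -> t b = 1.
Proof.
move=> ib; rewrite -[b]mul1r; apply: tr_pencil_limit => // n.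
by rewrite mul1r tr_partial.
Qed.

Lemma tr_rot_pencil_inv b i : isinv pencil b -> t (s i * b) = k i.
Proof. by move=> ib; apply: tr_pencil_limit => // n; rewrite tr_rot_partial. Qed.

End Resolvent.
End FreeRotations.

(** * Scalar estimates along the scaling of the weights *)

Section ScalarEstimates.
Variable R : realType.
Implicit Types x y M : R.

Let D x : 0 < 1 + x ^+ 2. Proof. by rewrite ltr_wpDr// sqr_ge0. Qed.

Lemma tau_lipschitz M x y : 0 <= x -> x <= y -> y <= M ->
  `|y / (1 + y ^+ 2) - x / (1 + x ^+ 2)| <= (1 + M ^+ 2) * (y - x).
Proof.
move=> x0 xy yM; have dx := D x; have dy := D y.
have -> : y / (1 + y ^+ 2) - x / (1 + x ^+ 2) =
    (1 - x * y) * (y - x) / ((1 + x ^+ 2) * (1 + y ^+ 2)).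
  by field; rewrite !gt_eqF.
rewrite !normrM normfV (ger0_norm (_ : 0 <= y - x)) ?subr_ge0//.
rewrite ler_pdivrMr ?normr_gt0 ?mulf_neq0 ?gt_eqF//.
rewrite (gtr0_norm (mulr_gt0 dx dy)).
have h : `|1 - x * y| <= 1 + M ^+ 2.
  by rewrite ler_norml; apply/andP; split; nra.
have h2 : 1 <= (1 + x ^+ 2) * (1 + y ^+ 2).
  by have := sqr_ge0 x; have := sqr_ge0 y; nra.
apply: (@le_trans _ _ ((1 + M ^+ 2) * (y - x))).
  by apply: ler_wpM2r; rewrite ?subr_ge0.
by rewrite ler_peMr// mulr_ge0 ?subr_ge0// ltW.
Qed.

Lemma p_lipschitz M x y : 0 <= x -> x <= y -> y <= M ->
  `|y ^+ 2 / (1 + y ^+ 2) - x ^+ 2 / (1 + x ^+ 2)| <= 2 * M * (y - x).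
Proof.
move=> x0 xy yM; have dx := D x; have dy := D y.
have -> : y ^+ 2 / (1 + y ^+ 2) - x ^+ 2 / (1 + x ^+ 2) =
    ((x + y) * (y - x)) / ((1 + x ^+ 2) * (1 + y ^+ 2)).
  by field; rewrite !gt_eqF.
rewrite ger0_norm; last first.
  apply: divr_ge0; last exact: ltW (mulr_gt0 dx dy).
  by apply: mulr_ge0; [apply: addr_ge0 => //; exact: le_trans xy|rewrite subr_ge0].
rewrite ler_pdivrMr ?mulr_gt0//.
have h2 : 1 <= (1 + x ^+ 2) * (1 + y ^+ 2).
  by have := sqr_ge0 x; have := sqr_ge0 y; nra.
have y0 := le_trans x0 xy.
apply: (@le_trans _ _ (2 * M * (y - x))).
  by apply: ler_wpM2r; rewrite ?subr_ge0//; lra.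
rewrite ler_peMr// mulr_ge0 ?subr_ge0//; lra.
Qed.

(** For tau = k / (1 + k^2) and p = k tau one has -dp + k dtau = -tau dk, and -2 tau dk is the
    differential of ln (1 - p) = -ln (1 + k^2). *)
Lemma ln_p_quadratic M x y : 0 <= x -> x <= y -> y <= M ->
  `|2 * (- (y ^+ 2 / (1 + y ^+ 2) - x ^+ 2 / (1 + x ^+ 2)) +
         (y / (1 + y ^+ 2) - x / (1 + x ^+ 2)) * x) -
    (ln (1 - y ^+ 2 / (1 + y ^+ 2)) - ln (1 - x ^+ 2 / (1 + x ^+ 2)))|
  <= (4 * M ^+ 2 + 1) * (y - x) ^+ 2.
Proof.
move=> x0 xy yM; have dx := D x; have dy := D y; have y0 := le_trans x0 xy.
have E (z : R) : 1 - z ^+ 2 / (1 + z ^+ 2) = (1 + z ^+ 2)^-1.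
  by have dz := D z; field; rewrite gt_eqF.
rewrite !E !lnV ?posrE//.
have x1 : 1 <= 1 + x ^+ 2 by rewrite lerDl sqr_ge0.
have y1 : 1 <= 1 + y ^+ 2 by rewrite lerDl sqr_ge0.
have := ln_quadratic ltr01 y1 x1; rewrite expr1n invr1 mul1r.
set lx := ln _; set ly := ln _ => h.
have -> : 2 * (- (y ^+ 2 / (1 + y ^+ 2) - x ^+ 2 / (1 + x ^+ 2)) +
    (y / (1 + y ^+ 2) - x / (1 + x ^+ 2)) * x) - (- ly - - lx) =
   - (lx - ly - (1 + y ^+ 2)^-1 * (1 + x ^+ 2 - (1 + y ^+ 2))) -
   (1 + y ^+ 2)^-1 * (y - x) ^+ 2.
  by field; rewrite !gt_eqF.
apply: le_trans (ler_normB _ _) _; rewrite normrN mulrDl mul1r; apply: lerD.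
  apply: le_trans h _.
  have -> : (1 + x ^+ 2 - (1 + y ^+ 2)) ^+ 2 = (x + y) ^+ 2 * (y - x) ^+ 2 by ring.
  apply: ler_wpM2r; first exact: sqr_ge0.
  have -> : 4 * M ^+ 2 = (2 * M) ^+ 2 by ring.
  by apply: lerXn2r; rewrite ?nnegrE; lra.
rewrite ger0_norm; last by apply: mulr_ge0; [rewrite invr_ge0 ltW|exact: sqr_ge0].
by apply: ler_piMl; [exact: sqr_ge0|rewrite invf_le1].
Qed.

End ScalarEstimates.

(** * The log-determinant of the pencil *)

Section FreeRotationPath.
Variables (R : realType) (A : algType R) (T : tracial A).
Local Notation st := (star T).
Local Notation t := (tr T).
Local Notation pos := (pos T).
Local Notation nb := (nb T).
Local Notation bnd := (bnd T).
Local Notation ldC := (ldC T).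
Variables (I : finType) (s : I -> A).
Hypothesis s_sq : forall i, s i * s i = -1.
Hypothesis s_star : forall i, st (s i) = - s i.
Hypothesis s_free : forall w : seq I, w != [::] -> sorted (fun i j => i != j) w ->
  t (\prod_(i <- w) s i) = 0.
Variable k : I -> R.
Hypothesis k0 : forall i, 0 <= k i.
Hypothesis k1 : \sum_i k i ^+ 2 / (1 + k i ^+ 2) < 1.

Let p x i := (x * k i) ^+ 2 / (1 + (x * k i) ^+ 2).
Let tau x i := (x * k i) / (1 + (x * k i) ^+ 2).
Let P x : A := pencil s (fun i => x * k i).

Let p_mono x i : 0 <= x -> x <= 1 -> p x i <= k i ^+ 2 / (1 + k i ^+ 2).
Proof.
move=> x0 x1; rewrite /p.
have a0 : 0 < 1 + k i ^+ 2 by rewrite ltr_wpDr// sqr_ge0.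
have b0 : 0 < 1 + (x * k i) ^+ 2 by rewrite ltr_wpDr// sqr_ge0.
rewrite ler_pdivrMr// mulrAC ler_pdivlMr//.
have : (x * k i) ^+ 2 <= k i ^+ 2.
  by apply: lerXn2r; rewrite ?nnegrE ?mulr_ge0// ler_piMl.
by rewrite !mulrDr !mulr1 (mulrC (k i ^+ 2)); lra.
Qed.

Let sig x := \sum_i p x i.

Let sig_mono x : 0 <= x -> x <= 1 -> sig x <= \sum_i k i ^+ 2 / (1 + k i ^+ 2).
Proof. by move=> x0 x1; apply: ler_sum => i _; exact: p_mono. Qed.

Let sig_lt1 x : 0 <= x -> x <= 1 -> sig x < 1.
Proof. by move=> x0 x1; apply: le_lt_trans k1; exact: sig_mono. Qed.

Let sig_ge0 x : 0 <= sig x.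
Proof.
apply: sumr_ge0 => i _; rewrite divr_ge0 ?sqr_ge0//.
by rewrite addr_ge0// sqr_ge0.
Qed.

Let nb_lin : exists2 K : R, 0 <= K & forall (c0 : R) (c : I -> R) (d : R),
  0 <= d -> `|c0| <= d -> (forall i, `|c i| <= d) ->
  nb (c0 *: 1 + \sum_i c i *: s i) (K * d).
Proof.
have [K K0 hK] := nb_comb s_sq s_star; exists (2 * (1 + K)).
  by rewrite mulr_ge0// addr_ge0.
move=> c0 c d d0 h0 hc; rewrite -mulrA (mulrDl 1 K) mul1r; apply: nbD; last exact: hK.
apply: nb_le (nbZ c0 (nb1 T)); by rewrite mulr1.
Qed.

Let PE x : P x = (1 - sig x) *: 1 + \sum_i tau x i *: s i.
Proof. by []. Qed.

Let tauN x : \sum_i (- tau x i) *: s i = - \sum_i tau x i *: s i.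
Proof. by rewrite -sumrN; apply: eq_bigr => i _; exact: scaleNr. Qed.

Let Pstar x : st (P x) = (1 - sig x) *: 1 + \sum_i (- tau x i) *: s i.
Proof.
by rewrite tauN; exact: pencil_star.
Qed.

Let Pdiff x y : P y - P x = (sig x - sig y) *: 1 + \sum_i (tau y i - tau x i) *: s i.
Proof.
rewrite !PE; under [in RHS]eq_bigr do rewrite scalerBl.
by rewrite sumrB !scalerBl; Ncring_tac.non_commutative_ring.
Qed.

Let kxy x y i : 0 <= x -> x <= y -> y <= 1 ->
  [/\ 0 <= x * k i, x * k i <= y * k i & y * k i <= k i].
Proof.
move=> x0 xy y1; split; first exact: mulr_ge0.
  exact: ler_wpM2r.
by rewrite ler_piMl.
Qed.

Let lip : exists2 L : R, 0 <= L & forall x y, 0 <= x -> x <= y -> y <= 1 ->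
  `|sig x - sig y| <= L * (y - x) /\ forall i, `|tau y i - tau x i| <= L * (y - x).
Proof.
pose l i := 2 * k i * k i + (1 + k i ^+ 2) * k i.
have l0 i : 0 <= l i.
  apply: addr_ge0; apply: mulr_ge0 => //; first exact: mulr_ge0.
  by apply: addr_ge0 => //; exact: sqr_ge0.
exists (\sum_i l i); first exact: sumr_ge0.
move=> x y x0 xy y1; split.
  rewrite -sumrB mulr_suml; apply: le_trans (ler_norm_sum _ _ _) _.
  apply: ler_sum => i _; have [h1 h2 h3] := kxy i x0 xy y1.
  rewrite distrC; apply: le_trans (p_lipschitz h1 h2 h3) _.
  rewrite -mulrBl mulrCA mulrC; apply: ler_wpM2r; first by rewrite subr_ge0.
  rewrite /l lerDl; apply: mulr_ge0 => //.
  by apply: addr_ge0 => //; exact: sqr_ge0.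
move=> i; have [h1 h2 h3] := kxy i x0 xy y1.
apply: le_trans (tau_lipschitz h1 h2 h3) _.
rewrite -mulrBl mulrCA mulrC; apply: ler_wpM2r; first by rewrite subr_ge0.
rewrite (bigD1 i)//=.
apply: (@le_trans _ _ (l i)); last by rewrite lerDl sumr_ge0.
by rewrite /l lerDr; apply: mulr_ge0 => //; apply: mulr_ge0.
Qed.

(** Scale the weights by x from 0, where the pencil is 1, up to 1. The derivative is twice the trace
    of P^-1 dP, and it is explicit because P^-1 has trace 1 and s_i P^-1 has trace x k_i. *)
Lemma ldet_pencil : ldet T (pencil s k * st (pencil s k)) =
  \sum_i ln (1 - k i ^+ 2 / (1 + k i ^+ 2)).
Proof.
have [K K0 hK] := nb_lin; have [L L0 hL] := lip.
have e0 : 0 < 1 - \sum_i k i ^+ 2 / (1 + k i ^+ 2) by rewrite subr_gt0.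
set e := 1 - _ in e0.
have Pinv x : 0 <= x -> x <= 1 -> exists b, isinv (P x) b.
  by move=> x0 x1; apply: (pencil_inv s_star); exact: sig_lt1.
have nP x : 0 <= x -> x <= 1 -> nb (P x) K /\ nb (st (P x)) K.
  move=> x0 x1.
  have a1 : `|1 - sig x| <= 1.
    rewrite ger0_norm ?subr_ge0 ?(ltW (sig_lt1 x0 x1))// gerBl.
    exact: sig_ge0.
  have a2 i : `|tau x i| <= 1.
    have kx0 : 0 <= x * k i by rewrite mulr_ge0.
    have den : 0 < 1 + (x * k i) ^+ 2 by rewrite ltr_wpDr// sqr_ge0.
    rewrite ger0_norm /tau ?divr_ge0 ?(ltW den)// ler_pdivrMr// mul1r.
    have := sqr_ge0 (x * k i - 1); set z := x * k i in kx0 *; nra.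
  rewrite -[K]mulr1; split.
    by rewrite PE; apply: hK.
  by rewrite Pstar; apply: hK => // i; rewrite normrN.
have low x : 0 <= x -> x <= 1 -> pos (P x * st (P x) - e ^+ 2 *: 1).
  move=> x0 x1; apply: pos_ge_scalar (pencil_sq_ge s_star _).
  apply: lerXn2r; rewrite ?nnegrE ?(ltW e0) ?subr_ge0 ?(ltW (sig_lt1 x0 x1))//.
  by rewrite lerD2l lerN2; exact: sig_mono.
pose C := Num.max (K ^+ 2) 1.
have C1 : 1 <= C by rewrite le_max lexx orbT.
have e20 : 0 < e ^+ 2 by rewrite exprn_gt0.
have bP x : 0 <= x -> x <= 1 -> bnd (e ^+ 2) C (P x * st (P x)).
  move=> x0 x1; split => //; first exact: low.
  apply: (pos_le_scalar (_ : K ^+ 2 <= C)); first by rewrite le_max lexx.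
  by have [_ [_]] := nP _ x0 x1; rewrite starK.
have [G G0 hG] := ldC_grad T (e ^+ 2) C.
pose M := \sum_i k i.
have kM i : k i <= M by rewrite /M (bigD1 i)//= lerDl sumr_ge0.
(* Three quadratic errors: that of [ldC_grad], the second-order term of the square modulus, and that
   of [ln_p_quadratic]. *)
pose Q := G * (2 * (K * L * K + K * (K * L))) ^+ 2 + (e^-1 * (K * L)) ^+ 2 +
  \sum_i (4 * k i ^+ 2 + 1) * k i ^+ 2.
have main := @quadratic_cst _ (fun x => ldC C (P x * st (P x)) - \sum_i ln (1 - p x i)) Q.
have P0 : P 0 = 1.
  rewrite PE /sig big1; last first.
    by move=> i _; rewrite /p mul0r expr0n /= mul0r.
  rewrite subr0 scale1r big1 ?addr0// => i _.
  by rewrite /tau !mul0r scale0r.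
have P1 : P 1 = pencil s k.
  by rewrite /P; congr pencil; apply/funext => i; rewrite mul1r.
have b1 := bP 1 ler01 (lexx _); have b0 := bP 0 (lexx _) ler01.
rewrite -P1 (ldetE C1 b1).
have z0 : ldC C (P 0 * st (P 0)) = 0.
  by rewrite -(ldetE C1 b0) P0 mul1r star1 ldet1.
have q0 : \sum_i ln (1 - p 0 i) = 0.
  by rewrite big1// => i _; rewrite /p mul0r expr0n /= mul0r subr0 ln1.
have q1 : \sum_i ln (1 - p 1 i) = \sum_i ln (1 - k i ^+ 2 / (1 + k i ^+ 2)).
  by apply: eq_bigr => i _; rewrite /p mul1r.
move: main; rewrite z0 q0 q1 => main.
apply/eqP; rewrite -subr_eq0; apply/eqP; rewrite main ?subr0// {main z0 q0 q1}.
move=> x y x0 xy y1.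
have y0 := le_trans x0 xy; have x1 := le_trans xy y1.
have [b ib] := Pinv _ x0 x1.
have [Lsig Ltau] := hL _ _ x0 xy y1.
set D := P y - P x.
have yx0 : 0 <= y - x by rewrite subr_ge0.
have nD : nb D (K * (L * (y - x))) by rewrite /D Pdiff; apply: hK => //; exact: mulr_ge0.
have nDs : nb (st D) (K * (L * (y - x))).
  have -> : st D = (sig x - sig y) *: 1 + \sum_i (- (tau y i - tau x i)) *: s i.
    rewrite /D starB !Pstar.
    under [in RHS]eq_bigr do rewrite opprB addrC scalerDl.
    by rewrite big_split /= !tauN !scalerBl; Ncring_tac.non_commutative_ring.
  by apply: hK => //; [exact: mulr_ge0|move=> i; rewrite normrN].
have iA : isinv (P x * st (P x)) (st b * b).
  by apply: isinvM => //; exact: isinv_star.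
have dA : P y * st (P y) - P x * st (P x) = D * st (P y) + P x * st D.
  by rewrite /D starB; Ncring_tac.non_commutative_ring.
have [nPx nPxs] := nP _ x0 x1; have [nPy nPys] := nP _ y0 y1.
have g1 := hG _ _ _ _ (bP _ x0 x1) (bP _ y0 y1) iA _.
have := g1 (2 * ((K * (L * (y - x))) * K + K * (K * (L * (y - x))))).
rewrite dA => /(_ (nbD (nbM nD nPys) (nbM nPx nDs))) {g1}.
(* The increment of the square modulus has two linear terms, both of trace [t (b * D)] by cyclicity
   and invariance under [st], and one square. *)
have tA : t (st b * b * (D * st (P y) + P x * st D)) =
    2 * t (b * D) + t (b * D * st (b * D)).
  have [i1 i2] := ib.
  have -> : st (P y) = st (P x) + st D by rewrite /D starB addrC subrK.
  have -> : st b * b * (D * (st (P x) + st D) + P x * st D) =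
    st b * (b * D * st (P x)) + st b * (b * D * st D) + st b * ((b * P x) * st D).
    by Ncring_tac.non_commutative_ring.
  have e1 : t (st b * (b * D * st (P x))) = t (b * D).
    by rewrite trC -(mulrA (b * D)) -starM i2 star1 mulr1.
  have e2 : t (st b * (b * D * st D)) = t (b * D * st (b * D)).
    by rewrite trC -(mulrA (b * D)) -starM.
  have e3 : t (st b * st D) = t (b * D) by rewrite -starM tr_star trC.
  by rewrite i2 mul1r !trD e1 e2 e3; ring.
rewrite tA => g1.
have nb_b : nb b e^-1.
  split; first by rewrite invr_ge0 ltW.
  have h1 := inv_nb (bP _ x0 x1) iA.
  have := nb_le_scalar _ (pos_sq T b) h1; rewrite invr_gt0 => /(_ e20).
  by rewrite exprVn.
have g2 := nb_tr_sq (nbM nb_b nD).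
have g2' : 0 <= t (b * D * st (b * D)) by apply: pos_tr; exact: pos_sq'.
have tD : t (b * D) = \sum_i (- (p y i - p x i) + (tau y i - tau x i) * (x * k i)).
  rewrite /D Pdiff mulrDr trD trMZ mulr1.
  rewrite (tr_pencil_inv s_sq s_star s_free (sig_lt1 x0 x1) ib) mulr1.
  rewrite big_split /= mulr_sumr tr_sum; congr (_ + _).
    by rewrite sumrN sumrB opprB.
  apply: eq_bigr => i _; rewrite trMZ trC.
  by rewrite (tr_rot_pencil_inv s_sq s_star s_free (sig_lt1 x0 x1) i ib).
have g3 : `|2 * t (b * D) - (\sum_i ln (1 - p y i) - \sum_i ln (1 - p x i))| <=
    \sum_i (4 * k i ^+ 2 + 1) * k i ^+ 2 * (y - x) ^+ 2.
  rewrite tD mulr_sumr -!sumrB; apply: le_trans (ler_norm_sum _ _ _) _.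
  apply: ler_sum => i _; have [h1 h2 h3] := kxy i x0 xy y1.
  apply: le_trans (ln_p_quadratic h1 h2 h3) _.
  by rewrite -mulrBl exprMn; apply: le_of_eq; ring.
rewrite -mulr_suml in g3.
rewrite /Q.
set X := ldC C (P y * _) in g1 *; set Y := ldC C (P x * _) in g1 *.
set U := \sum_i ln (1 - p y i) in g3 *; set V := \sum_i ln (1 - p x i) in g3 *.
set w := t (b * D) in g1 g3 *; set v := t _ in g1 g2 g2'.
have -> : X - U - (Y - V) = (X - Y - (2 * w + v)) + v + (2 * w - (U - V)) by ring.
apply: le_trans (ler_normD _ _) _; apply: le_trans (lerD (ler_normD _ _) g3) _.
rewrite (ger0_norm g2'); apply: le_trans (lerD (lerD g1 g2) (lexx _)) _.
by apply: le_of_eq; ring.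
Qed.

End FreeRotationPath.

(** * The parametrisation of the regularisation and its limit at 0 *)

Section Params.
Variable R : realType.
Implicit Types r q : R.

(** A pencil proportional to the coefficients 1/2, 1/2, r has weights p, p, q with p (1 - p) = gam^2
    / 4 and q (1 - q) = gam^2 r^2. Eliminating gam gives 1 - 2 p, which is this quantity. *)
Definition pairing r q : R := Num.sqrt (1 - q * (1 - q) / r ^+ 2).

(** This is (1 - sig)^2 / gam^2, because sig = 2 p + q gives 1 - sig = pairing - q. *)
Definition eps_of r q : R := (pairing r q - q) ^+ 2 * r ^+ 2 / (q * (1 - q)).

(** The value 2 ln (1 - p) + ln (1 - q) of [ldet_pencil], minus ln gam^2. *)
Definition ldet_of r q : R := 2 * ln ((1 + pairing r q) / 2) - ln q + 2 * ln r.

(** Twice the logarithm of Delta, since it is the limit of log-determinants of the square modulus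
    rather than of the modulus. *)
Definition limit_value r : R :=
  if 1 / 2 <= r ^+ 2 then ln r else - ln 2 - ln (1 - r ^+ 2) / 2.

(** The last inequality is q < pairing, that is sig < 1, squared and divided by 1 - q. *)
Definition admissible r q := [/\ 0 < q, q < 1 & q < r ^+ 2 * (1 + q)].

Lemma pairing_bounds r q : 0 < r -> admissible r q -> q < pairing r q < 1.
Proof.
move=> r0 [q0 q1 qr]; have r2 : 0 < r ^+ 2 by rewrite exprn_gt0.
have D : q ^+ 2 < 1 - q * (1 - q) / r ^+ 2.
  rewrite ltrBrDr -ltrBrDl ltr_pdivrMr//.
  have -> : 1 - q ^+ 2 = (1 - q) * (1 + q) by ring.
  by rewrite mulrC -mulrA ltr_pM2l ?subr_gt0// mulrC.
have D0 : 0 <= 1 - q * (1 - q) / r ^+ 2 by apply: le_trans (ltW D); exact: sqr_ge0.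
have s0 : 0 <= pairing r q by exact: sqrtr_ge0.
have s2 : pairing r q ^+ 2 = 1 - q * (1 - q) / r ^+ 2 by rewrite sqr_sqrtr.
apply/andP; split.
  by rewrite -ltr_sqr ?nnegrE ?(ltW q0)// s2.
rewrite -ltr_sqr ?nnegrE// s2 expr1n gtrBl divr_gt0// mulr_gt0// subr_gt0 //.
Qed.

Lemma eps_of_gt0 r q : 0 < r -> admissible r q -> 0 < eps_of r q.
Proof.
move=> r0 aq; have /andP[h1 _] := pairing_bounds r0 aq; case: aq => q0 q1 _.
by rewrite divr_gt0 ?mulr_gt0 ?exprn_gt0 ?subr_gt0.
Qed.

Lemma cvg_pairing r q : 0 < r ->
  pairing r x @[x --> q] --> pairing r q.
Proof.
move=> r0; apply: (@cvg_comp _ _ _ (fun x : R => 1 - x * (1 - x) / r ^+ 2) Num.sqrt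
  _ (nbhs (1 - q * (1 - q) / r ^+ 2))); last exact: sqrt_continuous.
apply: cvgB; first exact: cvg_cst.
apply: cvgM; last exact: cvg_cst.
by apply: cvgM; [exact: cvg_id|apply: cvgB; [exact: cvg_cst|exact: cvg_id]].
Qed.

Lemma cvg_ldet_of r q : 0 < r -> 0 < q ->
  ldet_of r x @[x --> q] --> ldet_of r q.
Proof.
move=> r0 q0; apply: cvgD; last exact: cvg_cst.
apply: cvgB; last exact: continuous_ln.
apply: cvgM; first exact: cvg_cst.
apply: (@cvg_comp _ _ _ (fun x : R => (1 + pairing r x) / 2) (@ln R)
  _ (nbhs ((1 + pairing r q) / 2))); last first.
  by apply: continuous_ln; rewrite divr_gt0// ltr_wpDr// sqrtr_ge0.
apply: cvgM; last exact: cvg_cst.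
by apply: cvgD; [exact: cvg_cst|exact: cvg_pairing].
Qed.

(** The regularisation vanishes where pairing = q, at q = r^2 / (1 - r^2), or as q tends to 1, where
    pairing tends to 1 as well. The first point lies strictly between 0 and 1 exactly when r^2 <
    1/2, which is the origin of the threshold. *)
Lemma limit_point r : 0 < r -> exists q0 : R, [/\ 0 < q0, q0 <= 1,
  q0 <= r ^+ 2 * (1 + q0), ldet_of r q0 = 2 * limit_value r &
  eps_of r x @[x --> q0^'-] --> (0 : R)].
Proof.
move=> r0; have r2 : 0 < r ^+ 2 by rewrite exprn_gt0.
rewrite /limit_value; have [big|small] := leP (1 / 2) (r ^+ 2).
  exists 1; split => //.
  - lra.
  - rewrite /ldet_of /pairing subrr mulr0 mul0r subr0 sqrtr1 ln1 subr0.
    have -> : (1 + 1) / 2 = 1 :> R by field.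
    by rewrite ln1 mulr0 add0r.
  apply: (@squeeze_cvgr _ _ _ _ (fun=> 0) (fun x => (1 - x) * r ^+ 2 / x)).
  - near=> x.
    have x0 : 0 < x by near: x; exact: nbhs_left_gt.
    have x1 : x < 1 by near: x; exact: nbhs_left_lt.
    have ax : admissible r x by split => //; nra.
    have /andP[h1 h2] := pairing_bounds r0 ax.
    rewrite (ltW (eps_of_gt0 r0 ax)) /=.
    rewrite /eps_of ler_pdivrMr ?mulr_gt0 ?subr_gt0//.
    have -> : (1 - x) * r ^+ 2 / x * (x * (1 - x)) = (1 - x) ^+ 2 * r ^+ 2.
      by field; rewrite gt_eqF.
    apply: ler_wpM2r; first exact: ltW.
    by apply: lerXn2r; rewrite ?nnegrE; lra.
  - exact: cvg_cst.
  - apply: cvg_at_left_filter.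
    suff : (1 - x) * r ^+ 2 / x @[x --> (1 : R)] --> ((1 - 1) * r ^+ 2 / 1 : R).
      by rewrite subrr !mul0r.
    apply: cvgM; last by apply: cvgV; [exact: oner_neq0|exact: cvg_id].
    apply: cvgM; last exact: cvg_cst.
    by apply: cvgB; [exact: cvg_cst|exact: cvg_id].
have s0 : 0 < 1 - r ^+ 2 by lra.
have q0 : 0 < r ^+ 2 / (1 - r ^+ 2) by rewrite divr_gt0.
have q1 : r ^+ 2 / (1 - r ^+ 2) < 1 by rewrite ltr_pdivrMr//; lra.
have pE : pairing r (r ^+ 2 / (1 - r ^+ 2)) = r ^+ 2 / (1 - r ^+ 2).
  rewrite /pairing -[RHS]ger0_norm ?(ltW q0)// -sqrtr_sqr; congr Num.sqrt.
  by field; rewrite !gt_eqF.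
exists (r ^+ 2 / (1 - r ^+ 2)); split => //.
- exact: ltW.
- by apply: le_of_eq; field; rewrite gt_eqF.
- rewrite /ldet_of pE.
  have -> : (1 + r ^+ 2 / (1 - r ^+ 2)) / 2 = (2 * (1 - r ^+ 2))^-1.
    by field; rewrite gt_eqF.
  have -> : ln (2 * (1 - r ^+ 2))^-1 = - ln 2 - ln (1 - r ^+ 2).
    by rewrite lnV ?posrE ?mulr_gt0// lnM ?posrE// opprD.
  have -> : ln (r ^+ 2 / (1 - r ^+ 2)) = 2 * ln r - ln (1 - r ^+ 2).
    by rewrite ln_div ?posrE// lnXn// mulr_natl.
  by field.
apply: cvg_at_left_filter.
set Q := r ^+ 2 / (1 - r ^+ 2) in q0 q1 pE *.
suff : eps_of r x @[x --> Q] --> ((pairing r Q - Q) ^+ 2 * r ^+ 2 / (Q * (1 - Q)) : R).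
  by rewrite pE subrr expr0n /= !mul0r.
apply: cvgM.
  apply: cvgM; last exact: cvg_cst.
  have h : pairing r x - x @[x --> Q] --> pairing r Q - Q.
    by apply: cvgB; [exact: cvg_pairing|exact: cvg_id].
  exact: (cvgM h h).
apply: cvgV; first by rewrite mulf_neq0 ?gt_eqF ?subr_gt0.
by apply: cvgM; [exact: cvg_id|apply: cvgB; [exact: cvg_cst|exact: cvg_id]].
Unshelve. all: by end_near.
Qed.

Lemma admissible_approx r e d : 0 < r -> 0 < e -> 0 < d -> exists q,
  [/\ admissible r q, eps_of r q <= e & `|ldet_of r q - 2 * limit_value r| <= d].
Proof.
move=> r0 e0 d0; have [q0 [q00 q01 q0r <- ce]] := limit_point r0.
have cl : ldet_of r x @[x --> q0^'-] --> ldet_of r q0.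
  by apply: cvg_at_left_filter; exact: cvg_ldet_of.
have r2 : 0 < r ^+ 2 by rewrite exprn_gt0.
have near_adm : \forall q \near q0^'-, admissible r q.
  near=> q.
  have h0 : 0 < q by near: q; exact: nbhs_left_gt.
  have h1 : q < q0 by near: q; exact: nbhs_left_lt.
  split => //; first exact: lt_le_trans q01.
  by have [h|h] := leP (r ^+ 2) 1; nra.
near (q0^'-) => q.
exists q; split.
- by near: q.
- near: q; move/cvgrPdist_le : ce => /(_ _ e0); apply: filterS => x.
  by rewrite sub0r normrN => h; apply: le_trans h; rewrite ler_norm.
- by rewrite distrC; near: q; move/cvgrPdist_le : cl => /(_ _ d0).
Unshelve. all: by end_near.
Qed.

End Params.

(** * Log-determinants of multiples, unipotents and two-sided products *)

Section MoreLdet.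
Variables (R : realType) (A : algType R) (T : tracial A).
Local Notation st := (star T).
Local Notation t := (tr T).
Local Notation pos := (pos T).
Local Notation ldet := (ldet T).
Implicit Types (a b x y u : A) (c d e : R).

Lemma ldetZ c a : 0 < c -> spos T a -> ldet (c *: a) = ln c + ldet a.
Proof.
move=> c0 pa; have s0 : Num.sqrt c != 0 by rewrite gt_eqF// sqrtr_gt0.
have iu : isinv (Num.sqrt c *: 1 : A) ((Num.sqrt c)^-1 *: 1).
  by split; rewrite -scalerAl mul1r scalerA ?mulfV ?mulVf// scale1r.
have cc : Num.sqrt c * Num.sqrt c = c by rewrite -expr2 sqr_sqrtr// ltW.
have := ldet_conj iu pa; rewrite !starZ star1 -!(scalerAl, scalerAr) !scalerA cc.
by rewrite !mulr1 mul1r ldet_scalar// addrC.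
Qed.

(** The symmetry [v] conjugates 1 + n into 1 - n, which is its inverse, so the log-determinant
    equals its own negative. *)
Lemma ldet_nilpotent v n : v * v = 1 -> st v = v -> n * n = 0 -> v * n * v = - n ->
  ldet ((1 + n) * st (1 + n)) = 0.
Proof.
move=> vv sv nn vnv.
have i1 : isinv (1 + n) (1 - n).
  split.
    have -> : (1 + n) * (1 - n) = 1 - n * n by Ncring_tac.non_commutative_ring.
    by rewrite nn subr0.
  have -> : (1 - n) * (1 + n) = 1 - n * n by Ncring_tac.non_commutative_ring.
  by rewrite nn subr0.
have i2 : isinv (1 - n) (1 + n) by exact: isinv_sym.
have iv : isinv v v by [].
have v0 : ldet (v * st v) = 0 by rewrite sv vv ldet1.
have e1 := ldet_mul T (isinvM iv i1) iv; have e2 := ldet_mul T iv i1.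
have e3 := ldet_mul T i1 i2.
have E : v * (1 + n) * v = 1 - n by rewrite mulrDr mulrDl mulr1 vv vnv.
rewrite E v0 e2 v0 in e1; case: i1 => i1 _; rewrite i1 mul1r star1 ldet1 in e3.
by lra.
Qed.

(** [ldet_sandwich] removes a factor on the outside only; [ldet_swap] brings the other factor
    there. *)
Lemma ldet_sandwich2 u u' v v' x : isinv u u' -> isinv v v' ->
  exists2 K : R, 1 <= K & forall e, 0 < e ->
    ldet (x * st x + (e / K) *: 1) + (ldet (u * st u) + ldet (st v * v)) <=
      ldet (st (u * x * v) * (u * x * v) + e *: 1) /\
    ldet (st (u * x * v) * (u * x * v) + e *: 1) <=
      ldet (x * st x + (e * K) *: 1) + (ldet (u * st u) + ldet (st v * v)).
Proof.
move=> iu iv.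
have [K K1 hK] := ldet_sandwich iu (pos_sq' T (x * v)).
have [L L1 hL] := ldet_sandwich (isinv_star T iv) (pos_sq T x).
have K0 := lt_le_trans ltr01 K1; have L0 := lt_le_trans ltr01 L1.
exists (K * L); first by rewrite mulr_ege1.
move=> e e0; rewrite ldet_swap//.
have -> : u * x * v * st (u * x * v) = u * (x * v * st (x * v)) * st u.
  by rewrite !starM; Ncring_tac.non_commutative_ring.
have step d : 0 < d -> ldet (x * v * st (x * v) + d *: 1) =
    ldet (st v * (st x * x) * st (st v) + d *: 1).
  move=> d0; rewrite -ldet_swap// starM starK; congr ldet.
  by congr (_ + _); Ncring_tac.non_commutative_ring.
have [h1 h2] := hK _ e0.
have eK : 0 < e / K by rewrite divr_gt0.
have eK' : 0 < e * K by rewrite mulr_gt0.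
have [h3 _] := hL _ eK; have [_ h4] := hL _ eK'.
rewrite -!step// starK ldet_swap ?divr_gt0// in h3.
rewrite -!step// starK ldet_swap ?mulr_gt0// in h4.
have -> : e / (K * L) = e / K / L by rewrite invfM mulrA.
have -> : e * (K * L) = e * K * L by rewrite mulrA.
split; lra.
Qed.

End MoreLdet.

(** * An off-diagonal self-adjoint element as a pencil in three free symmetries *)

Section Link.
Variables (R : realType) (A : algType R) (T : tracial A).
Local Notation st := (star T).
Local Notation t := (tr T).
Local Notation pos := (pos T).
Local Notation ldet := (ldet T).
Variable sc : {rmorphism R[i] -> A}.
Hypothesis scC : forall z x, sc z * x = x * sc z.
Hypothesis sc_star : forall z, st (sc z) = sc (z^*)%C.
Hypothesis sc_real : forall x : R, sc (x%:C) = x *: 1.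
Variables W N J : A.
Hypothesis W2 : W * W = 1.
Hypothesis Ws : st W = W.
Hypothesis N2 : N * N = 0.
Hypothesis Nu : N * st N + st N * N = 1.
Hypothesis J1 : J * st J = 1.
Hypothesis J2 : st J * J = 1.
Hypothesis JW : J * W = - (W * J).

(** The diagonal symmetry F_11 - F_22 when N = F_12; conjugation by it fixes diagonal blocks and
    negates off-diagonal ones. *)
Definition sgn : A := N * st N - st N * N.
Definition off (om : R[i]) : A := sc om * st N + sc (om^*)%C * N.
(** The sign of the second symmetry makes all three coefficients of [herm] positive ([herm_decomp]),
    in accordance with the nonnegative weights of [ldet_pencil]. *)
Definition flips om (i : 'I_3) : A :=
  nth 0 [:: W; - (sgn * W * sgn); off om] i.

Hypothesis flips_free : forall om : R[i], `|om| = 1 -> forall (z : R[i]) (w : seq 'I_3),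
  w != [::] -> sorted (fun i j => i != j) w -> t (sc z * \prod_(i <- w) flips om i) = 0.
Hypothesis tr_sgn : t sgn = 0.

Local Notation f1 := (N * st N).
Local Notation f2 := (st N * N).

Lemma NsN : N * st N * N = N.
Proof.
have : (N * st N + st N * N) * N = N by rewrite Nu mul1r.
by rewrite mulrDl -(mulrA (st N)) N2 mulr0 addr0.
Qed.

Lemma Ns2 : st N * st N = 0. Proof. by rewrite -starM N2 linear0. Qed.

Lemma sNNs : st N * N * st N = st N.
Proof. by rewrite -[in RHS]NsN !starM starK mulrA. Qed.

Lemma f1E : f1 = 1 - f2. Proof. by rewrite -Nu addrK. Qed.
Lemma f2f2 : f2 * f2 = f2. Proof. by rewrite mulrA sNNs. Qed.
Lemma f2s : st f2 = f2. Proof. by rewrite starM starK. Qed.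
Lemma f2N : f2 * N = 0. Proof. by rewrite -mulrA N2 mulr0. Qed.
Lemma Nf2 : N * f2 = N. Proof. by rewrite mulrA NsN. Qed.
Lemma f2Ns : f2 * st N = st N. Proof. exact: sNNs. Qed.
Lemma Nsf2 : st N * f2 = 0. Proof. by rewrite mulrA Ns2 mul0r. Qed.
Lemma sgnE : sgn = 1 - f2 - f2. Proof. by rewrite /sgn f1E. Qed.

Lemma sgn_sq : sgn * sgn = 1.
Proof.
have -> : sgn * sgn = 1 - f2 - f2 - f2 - f2 + (f2 * f2 + f2 * f2 + f2 * f2 + f2 * f2).
  by rewrite sgnE; Ncring_tac.non_commutative_ring.
by rewrite f2f2; Ncring_tac.non_commutative_ring.
Qed.

Lemma sgn_star : st sgn = sgn.
Proof. by rewrite sgnE !starB star1 f2s. Qed.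

Lemma sgnN : sgn * N = N.
Proof. by rewrite sgnE !mulrBl mul1r f2N !subr0. Qed.
Lemma Nsgn : N * sgn = - N.
Proof. by rewrite sgnE !mulrBr mulr1 Nf2 subrr sub0r. Qed.
Lemma sgnNs : sgn * st N = - st N.
Proof. by rewrite sgnE !mulrBl mul1r f2Ns subrr sub0r. Qed.
Lemma Nssgn : st N * sgn = st N.
Proof. by rewrite sgnE !mulrBr mulr1 Nsf2 !subr0. Qed.

Lemma sc_norm z : sc z * sc (z^*)%C = (complex.Re `|z| ^+ 2) *: 1.
Proof.
rewrite -rmorphM -sc_real; congr (sc _).
case: z => a b; rewrite normc_def /= sqr_sqrtr ?addr_ge0 ?sqr_ge0//.
by apply/eqP; rewrite eq_complex /=; apply/andP; split; apply/eqP; ring.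
Qed.

Lemma off_star om : st (off om) = off om.
Proof.
rewrite /off starD !starM starK !sc_star conjcK addrC.
by rewrite (scC om) (scC _ N) .
Qed.

Lemma off_sq om : off om * off om = (complex.Re `|om| ^+ 2) *: 1.
Proof.
rewrite /off; set a := sc om; set b := sc _.
have ab : a * b = (complex.Re `|om| ^+ 2) *: 1 by exact: sc_norm.
have ba : b * a = a * b by rewrite /a scC.
have -> : (a * st N + b * N) * (a * st N + b * N) =
    a * (st N * a) * st N + a * (st N * b) * N + b * (N * a) * st N + b * (N * b) * N.
  by Ncring_tac.non_commutative_ring.
rewrite -(scC om (st N)) -(scC _ (st N)) -(scC om N) -(scC _ N) -/a -/b.
have -> : a * (a * st N) * st N + a * (b * st N) * N + b * (a * N) * st N + b * (b * N) * N
  = a * a * (st N * st N) + a * b * f2 + b * a * f1 + b * b * (N * N).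
  by Ncring_tac.non_commutative_ring.
by rewrite Ns2 N2 !mulr0 add0r addr0 ba -mulrDr (addrC f2) Nu mulr1.
Qed.

Lemma sgn_off om : sgn * off om = - (off om * sgn).
Proof.
rewrite /off (mulrDr sgn) (mulrDl _ _ sgn) !mulrA -!(scC _ sgn) -!mulrA.
rewrite sgnN sgnNs Nsgn Nssgn.
by rewrite !mulrN opprD opprK.
Qed.

Section Offdiagonal.
Variable nu : R[i].
Let r : R := complex.Re `|nu|.
Hypothesis r0 : 0 < r.

(** In two-by-two blocks this is the self-adjoint off-diagonal element with lower left entry W_21 +
    nu. That entry is the Schur complement to which W + N - z is reduced for nu = 1 - z^2. *)
Definition herm : A := f1 * W * f2 + f2 * W * f1 + off nu.

Lemma hermE : herm = 2^-1 *: W - 2^-1 *: (sgn * W * sgn) + off nu.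
Proof.
rewrite /herm; congr (_ + _); rewrite -scalerBr.
have -> : W - sgn * W * sgn = (f1 * W * f2 + f2 * W * f1) + (f1 * W * f2 + f2 * W * f1).
  rewrite -{1}[W]mul1r -{1}[_ * W]mulr1 -{1}Nu -{1}Nu /sgn.
  by Ncring_tac.non_commutative_ring.
set X := _ + f2 * W * f1; have -> : X + X = 2 *: X by rewrite scaler_nat mulr2n.
by rewrite scalerA mulVf ?pnatr_eq0// scale1r.
Qed.

Lemma herm_star : st herm = herm.
Proof.
rewrite hermE starD starB !starZ Ws off_star !starM sgn_star Ws.
by rewrite mulrA.
Qed.

Lemma sgn_herm : sgn * herm = - (herm * sgn).
Proof.
have e : sgn * (W - sgn * W * sgn) = - ((W - sgn * W * sgn) * sgn).
  rewrite (mulrBr sgn) (mulrBl sgn) !mulrA sgn_sq mul1r.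
  by rewrite -(mulrA (sgn * W)) sgn_sq mulr1 opprB.
rewrite hermE -scalerBr (mulrDr sgn) (mulrDl _ _ sgn) sgn_off.
by rewrite -scalerAr -scalerAl e scalerN opprD.
Qed.

Let om : R[i] := nu / (r%:C).

Lemma om_norm : `|om| = 1.
Proof.
have nn : `|nu| = r%:C by rewrite /r normc_def.
have rC : r%:C != 0 by rewrite eq_complex /= eqxx andbT gt_eqF.
rewrite /om normrM normfV nn ger0_norm ?divff// lecE /= eqxx; exact: ltW.
Qed.

Lemma off_om : off nu = r *: off om.
Proof.
have rC : r%:C != 0 by rewrite eq_complex /= eqxx andbT gt_eqF.
have e1 : sc nu = r *: sc om.
  by rewrite -[sc om]mul1r scalerAl -sc_real -rmorphM /om mulrCA divff ?mulr1.
have e2 : sc (nu^*)%C = r *: sc (om^*)%C.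
  rewrite -[sc (om^*)%C]mul1r scalerAl -sc_real -rmorphM; congr (sc _).
  have e : r%:C * om = nu by rewrite /om mulrCA divff ?mulr1.
  have -> : (nu^*)%C = (r%:C^*)%C * (om^*)%C by rewrite -{1}e rmorphM.
  by rewrite conjc_real.
by rewrite /off e1 e2 scalerDr !scalerAl.
Qed.

(** The factor i turns a symmetry into a skew involution. *)
Let s (i : 'I_3) : A := sc 'i%C * flips om i.

Let i_sq : sc 'i%C * sc 'i%C = -1.
Proof. by rewrite -rmorphM -expr2 sqr_i rmorphN rmorph1. Qed.

Let i_star : st (sc 'i%C) = - sc 'i%C.
Proof. by rewrite sc_star -rmorphN; congr (sc _); apply/eqP; rewrite eq_complex /= oppr0 !eqxx. Qed.

Lemma flips_sq i : flips om i * flips om i = 1.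
Proof.
case: i => [[|[|[|//]]] ?] /=; rewrite /flips /=; first exact: W2.
  rewrite mulrNN.
  have -> : sgn * W * sgn * (sgn * W * sgn) = sgn * (W * (sgn * sgn) * W) * sgn.
    by Ncring_tac.non_commutative_ring.
  by rewrite sgn_sq mulr1 W2 mulr1 sgn_sq.
by rewrite off_sq om_norm expr1n scale1r.
Qed.

Lemma flips_star i : st (flips om i) = flips om i.
Proof.
case: i => [[|[|[|//]]] ?] /=; rewrite /flips /=; first exact: Ws.
  by rewrite starN !starM sgn_star Ws mulrA.
exact: off_star.
Qed.

Let s_sq i : s i * s i = -1.
Proof.
have -> : s i * s i = sc 'i%C * (flips om i * sc 'i%C) * flips om i.
  by rewrite /s; Ncring_tac.non_commutative_ring.
by rewrite -scC mulrA i_sq mulN1r mulNr flips_sq.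
Qed.

Let s_star i : st (s i) = - s i.
Proof. by rewrite /s starM flips_star i_star mulrN -scC. Qed.

Let s_free (w : seq 'I_3) : w != [::] -> sorted (fun i j => i != j) w ->
  t (\prod_(i <- w) s i) = 0.
Proof.
move=> w0 sw.
have -> : \prod_(i <- w) s i = sc ('i%C ^+ size w) * \prod_(i <- w) flips om i.
  elim: w {w0 sw} => [|i w IH]; first by rewrite !big_nil expr0 rmorph1 mulr1.
  rewrite !big_cons IH exprS rmorphM /s -!mulrA; congr (_ * _).
  by rewrite !mulrA scC.
exact: flips_free om_norm _ _ w0 sw.
Qed.

Lemma herm_decomp : herm = \sum_(i : 'I_3) (nth 0 [:: 2^-1; 2^-1; r] i : R) *: flips om i.
Proof.
rewrite !big_ord_recl big_ord0 /flips /= addr0 hermE scalerN off_om.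
by rewrite addrA.
Qed.

(** For the weights p, p, q the pencil is (1 - sig) + gam i [herm], whose square modulus is gam^2
    (herm^2 + eps_of r q). *)
Lemma ldet_herm_param q : admissible r q ->
  ldet (herm * herm + eps_of r q *: 1) = ldet_of r q.
Proof.
move=> aq; have /andP[qa a1] := pairing_bounds r0 aq; have e0 := eps_of_gt0 r0 aq.
case: aq => q0 q1 qr.
set a := pairing r q in qa a1.
have a0 : 0 < a by exact: lt_trans qa.
have r2 : 0 < r ^+ 2 by rewrite exprn_gt0.
have a2 : a ^+ 2 = 1 - q * (1 - q) / r ^+ 2.
  rewrite /a /pairing sqr_sqrtr//; rewrite /a /pairing in a0.
  by move: a0; rewrite sqrtr_gt0 => /ltW.
pose p := (1 - a) / 2.
have p0 : 0 < p by rewrite /p; lra.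
have p1 : p < 1 by rewrite /p; lra.
(* The inverse of k -> k^2 / (1 + k^2); correspondingly k / (1 + k^2) becomes the square root of x
   (1 - x). *)
pose h (x : R) := Num.sqrt (x / (1 - x)).
have hsq x : 0 < x -> x < 1 -> h x ^+ 2 = x / (1 - x).
  by move=> x0 x1; rewrite sqr_sqrtr// divr_ge0// ?subr_ge0 ltW.
have hp x : 0 < x -> x < 1 -> h x ^+ 2 / (1 + h x ^+ 2) = x.
  by move=> x0 x1; rewrite hsq//; field; rewrite subrK oner_neq0 subr_eq0 gt_eqF.
have ht x : 0 < x -> x < 1 -> h x / (1 + h x ^+ 2) = Num.sqrt (x * (1 - x)).
  move=> x0 x1; rewrite hsq//; have x1' : 0 < 1 - x by rewrite subr_gt0.
  have -> : 1 + x / (1 - x) = (1 - x)^-1 by field; rewrite gt_eqF.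
  rewrite invrK -[X in _ * X]gtr0_norm// -sqrtr_sqr /h -sqrtrM ?divr_ge0 ?(ltW x0) ?(ltW x1')//.
  by congr Num.sqrt; field; rewrite gt_eqF.
pose k (i : 'I_3) : R := nth 0 [:: h p; h p; h q] i.
have k0 i : 0 <= k i by case: i => [[|[|[|//]]] ?] /=; rewrite /k /= sqrtr_ge0.
have kp : forall F : R -> R, \sum_i F (k i) = 2 * F (h p) + F (h q).
  by move=> F; rewrite !big_ord_recl big_ord0 /k /=; ring.
have sigE : \sum_i k i ^+ 2 / (1 + k i ^+ 2) = 1 - (a - q).
  by rewrite (kp (fun x => x ^+ 2 / (1 + x ^+ 2))) !hp// /p; field.
have k1 : \sum_i k i ^+ 2 / (1 + k i ^+ 2) < 1 by rewrite sigE; lra.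
have := ldet_pencil s_sq s_star s_free k0 k1.
rewrite (kp (fun x => ln (1 - x ^+ 2 / (1 + x ^+ 2)))) !hp//.
rewrite (pencil_sq s_star) sigE subKr.
pose gam := Num.sqrt (q * (1 - q)) / r.
have qq : 0 < q * (1 - q) by rewrite mulr_gt0// subr_gt0.
have gam0 : 0 < gam by rewrite divr_gt0// sqrtr_gt0.
have gam2 : gam ^+ 2 = q * (1 - q) / r ^+ 2 by rewrite expr_div_n sqr_sqrtr// ltW.
have tp : h p / (1 + h p ^+ 2) = gam * 2^-1.
  rewrite ht//; have -> : p * (1 - p) = (gam * 2^-1) ^+ 2.
    by rewrite exprMn gam2 -[q * _ / _](subKr 1) -a2 /p; field.
  by rewrite sqrtr_sqr gtr0_norm// mulr_gt0// invr_gt0.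
have tq : h q / (1 + h q ^+ 2) = gam * r by rewrite ht// /gam divfK// gt_eqF.
have -> : skewsum s k = gam *: (sc 'i%C * herm).
  rewrite herm_decomp /skewsum mulr_sumr scaler_sumr; apply: eq_bigr => i _.
  rewrite /s -scalerAr scalerA; congr (_ *: _).
  by case: i => [[|[|[|//]]] ?]; rewrite /k /=; [exact: tp|exact: tp|exact: tq].
have -> : gam *: (sc 'i%C * herm) * st (gam *: (sc 'i%C * herm)) =
    gam ^+ 2 *: (herm * herm).
  rewrite starZ starM herm_star i_star -scalerAl -scalerAr scalerA -expr2.
  congr (_ *: _); set X := sc _.
  have -> : X * herm * (herm * - X) = - (X * (herm * herm) * X).
    by Ncring_tac.non_commutative_ring.
  by rewrite /X scC -mulrA i_sq mulrN1 opprK.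
have -> : (a - q) ^+ 2 = gam ^+ 2 * eps_of r q.
  by rewrite gam2 /eps_of -/a; field; rewrite subr_eq0 (gt_eqF q1) (gt_eqF q0) (gt_eqF r0).
rewrite -(scalerA (gam ^+ 2)) -scalerDr ldetZ; last 2 first.
- by rewrite exprn_gt0.
- by apply: spos_addl => //; apply: pos_selfsq; exact: herm_star.
have -> : 1 - p = (1 + a) / 2 by rewrite /p; field.
rewrite gam2 ln_div ?posrE// lnM ?posrE ?subr_gt0// lnXn// /ldet_of -/a => h1.
by move: h1; rewrite -mulr_natl; lra.
Qed.

(** Explicit values exist only at the regularisations [eps_of r q]; any small [e] lies between two
    of them, and the log-determinant is monotone in [e]. *)
Lemma ldet_herm_limit d : 0 < d -> exists2 e0 : R, 0 < e0 & forall e, 0 < e -> e <= e0 ->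
  `|ldet (herm * herm + e *: 1) - 2 * limit_value r| <= d.
Proof.
move=> d0; have [q [aq _ hq]] := admissible_approx r0 ltr01 d0.
have pp : pos (herm * herm) by apply: pos_selfsq; exact: herm_star.
have mono x y : 0 < x -> x <= y ->
    ldet (herm * herm + x *: 1) <= ldet (herm * herm + y *: 1).
  move=> x0 xy; apply: ldet_le; first exact: spos_addl.
  rewrite opprD addrACA subrr add0r -scalerBl; apply: pos_scalar.
  by rewrite subr_ge0.
exists (eps_of r q); first exact: eps_of_gt0.
move=> e e0 ee; rewrite ler_norml; apply/andP; split; last first.
  have := mono _ _ e0 ee; rewrite ldet_herm_param//.
  by move: hq; rewrite ler_norml => /andP[_]; lra.
have [q' [aq' eq' hq']] := admissible_approx r0 e0 d0.
have := mono _ _ (eps_of_gt0 r0 aq') eq'; rewrite ldet_herm_param//.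
by move: hq'; rewrite ler_norml => /andP[]; lra.
Qed.

End Offdiagonal.
End Link.

Lemma anticommuting_projection (R : realType) (A : algType R) (f y : A) :
  (1 - f - f) * y = - (y * (1 - f - f)) -> f * y = y - y * f.
Proof.
move=> e; have h : (f * y - (y - y * f)) + (f * y - (y - y * f)) = 0.
  have -> : (f * y - (y - y * f)) + (f * y - (y - y * f)) =
    - ((1 - f - f) * y) - y * (1 - f - f) by Ncring_tac.non_commutative_ring.
  by rewrite e opprK subrr.
apply/eqP; rewrite -subr_eq0; move/eqP: h; rewrite -mulr2n -scaler_nat scaler_eq0.
by rewrite pnatr_eq0.
Qed.

(** * The Schur complement factorisation of W + N - z *)

Section Factorization.
Variables (R : realType) (A : algType R) (T : tracial A).
Local Notation st := (star T).
Local Notation t := (tr T).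
Local Notation pos := (pos T).
Local Notation ldet := (ldet T).
Variable sc : {rmorphism R[i] -> A}.
Hypothesis scC : forall z x, sc z * x = x * sc z.
Hypothesis sc_star : forall z, st (sc z) = sc (z^*)%C.
Hypothesis sc_real : forall x : R, sc (x%:C) = x *: 1.
Variables W N J : A.
Hypothesis W2 : W * W = 1.
Hypothesis Ws : st W = W.
Hypothesis N2 : N * N = 0.
Hypothesis Nu : N * st N + st N * N = 1.
Hypothesis J1 : J * st J = 1.
Hypothesis J2 : st J * J = 1.
Hypothesis JW : J * W = - (W * J).
Local Notation sgn := (sgn T N).
Local Notation herm := (herm T sc W N).
Hypothesis tr_sgn : t sgn = 0.
Hypothesis flips_free : forall om : R[i], `|om| = 1 -> forall (z : R[i]) (w : seq 'I_3),
  w != [::] -> sorted (fun i j => i != j) w ->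
  t (sc z * \prod_(i <- w) flips T sc W N om i) = 0.

Local Notation f1 := (N * st N).
Local Notation f2 := (st N * N).

(** Moving one [Y] around the trace changes the sign of every term containing Y^2, and the constant
    term is a multiple of [t S]. For S = [sgn] this says that the two diagonal blocks of Y^2 have
    equal moments. *)
Lemma tr_anti S Y c d n : S * Y = - (Y * S) -> t S = 0 ->
  t (S * (c *: 1 - d *: (Y * Y)) ^+ n) = 0.
Proof.
move=> SY tS.
have [Q QY ->] : exists2 Q, Q * Y = Y * Q &
    (c *: 1 - d *: (Y * Y)) ^+ n = (c ^+ n) *: 1 + Y * Y * Q.
  elim: n => [|n [Q QY IH]].
    by exists 0; rewrite ?mulr0 ?mul0r// expr0 scale1r addr0.
  exists (c *: Q - (d * c ^+ n) *: 1 - d *: (Y * Y * Q)).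
    have e : Y * Y * Q * Y = Y * (Y * Y * Q) by rewrite -mulrA QY !mulrA.
    by rewrite !(mulrBl, mulrBr) -!(scalerAl, scalerAr) mul1r mulr1 QY e.
  rewrite exprS IH exprS mulrBl -!scalerAl mul1r !(mulrBr (Y * Y)) -!scalerAr mulr1.
  rewrite (mulrDr (Y * Y)) -scalerAr mulr1 !scalerDr !scalerA !mulrA.
  by rewrite opprD; Ncring_tac.non_commutative_ring.
have e : t (S * (Y * Y * Q)) = - t (S * (Y * Y * Q)).
  have e1 : t (Y * S * (Y * Q)) = t (S * (Y * Y * Q)).
    by rewrite -mulrA trC -!mulrA QY.
  by rewrite -[in RHS]e1 -trN -mulNr -SY !mulrA.
rewrite mulrDr trD -scalerAr mulr1 trZ tS mulr0 add0r.
by move: e; lra.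
Qed.

Variable lam : R[i].
Let nu : R[i] := 1 - lam ^+ 2.
Let r : R := complex.Re `|nu|.
Hypothesis r0 : 0 < r.

Let c : A := sc (nu^-1).
Let l : A := sc lam.
Variable Y : A.
Hypothesis YE : Y = herm nu.

Let nu0 : nu != 0.
Proof. by apply/eqP => e; move: r0; rewrite /r e normr0 ltxx. Qed.

Let cC x : c * x = x * c. Proof. exact: scC. Qed.
Let lC x : l * x = x * l. Proof. exact: scC. Qed.
Let cnu : c * sc nu = 1.
Proof. by rewrite /c -rmorphM mulVf// rmorph1. Qed.
Let nuE : sc nu = 1 - l * l.
Proof. by rewrite /nu rmorphB rmorph1 rmorphXn expr2. Qed.

Let cc : c * st c = r ^- 2 *: 1.
Proof.
rewrite /c sc_star sc_norm//; congr (_ *: _).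
rewrite -exprVn; congr (_ ^+ 2); rewrite normfV.
have -> : `|nu| = r%:C by rewrite /r normc_def.
by rewrite -(fmorphV (real_complex R)).
Qed.

Let k : A := W - l.
Let d : A := 1 + c * (f2 * W * N).
Let u : A := (1 + c * (f1 * W * N)) * (1 + c * l * N).

Let Nf1 : N * f1 = 0. Proof. by rewrite mulrA N2 mul0r. Qed.

(** Since (W - l) (W + l) = nu, the element is k (1 + c (W + l) N). The relations N^2 = 0 and N f1 =
    0 split off the unipotent factor [u], leaving [d], which differs from 1 only in the corner of
    [f2]. *)
Let bE : W + N - l = k * d * u.
Proof.
have e1 : d * (1 + c * (f1 * W * N)) = 1 + c * W * N.
  rewrite /d.
  have -> : (1 + c * (f2 * W * N)) * (1 + c * (f1 * W * N)) =
    1 + c * (f2 * W * N) + c * (f1 * W * N) + c * f2 * W * (N * c) * f1 * W * N.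
    by Ncring_tac.non_commutative_ring.
  rewrite -cC.
  have -> : c * f2 * W * (c * N) * f1 * W * N = c * f2 * W * c * (N * f1) * W * N.
    by Ncring_tac.non_commutative_ring.
  rewrite Nf1 mulr0 !mul0r addr0.
  have -> : 1 + c * (f2 * W * N) + c * (f1 * W * N) = 1 + c * ((f1 + f2) * W * N).
    by Ncring_tac.non_commutative_ring.
  by rewrite Nu mul1r mulrA.
have e2 : (1 + c * W * N) * (1 + c * l * N) = 1 + c * (W + l) * N.
  have -> : (1 + c * W * N) * (1 + c * l * N) =
      1 + c * (W + l) * N + c * W * (N * (c * l)) * N.
    by Ncring_tac.non_commutative_ring.
  rewrite (_ : N * (c * l) = c * l * N); last by rewrite mulrA -cC -mulrA -lC mulrA.
  by rewrite -!mulrA N2 !mulr0 addr0.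
rewrite /u -(mulrA k) (mulrA d) e1 e2 mulrDr mulr1.
have -> : k * (c * (W + l) * N) = c * sc nu * N.
  rewrite !mulrA -(cC k) -(mulrA c); congr (_ * _ * _).
  rewrite /k nuE mulrDr !mulrBl W2 -lC.
  by Ncring_tac.non_commutative_ring.
by rewrite cnu mul1r /k addrAC.
Qed.

Let k' : A := c * (W + l).

Let ik : isinv k k'.
Proof.
have e : k * (W + l) = sc nu.
  by rewrite /k nuE mulrDr !mulrBl W2 -lC; Ncring_tac.non_commutative_ring.
have e' : (W + l) * k = sc nu.
  by rewrite /k nuE mulrBr !mulrDl W2 -lC; Ncring_tac.non_commutative_ring.
split; rewrite /k'; first by rewrite mulrA -cC -mulrA e.
by rewrite -mulrA e'.
Qed.

(** The unitary [J] conjugates W - l into -(W + l), so both factors of the product nu contribute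
    equally. *)
Lemma ldet_k : ldet (k * st k) = ln r.
Proof.
have iJ : isinv J (st J) by split.
have iJs : isinv (st J) J by exact: isinv_sym.
have iWl : isinv (W + l) (c * k).
  split.
    rewrite mulrA -cC -mulrA -cnu; congr (_ * _).
    by rewrite /k nuE mulrBr !mulrDl W2 -lC; Ncring_tac.non_commutative_ring.
  rewrite -mulrA -cnu; congr (_ * _).
  by rewrite /k nuE mulrDr !mulrBl W2 -lC; Ncring_tac.non_commutative_ring.
have e1 := ldet_mul T (isinvM iJ ik) iJs; have e2 := ldet_mul T iJ ik.
have e3 := ldet_mul T ik iWl.
have J3 : st J * st (st J) = 1 by rewrite starK.
rewrite (ldet_unitary J3) e2 (ldet_unitary J1) add0r addr0 in e1.
have E : J * k * st J = - (W + l).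
  rewrite /k mulrBr mulrBl JW -(lC J) mulNr -!(mulrA _ J) J1 !mulr1.
  by rewrite opprD.
rewrite E starN mulrNN in e1.
have E2 : k * (W + l) = sc nu.
  by rewrite /k nuE mulrDr !mulrBl W2 -lC; Ncring_tac.non_commutative_ring.
rewrite E2 sc_star sc_norm// -/r ldet_scalar ?exprn_gt0// lnXn// in e3.
by move: e3; rewrite e1 -mulr_natl; lra.
Qed.

(** Such an [x] is strictly upper triangular with respect to [sgn], which conjugates it into [- x];
    [ldet_nilpotent] then applies to [x] and to its adjoint. *)
Let sgn_nilp x : x * x = 0 -> sgn * x = x -> x * sgn = - x ->
  ldet ((1 + x) * st (1 + x)) = 0 /\ ldet (st (1 + x) * (1 + x)) = 0.
Proof.
move=> xx h1 h2; have s2 := sgn_sq N2 Nu; have ss := sgn_star Nu.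
split; first by apply: (ldet_nilpotent s2 ss xx); rewrite h1 h2.
have E : ldet ((1 + st x) * st (1 + st x)) = 0.
  apply: (ldet_nilpotent s2 ss); first by rewrite -starM xx linear0.
  by rewrite -{1}ss -{2}ss -!starM mulrA h1 h2 starN.
by move: E; rewrite !starD !star1 starK.
Qed.

Let u1 : A := c * (f1 * W * N).
Let u2 : A := c * l * N.

Let u1_facts : [/\ u1 * u1 = 0, sgn * u1 = u1 & u1 * sgn = - u1].
Proof.
rewrite /u1; split.
- rewrite -!mulrA (mulrA N c) -cC -!mulrA (mulrA N N) N2 mul0r !mulr0.
  by [].
- have e : sgn * (f1 * W * N) = f1 * W * N by rewrite !(mulrA sgn) (sgnN N2 Nu).
  by rewrite mulrA -cC -mulrA e.
- by rewrite -!mulrA (Nsgn N2 Nu) !mulrN.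
Qed.

Let u2_facts : [/\ u2 * u2 = 0, sgn * u2 = u2 & u2 * sgn = - u2].
Proof.
rewrite /u2; split.
- have -> : c * l * N * (c * l * N) = c * l * (N * (c * l)) * N.
    by Ncring_tac.non_commutative_ring.
  rewrite (_ : N * (c * l) = c * l * N); last by rewrite mulrA -cC -mulrA -lC mulrA.
  by rewrite -!mulrA N2 !mulr0.
- have e : sgn * (c * l) = c * l * sgn by rewrite mulrA -cC -mulrA -lC mulrA.
  by rewrite mulrA e -mulrA (sgnN N2 Nu).
- by rewrite -!mulrA (Nsgn N2 Nu) !mulrN.
Qed.

Let isinv_nilp (x : A) : x * x = 0 -> isinv (1 + x) (1 - x).
Proof.
move=> xx; split.
  have -> : (1 + x) * (1 - x) = 1 - x * x by Ncring_tac.non_commutative_ring.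
  by rewrite xx subr0.
have -> : (1 - x) * (1 + x) = 1 - x * x by Ncring_tac.non_commutative_ring.
by rewrite xx subr0.
Qed.

Let iu : exists u', isinv u u'.
Proof.
have [h1 _ _] := u1_facts; have [h2 _ _] := u2_facts.
by eexists; apply: isinvM; apply: isinv_nilp.
Qed.

Lemma ldet_u : ldet (st u * u) = 0.
Proof.
have [h1 h2 h3] := u1_facts; have [g1 g2 g3] := u2_facts.
have i1 := isinv_star T (isinv_nilp h1); have i2 := isinv_star T (isinv_nilp g1).
have := ldet_mul T i2 i1; rewrite -(starM T (1 + u1)) !starK -/u1 -/u2.
have [_ ->] := sgn_nilp h1 h2 h3; have [_ ->] := sgn_nilp g1 g2 g3.
by rewrite addr0.
Qed.

Let Ysgn : sgn * Y = - (Y * sgn). Proof. by rewrite YE; exact: sgn_herm. Qed.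
Let Yst : st Y = Y. Proof. by rewrite YE; exact: herm_star. Qed.
Let f2f2' : f2 * f2 = f2. Proof. exact: f2f2. Qed.
Let sgnE' : sgn = 1 - f2 - f2. Proof. exact: sgnE. Qed.

Let f2Y : f2 * Y = Y - Y * f2.
Proof. by apply: anticommuting_projection; rewrite -sgnE'; exact: Ysgn. Qed.

Let f2YY : f2 * (Y * Y) = Y * Y * f2.
Proof.
rewrite mulrA f2Y mulrBl -(mulrA Y f2) f2Y.
by Ncring_tac.non_commutative_ring.
Qed.

Let f2YNE : f2 * Y * N = f2 * W * N + sc nu * f2.
Proof.
have NN := NsN N2 Nu.
rewrite YE /herm /off.
set a := sc nu; set b := sc _.
have -> : f2 * (f1 * W * f2 + f2 * W * f1 + (a * st N + b * N)) * N =
   st N * (N * N) * st N * W * f2 * N + f2 * f2 * W * (f1 * N) + f2 * a * (st N * N) +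
   f2 * b * (N * N) by Ncring_tac.non_commutative_ring.
rewrite N2 NN f2f2' !mulr0 !mul0r addr0 add0r -(scC nu).
by rewrite -(mulrA (sc nu)) f2f2'.
Qed.

(** Right multiplication by [N] moves the lower left entry of [Y] into the corner of [f2].
    Consequently [d * st d] carries r^-2 times the lower block of Y^2 there. *)
Let dE : d = (1 - f2) + c * (f2 * Y * N).
Proof.
rewrite f2YNE (mulrDr c) (mulrA c (sc nu)) cnu mul1r /d.
by Ncring_tac.non_commutative_ring.
Qed.

Let f2N0 : f2 * N = 0. Proof. exact: f2N. Qed.
Let Nsf20 : st N * f2 = 0. Proof. exact: Nsf2. Qed.

Let ddE : d * st d = (1 - f2) + r ^- 2 *: (f2 * (Y * Y)).
Proof.
rewrite dE starD starB star1 f2s starM !starM starK Yst.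
set cs := st c.
have -> : (1 - f2 + c * (f2 * Y * N)) * (1 - f2 + st N * (Y * (st N * N)) * cs) =
   (1 - f2 - f2 + f2 * f2) + (st N - f2 * st N) * Y * f2 * cs +
   c * f2 * Y * (N - N * f2) + c * (f2 * Y * f1 * Y * f2) * cs.
  by Ncring_tac.non_commutative_ring.
rewrite f2f2' (f2Ns N2 Nu) (Nf2 N2 Nu) !subrr !mulr0 !mul0r !addr0 subrK.
congr (_ + _); rewrite cC -mulrA cc -scalerAr mulr1; congr (_ *: _).
have -> : f1 = 1 - f2 by rewrite -Nu addrK.
have e0 : f2 * Y * f2 = 0 by rewrite f2Y mulrBl -(mulrA Y) f2f2' subrr.
have -> : f2 * Y * (1 - f2) * Y * f2 = f2 * (Y * Y) * f2 - (f2 * Y * f2) * Y * f2.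
  by Ncring_tac.non_commutative_ring.
by rewrite e0 !mul0r subr0 f2YY -(mulrA (Y * Y)) f2f2'.
Qed.

Let f2tr (x : A) : t (sgn * x) = 0 -> t (f2 * x) = t x / 2.
Proof.
rewrite sgnE' !mulrBl mul1r !trB => h.
by move: h; lra.
Qed.

Let f2s' : st f2 = f2. Proof. exact: f2s. Qed.

(** Regularising only in the corner of [f2] gives an exact formula: with Y^2 + r^2 e in that corner,
    conjugation by an element scaling the corner by 1 / r yields [d * st d + e *: f2]. The corner
    contributes one half by [tr_anti], and the scaling contributes -ln r. *)
Let ldet_core e : 0 < e ->
  spos T (d * st d + e *: f2) /\
  ldet (d * st d + e *: f2) = ldet (Y * Y + (r ^+ 2 * e) *: 1) / 2 - ln r.
Proof.
move=> e0; have r2 : 0 < r ^+ 2 by rewrite exprn_gt0.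
set a := Y * Y + _.
have pa : spos T a by apply: spos_addl; [exact: mulr_gt0|exact: pos_selfsq].
have fa : f2 * a = a * f2.
  by rewrite /a (mulrDr f2) (mulrDl _ _ f2) f2YY mulr_algr mulr_algl.
have [pZ EZ] : spos T (1 - f2 + f2 * a) /\ ldet (1 - f2 + f2 * a) = ldet a / 2.
  apply: ldet_corner => // C n; apply: f2tr.
  have -> : gap C a = (1 - C^-1 * (r ^+ 2 * e)) *: 1 - C^-1 *: (Y * Y).
    rewrite /gap /a scalerDr scalerA scalerBl scale1r.
    by Ncring_tac.non_commutative_ring.
  exact: tr_anti.
pose q := 1 - f2 + r^-1 *: f2.
have sq : st q = q by rewrite /q starD starB starZ star1 f2s'.
have q2 : q * q = 1 - f2 + f2 * (r ^- 2 *: 1).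
  rewrite /q -[f2 * (_ *: _)]scalerAr mulr1.
  have -> : (1 - f2 + r^-1 *: f2) * (1 - f2 + r^-1 *: f2) =
    (1 - f2 - f2 + f2 * f2) + (r^-1 *: f2 - f2 * (r^-1 *: f2)) +
    (r^-1 *: f2 - (r^-1 *: f2) * f2) + (r^-1 *: f2) * (r^-1 *: f2).
    by Ncring_tac.non_commutative_ring.
  rewrite -!(scalerAl, scalerAr) f2f2' !subrr !addr0 subrK scalerA -exprVn expr2.
  by [].
have ri : 0 < r ^- 2 by rewrite invr_gt0.
have Eq : ldet (q * st q) = - ln r.
  have [_] : spos T (1 - f2 + f2 * (r ^- 2 *: 1)) /\
      ldet (1 - f2 + f2 * (r ^- 2 *: 1)) = ldet (r ^- 2 *: 1) / 2.
    apply: ldet_corner => //.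
    - by rewrite -scalerAr -scalerAl mulr1 mul1r.
    - move=> C n; apply: f2tr.
      have -> : gap C (r ^- 2 *: 1) = (1 - C^-1 * r ^- 2) *: 1 :> A.
        by rewrite /gap scalerA scalerBl scale1r.
      by rewrite exprZn expr1n -scalerAr mulr1 trZ tr_sgn mulr0.
    by exists (r ^- 2) => //; rewrite subrr; exact: pos0.
  rewrite sq q2 => ->; rewrite ldet_scalar// lnV ?posrE// lnXn// -mulr_natl.
  by field.
have iq : isinv q (1 - f2 + r *: f2).
  have rr : r != 0 by rewrite gt_eqF.
  rewrite /q; split.
    have -> : (1 - f2 + r^-1 *: f2) * (1 - f2 + r *: f2) =
      (1 - f2 - f2 + f2 * f2) + (r *: f2 - f2 * (r *: f2)) +
      (r^-1 *: f2 - (r^-1 *: f2) * f2) + (r^-1 *: f2) * (r *: f2).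
      by Ncring_tac.non_commutative_ring.
    by rewrite -!(scalerAl, scalerAr) f2f2' !subrr !addr0 subrK scalerA mulVf// scale1r subrK.
  have -> : (1 - f2 + r *: f2) * (1 - f2 + r^-1 *: f2) =
    (1 - f2 - f2 + f2 * f2) + (r^-1 *: f2 - f2 * (r^-1 *: f2)) +
    (r *: f2 - (r *: f2) * f2) + (r *: f2) * (r^-1 *: f2).
    by Ncring_tac.non_commutative_ring.
  by rewrite -!(scalerAl, scalerAr) f2f2' !subrr !addr0 subrK scalerA mulfV// scale1r subrK.
have E : q * (1 - f2 + f2 * a) * st q = d * st d + e *: f2.
  rewrite sq ddE.
  have qf : q * f2 = r^-1 *: f2.
    by rewrite /q mulrDl mulrBl mul1r f2f2' subrr add0r -scalerAl f2f2'.
  have fq : f2 * q = r^-1 *: f2.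
    by rewrite /q mulrDr mulrBr mulr1 f2f2' subrr add0r -scalerAr f2f2'.
  have -> : q * (1 - f2 + f2 * a) * q =
     (q * q - q * (f2 * q)) + q * f2 * (a * q) by Ncring_tac.non_commutative_ring.
  have e1 : q * (f2 * q) = r ^- 2 *: f2.
    by rewrite fq -scalerAr qf scalerA -expr2 exprVn.
  have e2 : q * f2 * (a * q) = r ^- 2 *: (f2 * a).
    rewrite qf -scalerAl (mulrA f2 a q) fa -(mulrA a f2 q) fq -scalerAr -fa.
    by rewrite scalerA -expr2 exprVn.
  rewrite e1 e2 q2 mulr_algr addrK /a (mulrDr f2) scalerDr mulr_algr scalerA addrA.
  by rewrite (mulrA (r ^- 2)) mulVf ?mul1r// gt_eqF.
rewrite -E; split; first exact: (spos_conj iq pZ).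
by rewrite (ldet_conj iq pZ) EZ Eq.
Qed.

(** On the complementary corner [d * st d] is already 1, so the full regularisation lies between the
    partial one and 1 + e times the partial one. *)
Let ldet_dd e : 0 < e ->
  ldet (Y * Y + (r ^+ 2 * e) *: 1) / 2 - ln r <= ldet (d * st d + e *: 1) /\
  ldet (d * st d + e *: 1) <=
    ln (1 + e) + (ldet (Y * Y + (r ^+ 2 * e) *: 1) / 2 - ln r).
Proof.
move=> e0; have [p1 <-] := ldet_core e0.
have r2 : 0 < r ^- 2 by rewrite invr_gt0 exprn_gt0.
have pf : pos f2 by exact: pos_sq.
have pf' : pos (1 - f2).
  have -> : 1 - f2 = N * st N by rewrite -Nu addrK.
  exact: pos_sq'.
split.
  apply: ldet_le => //; rewrite opprD addrACA subrr add0r -scalerBr.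
  by apply: posZ => //; exact: ltW.
have e1 : 0 < 1 + e by rewrite ltr_wpDl.
rewrite -ldetZ//; apply: ldet_le.
  by apply: spos_addl => //; exact: pos_sq'.
rewrite ddE.
have -> : (1 + e) *: (1 - f2 + r ^- 2 *: (f2 * (Y * Y)) + e *: f2) -
   (1 - f2 + r ^- 2 *: (f2 * (Y * Y)) + e *: 1) =
   (e * r ^- 2) *: (f2 * (Y * Y)) + (e * e) *: f2.
  rewrite scalerDl scale1r !scalerDr !scalerN !scalerA.
  have E (a1 a2 a3 a4 a5 a6 : A) :
      a1 + a2 + a3 + (a4 - a3 + a5 + a6) - (a1 + a2 + a4) = a5 + a6.
    by Ncring_tac.non_commutative_ring.
  exact: E.
apply: posD; apply: posZ => //; try by rewrite mulr_ge0 ?ltW.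
have -> : f2 * (Y * Y) = st (Y * f2) * (Y * f2).
  rewrite starM Yst f2s'.
  have -> : f2 * Y * (Y * f2) = f2 * (Y * Y) * f2 by Ncring_tac.non_commutative_ring.
  by rewrite f2YY -(mulrA (Y * Y)) f2f2'.
exact: pos_sq.
Qed.

(** The ln r coming from [k] cancels the -ln r of the corner scaling; what remains is half of the
    limit for Y^2, that is [limit_value r]. *)
Lemma ldet_regularized_limit d0 : 0 < d0 -> exists2 e0 : R, 0 < e0 &
  forall e, 0 < e -> e <= e0 ->
  `|ldet (st (W + N - sc lam) * (W + N - sc lam) + e *: 1) - limit_value r| <= d0.
Proof.
move=> d00; have [u' iu'] := iu.
have [K K1 hK] := ldet_sandwich2 T d ik iu'.
have K0 := lt_le_trans ltr01 K1; have r2 : 0 < r ^+ 2 by rewrite exprn_gt0.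
have [e0 e00 he0] := ldet_herm_limit scC sc_star sc_real W2 Ws N2 Nu flips_free r0 d00.
rewrite -YE in he0.
(* The first bound puts the rescaled regularisation within reach of [ldet_herm_limit], whose error
   is halved to d0 / 2; the second makes ln (1 + e K) at most d0 / 2. *)
exists (Num.min (e0 / (r ^+ 2 * K)) (d0 / (2 * K))).
  by rewrite lt_min !divr_gt0// mulr_gt0.
move=> e ep; rewrite le_min => /andP[h1 h2].
have [g1 g2] := hK _ ep; move: g1 g2; rewrite -bE ldet_k ldet_u addr0.
have eK1 : 0 < e / K by rewrite divr_gt0.
have eK2 : 0 < e * K by rewrite mulr_gt0.
have [g3 _] := ldet_dd eK1; have [_ g4] := ldet_dd eK2.
rewrite ler_pdivlMr ?mulr_gt0// in h1; rewrite ler_pdivlMr ?mulr_gt0// in h2.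
have b2 : r ^+ 2 * (e * K) <= e0 by rewrite mulrCA.
have b1 : r ^+ 2 * (e / K) <= e0.
  apply: le_trans b2; apply: ler_wpM2l; first exact: ltW.
  rewrite ler_pdivrMr// -mulrA; apply: ler_peMr; first exact: ltW.
  by rewrite mulr_ege1.
have l1 := he0 _ (mulr_gt0 r2 eK1) b1; have l2 := he0 _ (mulr_gt0 r2 eK2) b2.
have ll : ln (1 + e * K) <= e * K by apply: le_ln1Dx; move: eK2; lra.
move: l1 l2; rewrite !ler_norml => /andP[l1 _] /andP[_ l2] g1 g2.
by apply/andP; split; lra.
Qed.

End Factorization.

(** * Hilbert space preliminaries with real-valued norms *)

Section Hilbert.
Variables (R : realType) (H : completeNormedModType R[i]).
Variable dot : {dot H for Num.conj}.
Hypothesis hdot : hilbert_norm dot.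
Implicit Types (A B : H -> H) (x y : H).

Lemma dotDl x y z : dot (x + y) z = dot x z + dot y z.
Proof. exact: (linearDl dot). Qed.
Lemma dotBl x y z : dot (x - y) z = dot x z - dot y z.
Proof. exact: (linearBl dot). Qed.
Lemma dotDr x y z : dot z (x + y) = dot z x + dot z y.
Proof. exact: (linearDr dot). Qed.
Lemma dotBr x y z : dot z (x - y) = dot z x - dot z y.
Proof. exact: (linearBr dot). Qed.
Lemma dotZl c x z : dot (c *: x) z = c * dot x z.
Proof. exact: (linearZl_LR dot). Qed.
Lemma dotZr c x z : dot z (c *: x) = Num.conj c * dot z x.
Proof. exact: (linearZr_LR dot). Qed.
Lemma dotC x y : dot x y = Num.conj (dot y x).
Proof. by rewrite (@hermitian_subproof _ _ _ _ dot x y) /= expr0 mul1r. Qed.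

Lemma conjcE (z : R[i]) : Num.conj z = (z^*)%C. Proof. by []. Qed.

(** The norm of [H] takes values in [R[i]]; this is the same number as a real. *)
Definition nrm x : R := complex.Re `|x|.

Lemma nrmE x : `|x| = (nrm x)%:C.
Proof.
have := normr_ge0 x; rewrite /nrm; case: `|x| => a b /=.
by rewrite lecE /= => /andP[/eqP -> _].
Qed.

Lemma nrm_ge0 x : 0 <= nrm x.
Proof. by rewrite -lecR -nrmE normr_ge0. Qed.

Lemma dot_nrm x : dot x x = (nrm x ^+ 2)%:C.
Proof. by rewrite hdot nrmE rmorphXn. Qed.

Lemma nrm_eq0 x : nrm x = 0 -> x = 0.
Proof. by move=> h; apply/eqP; rewrite -normr_eq0 nrmE h. Qed.

Lemma dot_eq0 x : dot x x = 0 -> x = 0.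
Proof.
rewrite dot_nrm => /eqP; rewrite -[0]/(0%:C) (inj_eq (@complexI R)) sqrf_eq0.
by move/eqP/nrm_eq0.
Qed.

Lemma dot_inj x y : (forall z, dot z x = dot z y) -> x = y.
Proof.
move=> h; apply/eqP; rewrite -subr_eq0; apply/eqP; apply: dot_eq0.
by rewrite dotBr h subrr.
Qed.

(* Polarization over the complex numbers. *)
Lemma quadratic_form_eq0 A : linear A -> (forall x, dot (A x) x = 0) -> forall x, A x = 0.
Proof.
move=> lA h x.
have AD u v : A (u + v) = A u + A v by have := lA 1 u v; rewrite !scale1r.
have A0 : A 0 = 0 by apply: (addrI (A 0)); rewrite -AD !addr0.
have AZ c u : A (c *: u) = c *: A u by have := lA c u 0; rewrite !addr0 A0 addr0.
have e1 u v : dot (A u) v + dot (A v) u = 0.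
  have := h (u + v); rewrite AD !dotDl !dotDr !h add0r addr0.
  by rewrite addrC.
apply: dot_inj => z; rewrite linear0r dotC.
have i0 : ('i%C : R[i]) != 0 by rewrite eq_complex /= oner_eq0 andbF.
have := e1 x ('i%C *: z); rewrite AZ dotZl dotZr.
have -> : Num.conj ('i%C : R[i]) = - 'i%C.
  by rewrite conjcE; apply/eqP; rewrite eq_complex /= oppr0 !eqxx.
rewrite mulNr -mulrN -mulrDr => /eqP; rewrite mulf_eq0 (negPf i0) /= => /eqP e.
have : dot (A x) z + dot (A x) z = 0.
  move: (e1 x z) e; set d1 := dot (A x) z; set d2 := dot (A z) x => f e.
  have -> : d1 + d1 = (d1 + d2) - (- d1 + d2) by ring.
  by rewrite f e subrr.
by rewrite -mulr2n => /eqP; rewrite mulrn_eq0 /= => /eqP ->; rewrite conjC0.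
Qed.

Lemma cvg_of_geometric (u : nat -> H) (r K : R) : 0 <= r -> r < 1 ->
  (forall n m, nrm (u (n + m)%N - u n) <= r ^+ n * K) -> cvgn u.
Proof.
move=> r0 r1 h; apply: cauchy_cvg; apply: cauchy_exP => e e0.
have [eR ep] : e = (complex.Re e)%:C /\ 0 < complex.Re e.
  by case: e e0 => a b; rewrite ltcE /= => /andP[/eqP -> ->].
have K0 : 0 <= K by have := h 0%N 0%N; rewrite expr0 mul1r; apply: le_trans; exact: nrm_ge0.
have : (fun n => r ^+ n * K) @ \oo --> (0 : R).
  rewrite -[X in _ --> X](mul0r K); apply: cvgMl; apply: cvg_expr.
  by rewrite ger0_norm.
move/cvgrPdist_lt => /(_ _ ep) [N _ hN].
exists (u N); exists N => // n /= Nn.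
rewrite -ball_normE /= eR distrC nrmE ltcR.
apply: le_lt_trans (_ : r ^+ N * K < _).
  by rewrite -(subnKC Nn); exact: h.
have := hN N (leqnn _); rewrite /= sub0r normrN ger0_norm// mulr_ge0//.
exact: exprn_ge0.
Qed.

Lemma linear_bounded_nrm A : bounded_operator A ->
  exists2 K : R, 0 <= K & forall x, nrm (A x) <= K * nrm x.
Proof.
move=> [lA cA].
pose lAm := GRing.isLinear.Build _ _ _ _ A lA.
pose f : {linear H -> H} := HB.pack A lAm.
have /linear_boundedP /pinfty_ex_gt0 [M M0 hM] : bounded_near f (nbhs (0 : H)).
  by apply: continuous_linear_bounded; exact: cA.
have [MR Mp] : M = (complex.Re M)%:C /\ 0 < complex.Re M.
  by case: M M0 {hM} => a b; rewrite ltcE /= => /andP[/eqP -> ->].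
exists (complex.Re M); first exact: ltW.
by move=> x; have := hM x; rewrite !nrmE MR -rmorphM lecR.
Qed.

Lemma nrm_bounded_continuous A K : linear A ->
  (forall x, nrm (A x) <= K * nrm x) -> continuous A.
Proof.
move=> lA hA.
pose lAm := GRing.isLinear.Build _ _ _ _ A lA.
pose f : {linear H -> H} := HB.pack A lAm.
apply: (@bounded_linear_continuous _ _ _ f).
apply/linear_boundedP; near=> M => x.
apply: (@le_trans _ _ (K%:C * `|x|)); first by rewrite !nrmE -rmorphM lecR; exact: hA.
apply: ler_wpM2r; first exact: normr_ge0.
by near: M; apply: nbhs_pinfty_ge; rewrite complex_real.
Unshelve. all: by end_near.
Qed.

End Hilbert.

(** * A von Neumann algebra with trace as a real tracial algebra *)

Section VonNeumann.
Variables (R : realType) (H : completeNormedModType R[i]).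
Variable dot : {dot H for Num.conj}.
Hypothesis hdot : hilbert_norm dot.
Variable M : set (H -> H).
Hypothesis vn : von_neumann_algebra dot M.
Variable tau : (H -> H) -> R[i].
Hypothesis ft : faithful_normal_trace dot M tau.

Let MP A : M A <-> bounded_operator A /\ forall B, commutant M B -> A \o B = B \o A.
Proof. by rewrite -{1}(vn_bicommutant vn). Qed.

Let M_lin A : M A -> linear A. Proof. by move/MP => [[]]. Qed.
Let M_cont A : M A -> continuous A. Proof. by move/MP => [[]]. Qed.
Let M_comm A B x : M A -> commutant M B -> A (B x) = B (A x).
Proof. by move=> /MP[_ h] /h /(congr1 (fun f => f x)). Qed.

Let M_intro A : linear A -> continuous A ->
  (forall B x, commutant M B -> A (B x) = B (A x)) -> M A.
Proof.
move=> lA cA h; apply/MP; split => // B hB; apply/funext => x /=; exact: h.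
Qed.

Let C_lin B : commutant M B -> linear B. Proof. by move=> [[]]. Qed.

Let linD (A : H -> H) : linear A -> forall x y, A (x + y) = A x + A y.
Proof. by move=> lA x y; have := lA 1 x y; rewrite !scale1r. Qed.
Let lin0 (A : H -> H) : linear A -> A 0 = 0.
Proof. by move=> lA; apply: (addrI (A 0)); rewrite -linD// !addr0. Qed.
Let linZ (A : H -> H) : linear A -> forall c x, A (c *: x) = c *: A x.
Proof. by move=> lA c x; have := lA c x 0; rewrite !addr0 lin0// addr0. Qed.
Let linN (A : H -> H) : linear A -> forall x, A (- x) = - A x.
Proof. by move=> lA x; rewrite -scaleN1r linZ// scaleN1r. Qed.
Let linB (A : H -> H) : linear A -> forall x y, A (x - y) = A x - A y.
Proof. by move=> lA x y; rewrite linD// linN. Qed.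

Lemma M_id : M id.
Proof. by apply: M_intro => // x; exact: cvg_id. Qed.

Lemma M_add A B : M A -> M B -> M (A + B).
Proof.
move=> hA hB; have lA := M_lin hA; have lB := M_lin hB; apply: M_intro.
- by move=> c x y; rewrite !fctE (lA c x y) (lB c x y) scalerDr addrACA.
- by move=> x; apply: cvgD; [exact: (M_cont hA)|exact: (M_cont hB)].
- by move=> B' x hB'; rewrite !fctE (M_comm x hA hB') (M_comm x hB hB') linD//; exact: C_lin.
Qed.

Lemma M_scale c A : M A -> M (c *: A).
Proof.
move=> hA; have lA := M_lin hA; apply: M_intro.
- move=> d x y; rewrite !fctE (lA d x y) scalerDr !scalerA mulrC.
  by rewrite -!scalerA.
- by move=> x; apply: cvgZr; exact: (M_cont hA).
- by move=> B' x hB'; rewrite !fctE (M_comm x hA hB') linZ//; exact: C_lin.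
Qed.

Lemma M_comp A B : M A -> M B -> M (A \o B).
Proof.
move=> hA hB; have lA := M_lin hA; have lB := M_lin hB; apply: M_intro.
- by move=> d x y /=; rewrite (lB d x y) (lA d).
- by move=> x; apply: continuous_comp; [exact: (M_cont hB)|exact: (M_cont hA)].
- by move=> B' x hB' /=; rewrite (M_comm x hB hB') (M_comm _ hA hB').
Qed.

(** The type mentions the two proofs because the algebraic structures declared on it depend on
    them. *)
Record vn_element (v : von_neumann_algebra dot M)
  (f : faithful_normal_trace dot M tau) := VNElt { vnval :> H -> H; vnP : M vnval }.

Definition vnelt := vn_element vn ft.
Definition mkvn A (hA : M A) : vnelt := VNElt vn ft hA.

Lemma vnval_inj (a b : vnelt) : vnval a = vnval b -> a = b.
Proof.
case: a b => [a ha] [b hb] /= e; subst b; congr VNElt; exact: Prop_irrelevance.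
Qed.

Lemma vn_ext (a b : vnelt) : (forall x, a x = b x) -> a = b.
Proof. by move=> h; apply: vnval_inj; apply/funext. Qed.

HB.instance Definition _ := gen_eqMixin vnelt.
HB.instance Definition _ := gen_choiceMixin vnelt.

Definition vn_add (a b : vnelt) := mkvn (M_add (vnP a) (vnP b)).
Definition vn_scalec (c : R[i]) (a : vnelt) := mkvn (M_scale c (vnP a)).
Definition vn_opp (a : vnelt) := vn_scalec (-1) a.
Definition vn_one := mkvn M_id.
Definition vn_zero := vn_scalec 0 vn_one.
Definition vn_mul (a b : vnelt) := mkvn (M_comp (vnP a) (vnP b)).

Let addE a b x : vn_add a b x = a x + b x. Proof. by []. Qed.
Let scalecE c a x : vn_scalec c a x = c *: a x. Proof. by []. Qed.

Lemma vn_addA : associative vn_add.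
Proof. by move=> a b c; apply: vn_ext => x; rewrite !addE addrA. Qed.
Lemma vn_addC : commutative vn_add.
Proof. by move=> a b; apply: vn_ext => x; rewrite !addE addrC. Qed.
Lemma vn_add0 : left_id vn_zero vn_add.
Proof. by move=> a; apply: vn_ext => x; rewrite !addE scalecE scale0r add0r. Qed.
Lemma vn_addN : left_inverse vn_zero vn_opp vn_add.
Proof. by move=> a; apply: vn_ext => x; rewrite addE !scalecE scaleN1r addNr scale0r. Qed.

HB.instance Definition _ := GRing.isZmodule.Build vnelt vn_addA vn_addC vn_add0 vn_addN.

Lemma vn_mulA : associative vn_mul.
Proof. by move=> a b c; apply: vn_ext. Qed.
Lemma vn_mul1 : left_id vn_one vn_mul. Proof. by move=> a; apply: vn_ext. Qed.
Lemma vn_mulr1 : right_id vn_one vn_mul. Proof. by move=> a; apply: vn_ext. Qed.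
Lemma vn_mulDl : left_distributive vn_mul +%R.
Proof. by move=> a b c; apply: vn_ext. Qed.
Lemma vn_mulDr : right_distributive vn_mul +%R.
Proof. by move=> a b c; apply: vn_ext => x; exact: linD (M_lin (vnP a)) _ _. Qed.

(** The zero space is excluded by the trace: there -id + id would be id, with trace 0 and 1. *)
Lemma vn_one_neq0 : vn_one != 0.
Proof.
apply/eqP => e; have := tr_linear ft (-1) M_id M_id.
have -> : -1 *: id + id = id :> (H -> H).
  apply/funext => x; have e1 : x = 0 *: x by exact: (congr1 (fun a : vnelt => a x) e).
  by rewrite !fctE e1 scale0r scaler0 addr0.
by rewrite (tr_unit ft) mulr1 addNr => /eqP; rewrite oner_eq0.
Qed.

HB.instance Definition _ := GRing.Zmodule_isNzRing.Build vnelt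
  vn_mulA vn_mul1 vn_mulr1 vn_mulDl vn_mulDr vn_one_neq0.

Definition vn_scale (c : R) (a : vnelt) := vn_scalec c%:C a.

Lemma vn_scaleA a b v : vn_scale a (vn_scale b v) = vn_scale (a * b) v.
Proof. by apply: vn_ext => x; rewrite /vn_scale !scalecE scalerA rmorphM. Qed.
Lemma vn_scale1 : left_id 1 vn_scale.
Proof. by move=> a; apply: vn_ext => x; rewrite /vn_scale !scalecE scale1r. Qed.
Lemma vn_scaleDr : right_distributive vn_scale +%R.
Proof. by move=> c a b; apply: vn_ext => x; exact: scalerDr. Qed.
Lemma vn_scaleDl v : {morph vn_scale^~ v : a b / a + b}.
Proof.
move=> a b; apply: vn_ext => x; rewrite /vn_scale !scalecE rmorphD.
exact: scalerDl.
Qed.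

HB.instance Definition _ := GRing.Zmodule_isLmodule.Build R vnelt
  vn_scaleA vn_scale1 vn_scaleDr vn_scaleDl.

Lemma vn_scaleAl (c : R) (a b : vnelt) : c *: (a * b) = (c *: a) * b.
Proof. by apply: vn_ext. Qed.
HB.instance Definition _ := GRing.Lmodule_isLalgebra.Build R vnelt vn_scaleAl.

Lemma vn_scaleAr (c : R) (a b : vnelt) : c *: (a * b) = a * (c *: b).
Proof. by apply: vn_ext => x; exact: esym (linZ (M_lin (vnP a)) _ _). Qed.
HB.instance Definition _ := GRing.Lalgebra_isAlgebra.Build R vnelt vn_scaleAr.

Lemma vnDE (a b : vnelt) x : (a + b) x = a x + b x. Proof. by []. Qed.
Lemma vnNE (a : vnelt) x : (- a) x = - a x. Proof. exact: scaleN1r. Qed.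
Lemma vnBE (a b : vnelt) x : (a - b) x = a x - b x.
Proof. by rewrite vnDE vnNE. Qed.
Lemma vnME (a b : vnelt) x : (a * b) x = a (b x). Proof. by []. Qed.
Lemma vn1E x : (1 : vnelt) x = x. Proof. by []. Qed.
Lemma vnZE (c : R) (a : vnelt) x : (c *: a) x = c%:C *: a x. Proof. by []. Qed.

Lemma vn_linD (a : vnelt) x y : a (x + y) = a x + a y.
Proof. exact: linD (M_lin (vnP a)) _ _. Qed.
Lemma vn_linB (a : vnelt) x y : a (x - y) = a x - a y.
Proof. exact: linB (M_lin (vnP a)) _ _. Qed.
Lemma vn_linZ (a : vnelt) c x : a (c *: x) = c *: a x.
Proof. exact: linZ (M_lin (vnP a)) _ _. Qed.
Lemma vn_linear (a : vnelt) : linear a. Proof. exact: M_lin (vnP a). Qed.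
Lemma vn_continuous (a : vnelt) : continuous a. Proof. exact: M_cont (vnP a). Qed.

Definition vn_star (a : vnelt) : vnelt :=
  mkvn (s2valP (cid2 (vn_adjoint vn (vnP a)))).

Lemma vn_starP (a : vnelt) x y : dot (a x) y = dot x (vn_star a y).
Proof. exact: (s2valP' (cid2 (vn_adjoint vn (vnP a)))). Qed.

Lemma vn_starP' (a : vnelt) x y : dot (vn_star a x) y = dot x (a y).
Proof. by rewrite (dotC dot (vn_star a x)) -vn_starP -(dotC dot x). Qed.

Lemma vn_star_unique (a b : vnelt) : (forall x y, dot (a x) y = dot x (b y)) ->
  vn_star a = b.
Proof. by move=> h; apply: vn_ext => x; apply: (dot_inj hdot) => z; rewrite -vn_starP h. Qed.

Lemma vn_star_linear : linear vn_star.
Proof.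
move=> c a b; apply: vn_star_unique => x y.
rewrite !vnDE !vnZE dotDl dotDr dotZl dotZr !vn_starP; congr (_ * _ + _).
by rewrite conjcE conjc_real.
Qed.
HB.instance Definition _ := GRing.isLinear.Build R vnelt vnelt *:%R vn_star vn_star_linear.

Lemma vn_starM (a b : vnelt) : vn_star (a * b) = vn_star b * vn_star a.
Proof. by apply: vn_star_unique => x y; rewrite !vnME !vn_starP. Qed.

Lemma vn_starK (a : vnelt) : vn_star (vn_star a) = a.
Proof. by apply: vn_star_unique => x y; rewrite vn_starP'. Qed.

Definition ctr (a : vnelt) : R[i] := tau a.

(** The scalars are restricted to the reals so that the logarithms live in [R]; on self-adjoint
    elements [tau] is real ([tau_selfadjoint_real]). *)
Definition vn_tr (a : vnelt) : R := complex.Re (ctr a).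

Lemma tau_lin (c : R[i]) (a b : vnelt) :
  ctr (vn_scalec c a + b) = c * ctr a + ctr b.
Proof. exact: (tr_linear ft c (vnP a) (vnP b)). Qed.

Lemma vn_tr_linear : linear_for *%R vn_tr.
Proof.
move=> c a b; rewrite /vn_tr tau_lin; case: (ctr a) => x y; case: (ctr b) => z w /=.
by rewrite mul0r subr0.
Qed.
HB.instance Definition _ := GRing.isLinear.Build R vnelt R *%R vn_tr vn_tr_linear.

Definition vn_pos (a : vnelt) := positive_operator dot a.

Lemma vn_tr1 : vn_tr 1 = 1.
Proof. by rewrite /vn_tr /ctr (tr_unit ft). Qed.

Lemma vn_trC (a b : vnelt) : vn_tr (a * b) = vn_tr (b * a).
Proof. by rewrite /vn_tr /ctr (tr_trace ft (vnP a) (vnP b)). Qed.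

Lemma vn_pos1 : vn_pos 1.
Proof. by move=> x; rewrite vn1E (dot_nrm hdot) lecR sqr_ge0. Qed.

Lemma vn_posD (a b : vnelt) : vn_pos a -> vn_pos b -> vn_pos (a + b).
Proof. by move=> ha hb x; rewrite vnDE dotDl addr_ge0. Qed.

Lemma vn_pos_conj (a x : vnelt) : vn_pos a -> vn_pos (vn_star x * a * x).
Proof. by move=> ha v; rewrite !vnME vn_starP'; exact: ha. Qed.

Lemma vn_pos_tr (a : vnelt) : vn_pos a -> 0 <= vn_tr a.
Proof.
move=> ha; have := tr_positive ft (vnP a) ha; rewrite /vn_tr -/(ctr a).
by case: (ctr a) => x y; rewrite lecE /= => /andP[].
Qed.

Lemma vn_pos_star (a : vnelt) : vn_pos a -> vn_star a = a.
Proof.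
move=> ha; apply: vn_ext => x; apply/eqP; rewrite -subr_eq0 -vnBE; apply/eqP.
move: x; apply: (quadratic_form_eq0 hdot); first exact: vn_linear.
move=> x; rewrite vnBE dotBl vn_starP' (dotC dot x).
have := ha x; case: (dot (a x) x) => u v; rewrite lecE /= => /andP[/eqP -> _].
by rewrite conjcE /= oppr0 subrr.
Qed.

(** By polarisation 2 a = (a + 1)^2 - a^2 - 1, a real combination of positive elements. *)
Lemma tau_selfadjoint_real (a : vnelt) : vn_star a = a -> complex.Im (ctr a) = 0.
Proof.
move=> sa; have p (b : vnelt) : vn_star b = b -> complex.Im (ctr (b * b)) = 0.
  move=> sb; have := tr_positive ft (vnP (b * b)).
  have h : positive_operator dot (b * b).
    have := vn_pos_conj b vn_pos1; rewrite mulr1 sb; exact.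
  move=> /(_ h); rewrite -/(ctr (b * b)) lecE => /andP[/eqP e _]; exact: e.
have imD (x y : vnelt) : complex.Im (ctr (x + y)) = complex.Im (ctr x) + complex.Im (ctr y).
  have := tau_lin 1 x y; have -> : vn_scalec 1 x = x.
    by apply: vn_ext => v; rewrite scalecE scale1r.
  by move=> ->; rewrite mul1r; case: (ctr x); case: (ctr y).
have := p (a + 1); rewrite linearD /= sa (vn_pos_star vn_pos1) => /(_ erefl).
have -> : (a + 1) * (a + 1) = a * a + (a + (a + 1)).
  by rewrite mulrDr mulr1 mulrDl mul1r -addrA.
have i1 : complex.Im (ctr 1) = 0 by rewrite /ctr (tr_unit ft).
rewrite !imD (p _ sa) i1.
by lra.
Qed.

Lemma vn_tr_star (a : vnelt) : vn_tr (vn_star a) = vn_tr a.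
Proof.
apply/eqP; rewrite eq_sym -subr_eq0 -(linearB (vn_tr : {linear _ -> _ | *%R})) /=; apply/eqP.
(* This element is self-adjoint, and the imaginary part of its trace is the real part of the trace
   of [a - vn_star a]. *)
pose b := vn_scalec 'i%C (a - vn_star a).
have sb : vn_star b = b.
  apply: vn_star_unique => x y; rewrite !scalecE dotZl dotZr !vnBE dotBl dotBr.
  rewrite vn_starP vn_starP' conjcE.
  have -> : ('i%C^*)%C = - 'i%C :> R[i] by apply/eqP; rewrite eq_complex /= oppr0 !eqxx.
  by ring.
have := tau_selfadjoint_real sb.
have -> : ctr b = 'i%C * ctr (a - vn_star a).
  rewrite -[b]addr0 tau_lin.
  have -> : ctr (0 : vnelt) = 0.
    have := tau_lin (-1) 0 0; rewrite addr0 => e.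
    by move: e; rewrite mulN1r addNr; have -> : vn_scalec (-1) 0 = 0 by rewrite -[RHS](@oppr0 vnelt).
  by rewrite addr0.
rewrite /vn_tr; case: (ctr _) => x y /=.
by rewrite mul0r mul1r add0r.
Qed.

Lemma vn_bounded (a : vnelt) :
  exists2 K : R, 0 <= K & vn_pos (K ^+ 2 *: 1 - vn_star a * a).
Proof.
have [K K0 hK] := linear_bounded_nrm (conj (vn_linear a) (@vn_continuous a)).
exists K => // x; rewrite vnBE vnZE vn1E vnME dotBl dotZl vn_starP' !(dot_nrm hdot).
rewrite -rmorphM -rmorphB lecR subr_ge0 -exprMn.
by apply: lerXn2r; rewrite ?nnegrE ?mulr_ge0 ?nrm_ge0.
Qed.

Definition vn_pretracial : pretracial vnelt := @Pretracial R vnelt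
  vn_star vn_tr vn_pos vn_starM vn_starK vn_tr1 vn_trC vn_tr_star vn_pos1 vn_posD
  vn_pos_conj vn_pos_tr vn_pos_star vn_bounded.

Local Notation T0 := vn_pretracial.

Lemma nb_nrm (a : vnelt) K : nb T0 a K -> forall x, nrm (a x) <= K * nrm x.
Proof.
move=> [K0 h] x; have := h x.
rewrite vnBE vnZE vn1E vnME dotBl dotZl vn_starP' !(dot_nrm hdot).
rewrite -rmorphM -rmorphB lecR subr_ge0 -exprMn => h2.
by rewrite -(ler_pXn2r (ltn0Sn 1)) ?nnegrE ?mulr_ge0 ?nrm_ge0.
Qed.

Lemma vn_contraction_fixpoint (Q : vnelt) (r : R) (w : H) : 0 < r -> r < 1 ->
  nb T0 Q r -> exists u, Q u + w = u.
Proof.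
move=> r0 r1 nQ; have hQ := nb_nrm nQ.
have [u [u0 uS]] : exists u : nat -> H, u 0%N = 0 /\ forall n, u n.+1 = Q (u n) + w.
  by exists (fun n => iter n (fun x => Q x + w) 0).
have nD (x y : H) : nrm (x + y) <= nrm x + nrm y.
  by rewrite -lecR rmorphD /= -!nrmE ler_normD.
have bu m : nrm (u m) <= nrm w / (1 - r).
  have r2 : 0 < 1 - r by rewrite subr_gt0.
  elim: m => [|m IH]; rewrite ?u0 ?uS.
    by rewrite /nrm normr0 divr_ge0 ?nrm_ge0// ltW.
  apply: le_trans (nD _ _) _; apply: le_trans (lerD (hQ _) (lexx _)) _.
  apply: le_trans (lerD (ler_wpM2l (ltW r0) IH) (lexx _)) _.
  by apply: le_of_eq; field; rewrite gt_eqF.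
have du n m : nrm (u (n + m)%N - u n) <= r ^+ n * (nrm w / (1 - r)).
  elim: n => [|n IH]; first by rewrite add0n u0 subr0 expr0 mul1r.
  rewrite addSn !uS opprD addrACA subrr addr0 -vn_linB exprS -mulrA.
  by apply: le_trans (hQ _) _; apply: ler_wpM2l => //; exact: ltW.
have cu := cvg_of_geometric (ltW r0) r1 du.
exists (limn u).
have c1 : (fun n => u n.+1) @ \oo --> limn u by rewrite (cvg_shiftS u).
have c2 : (fun n => u n.+1) @ \oo --> Q (limn u) + w.
  under eq_fun do rewrite uS.
  apply: cvgD; last exact: cvg_cst.
  by apply: continuous_cvg => //; exact: vn_continuous.
by rewrite -(cvg_lim (@norm_hausdorff _ _) c2) (cvg_lim (@norm_hausdorff _ _) c1).
Qed.

(** A solution of a u = v is a fixed point of u -> (1 - a / C) u + v / C, a contraction by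
    [gap_contraction]. *)
Lemma vn_surjective (a : vnelt) (d : R) : 0 < d -> vn_pos (a - d *: 1) ->
  forall v, exists u, a u = v.
Proof.
move=> d0 hd v.
have pa : vn_pos a.
  by have := @posD R vnelt T0 _ _ hd (pos_scalar T0 (ltW d0)); rewrite subrK.
have [C0 C01 hC0] := @pos_upper R vnelt T0 a pa.
have hC : pos T0 ((Num.max C0 d) *: 1 - a).
  apply: (@pos_trans R vnelt T0 (C0 *: 1)) => //; rewrite -scalerBl.
  by apply: pos_scalar; rewrite subr_ge0 le_max lexx.
set C := Num.max C0 d in hC.
have dC : d <= C by rewrite le_max lexx orbT.
have C0' : 0 < C by exact: lt_le_trans dC.
have [r0 r1 nQ] := @gap_contraction R vnelt T0 C d a d0 dC hd hC.
have [u hu] := vn_contraction_fixpoint ((C^-1)%:C *: v) r0 r1 nQ.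
exists u; move: hu; rewrite vnBE vn1E vnZE -addrA => /eqP.
rewrite -subr_eq0 addrAC subrr add0r addrC subr_eq0 => /eqP e.
have Cn : (C^-1)%:C != 0 :> R[i].
  by rewrite -[0]/(0%:C) (inj_eq (@complexI R)) invr_eq0 gt_eqF.
by apply: (scalerI Cn).
Qed.

(** The pointwise inverse is bounded by d^-1 and commutes with whatever [a] commutes with, so the
    bicommutant property places it in [M]. *)
Lemma vn_inverse (a : vnelt) (d : R) : 0 < d -> vn_pos (a - d *: 1) ->
  exists2 b : vnelt, a * b = 1 & b * a = 1.
Proof.
move=> d0 hd; have sur := vn_surjective d0 hd.
have low x : d * nrm x <= nrm (a x).
  have sa : vn_star a = a.
    apply: vn_pos_star; have := @posD R vnelt T0 _ _ hd (pos_scalar T0 (ltW d0)).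
    by rewrite subrK.
  have := @pos_sq_lower R vnelt T0 d a (ltW d0) hd x.
  rewrite vnBE vnZE vn1E vnME dotBl dotZl -{1}sa vn_starP' !(dot_nrm hdot).
  rewrite -rmorphM -rmorphB lecR subr_ge0 -exprMn => h2.
  by rewrite -(ler_pXn2r (ltn0Sn 1)) ?nnegrE ?mulr_ge0 ?nrm_ge0 ?(ltW d0).
have inj x y : a x = a y -> x = y.
  move=> e; apply/eqP; rewrite -subr_eq0; apply/eqP; apply: nrm_eq0.
  have := low (x - y); rewrite vn_linB e subrr /nrm normr0 /= => h.
  by apply/eqP; rewrite eq_le -/(nrm _) nrm_ge0 andbT -(pmulr_rle0 _ d0).
have [b hb] : exists b : H -> H, forall v, a (b v) = v.
  by exists (fun v => sval (cid (sur v))) => v; case: cid.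
have lb : linear b.
  by move=> c x y; apply: inj; rewrite vn_linD vn_linZ !hb.
have cb : continuous b.
  apply: (@nrm_bounded_continuous _ _ b d^-1 lb) => x.
  by rewrite ler_pdivlMl// -[X in _ <= nrm X](hb x).
have Mb : M b.
  apply: M_intro => // B x hB; apply: inj.
  by rewrite hb (M_comm _ (vnP a) hB) hb.
by exists (mkvn Mb); apply: vn_ext => x; [exact: hb|apply: inj; exact: hb].
Qed.

Definition vn_tracial : tracial vnelt := @Tracial R vnelt vn_pretracial vn_inverse.

Definition vn_sc (z : R[i]) : vnelt := vn_scalec z 1.

Lemma vn_scE z x : vn_sc z x = z *: x. Proof. by []. Qed.

Lemma vn_sc_monoid : monoid_morphism vn_sc.
Proof.
split; first by apply: vn_ext => x; rewrite vn_scE scale1r.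
by move=> z w; apply: vn_ext => x; rewrite vnME !vn_scE scalerA.
Qed.

Lemma vn_sc_zmod : zmod_morphism vn_sc.
Proof. by move=> z w; apply: vn_ext => x; rewrite vnBE !vn_scE scalerBl. Qed.

HB.instance Definition _ := GRing.isZmodMorphism.Build R[i] vnelt vn_sc vn_sc_zmod.
HB.instance Definition _ := GRing.isMonoidMorphism.Build R[i] vnelt vn_sc vn_sc_monoid.

Lemma vn_scC z (a : vnelt) : vn_sc z * a = a * vn_sc z.
Proof. by apply: vn_ext => x; rewrite !vnME !vn_scE vn_linZ. Qed.

Lemma vn_sc_star z : star vn_tracial (vn_sc z) = vn_sc (z^*)%C.
Proof. by apply: vn_star_unique => x y; rewrite !vn_scE dotZl dotZr conjcE conjcK. Qed.

Lemma vn_sc_real (x : R) : vn_sc x%:C = x *: 1.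
Proof. by apply: vn_ext. Qed.

End VonNeumann.

(** * The elements of the free product and the freeness of the three symmetries *)

Section FreeProduct.
Variables (R : realType) (H : completeNormedModType R[i]).
Variable dot : {dot H for Num.conj}.
Hypothesis hdot : hilbert_norm dot.
Variables (M : set (H -> H)) (tau : (H -> H) -> R[i]).
Variable iota : bool -> 'M[R[i]]_2 -> H -> H.
Hypothesis hM : reduced_free_product dot M tau iota.

Local Notation A := (vnelt (rfp_vn hM) (rfp_trace hM)).
Definition free_tracial : tracial A := vn_tracial hdot (rfp_vn hM) (rfp_trace hM).
Local Notation T := free_tracial.
Local Notation st := (star T).
Local Notation sc := (@vn_sc _ _ _ _ (rfp_vn hM) _ (rfp_trace hM)).

Definition emb i (m : 'M[R[i]]_2) : A := mkvn _ _ (emb_in (rfp_emb hM i) m).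

Lemma emb_lin i c m n : emb i (c *: m + n) = sc c * emb i m + emb i n.
Proof.
apply: vn_ext => x; rewrite vnDE vnME vn_scE /=.
by rewrite (emb_linear (rfp_emb hM i)).
Qed.

Lemma emb0 i : emb i 0 = 0.
Proof.
have := emb_lin i (-1) 0 0; rewrite scaler0 addr0 => ->.
by rewrite rmorphN rmorph1 mulN1r addNr.
Qed.

Lemma embD i m n : emb i (m + n) = emb i m + emb i n.
Proof. by rewrite -[m]scale1r emb_lin scale1r rmorph1 mul1r. Qed.

Lemma embZ i c m : emb i (c *: m) = sc c * emb i m.
Proof. by rewrite -[c *: m]addr0 emb_lin emb0 addr0. Qed.

Lemma embN i m : emb i (- m) = - emb i m.
Proof. by rewrite -scaleN1r embZ rmorphN rmorph1 mulN1r. Qed.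

Lemma emb1 i : emb i 1%:M = 1.
Proof. by apply: vn_ext => x; rewrite /= (emb_unit (rfp_emb hM i)). Qed.

Lemma embM i m n : emb i (m *m n) = emb i m * emb i n.
Proof. by apply: vn_ext => x; rewrite vnME /= (emb_mul (rfp_emb hM i)). Qed.

Lemma emb_star i m : st (emb i m) = emb i (map_mx Num.conj m)^T.
Proof. by apply: (vn_star_unique hdot) => x y; exact: (emb_adjoint (rfp_emb hM i)). Qed.

Definition mx2 (a b c d : R[i]) : 'M[R[i]]_2 :=
  \matrix_(i, j) nth 0 (nth [::] [:: [:: a; b]; [:: c; d]] i) j.

Ltac mx2_tac := apply/matrixP => - [[|[|//]] ?] [[|[|//]] ?];
  rewrite !mxE ?big_ord_recl ?big_ord0 ?mxE /=.

Lemma mx2M a b c d a' b' c' d' : mx2 a b c d *m mx2 a' b' c' d' =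
  mx2 (a * a' + b * c') (a * b' + b * d') (c * a' + d * c') (c * b' + d * d').
Proof. by mx2_tac; rewrite addr0. Qed.

Lemma mx2D a b c d a' b' c' d' : mx2 a b c d + mx2 a' b' c' d' =
  mx2 (a + a') (b + b') (c + c') (d + d').
Proof. by mx2_tac. Qed.

Lemma mx2N a b c d : - mx2 a b c d = mx2 (- a) (- b) (- c) (- d).
Proof. by mx2_tac. Qed.

Lemma mx2Z e a b c d : e *: mx2 a b c d = mx2 (e * a) (e * b) (e * c) (e * d).
Proof. by mx2_tac. Qed.

Lemma mx2_1 : 1%:M = mx2 1 0 0 1. Proof. by mx2_tac. Qed.
Lemma mx2_0 : 0 = mx2 0 0 0 0. Proof. by mx2_tac. Qed.

Lemma mx2_star a b c d : (map_mx Num.conj (mx2 a b c d))^T =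
  mx2 (Num.conj a) (Num.conj c) (Num.conj b) (Num.conj d).
Proof. by mx2_tac. Qed.

Lemma mx2_tr a b c d : \tr (mx2 a b c d) = a + d.
Proof. by rewrite /mxtrace !big_ord_recl big_ord0 !mxE /= addr0. Qed.

Inductive alternating : bool -> A -> Prop :=
| Alt1 b m : \tr m = 0 -> alternating b (emb b m)
| AltS b m x : \tr m = 0 -> alternating (~~ b) x -> alternating b (emb b m * x).

Lemma alternating_word b x : alternating b x -> exists w : seq (bool * 'M[R[i]]_2),
  [/\ w != [::], (head (b, 0) w).1 = b, sorted (fun p q => p.1 != q.1) w,
      all (fun p => \tr p.2 == 0) w & x = \prod_(p <- w) emb p.1 p.2].
Proof.
elim=> {b x} [b m m0|b m x m0 _ [w []]].
  by exists [:: (b, m)]; rewrite big_seq1 /= m0 eqxx.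
case: w => [//|p w] _ /= pb sw aw ->.
exists ((b, m) :: p :: w); split => //=; last by rewrite [in RHS]big_cons.
  by rewrite pb sw andbT; case: (b).
by rewrite m0 eqxx.
Qed.

Lemma alternating_tau b x : alternating b x -> tau x = 0.
Proof.
move=> /alternating_word[w [w0 _ sw aw ->]].
have -> : vnval (\prod_(p <- w) emb p.1 p.2) =
    \big[(fun B B' : H -> H => B \o B')/id]_(p <- w) iota p.1 p.2.
  by rewrite (big_morph (@vnval _ _ _ _ _ _ _) (id1 := id)
    (op1 := fun B B' : H -> H => B \o B')).
rewrite (big_nth (false, 0)) big_mkord.
have fr : free_family tau (fun i => range (iota i)) := rfp_free hM.
apply: (fr (size w) (fun k => (nth (false, 0) w k).1)
  (fun k => iota (nth (false, 0) w k).1 (nth (false, 0) w k).2)).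
- by case: w w0 {sw aw}.
- move=> k kw; split; first by exists (nth (false, 0) w k).2.
  have := emb_trace (rfp_emb hM (nth (false, 0) w k).1) (nth (false, 0) w k).2 => ->.
  by move/allP: aw => /(_ _ (mem_nth (false, 0) kw)) /eqP ->; rewrite mulr0.
- move=> k kw; have tr : True by [].
  case: w w0 sw {aw} kw => // p w _ /= /(pathP (false, 0)) h.
  by rewrite ltnS => /h.
Qed.

Definition Wel : A := emb false (mx2 1 0 0 (-1)).
Definition Nel : A := emb true (mx2 0 1 0 0).
(** A unitary exchanging the eigenspaces of [Wel]; it provides the conjugation of [Wel] into its
    negative behind [ldet_k]. *)
Definition Jel : A := emb false (mx2 0 1 1 0).

Let conj0 : Num.conj (0 : R[i]) = 0. Proof. exact: rmorph0. Qed.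
Let conj1 : Num.conj (1 : R[i]) = 1. Proof. exact: rmorph1. Qed.

Ltac emb_tac := rewrite ?emb_star ?mx2_star ?conj0 ?conj1 -?embM ?mx2M -?embN ?mx2N
  -?embD ?mx2D ?(mulr0, mul0r, mulr1, mul1r, addr0, add0r, mulN1r, mulrN1, opprK, oppr0).

Lemma Nel_star : st Nel = emb true (mx2 0 0 1 0).
Proof. by rewrite /Nel; emb_tac. Qed.

Lemma Wel_sq : Wel * Wel = 1.
Proof. by rewrite /Wel; emb_tac; rewrite -mx2_1 emb1. Qed.

Lemma Wel_star : st Wel = Wel.
Proof. by rewrite /Wel; emb_tac; rewrite rmorphN rmorph1. Qed.

Lemma Nel_sq : Nel * Nel = 0.
Proof. by rewrite /Nel; emb_tac; rewrite -mx2_0 emb0. Qed.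

Lemma Nel_unit : Nel * st Nel + st Nel * Nel = 1.
Proof. by rewrite Nel_star /Nel; emb_tac; rewrite -mx2_1 emb1. Qed.

Lemma Jel_star : st Jel = Jel.
Proof. by rewrite /Jel; emb_tac. Qed.

Lemma Jel_sq : Jel * Jel = 1.
Proof. by rewrite /Jel; emb_tac; rewrite -mx2_1 emb1. Qed.

Lemma JelW : Jel * Wel = - (Wel * Jel).
Proof. by rewrite /Jel /Wel; emb_tac. Qed.

Lemma free_sgnE : sgn T Nel = emb true (mx2 1 0 0 (-1)).
Proof. by rewrite /sgn Nel_star /Nel; emb_tac. Qed.

Lemma offE om : off T sc Nel om = emb true (mx2 0 (om^*)%C om 0).
Proof.
by rewrite /off Nel_star /Nel -!embZ !mx2Z -embD mx2D !(mulr0, mulr1, addr0, add0r).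
Qed.

Lemma tr_sgn0 : tr T (sgn T Nel) = 0.
Proof.
rewrite free_sgnE /= /vn_tr /ctr (emb_trace (rfp_emb hM true)) mx2_tr subrr mulr0.
by [].
Qed.

Local Notation sg := (sgn T Nel).
Local Notation fl := (flips T sc Wel Nel).

Let sgM x : sg * (sg * x) = x.
Proof. by rewrite mulrA (sgn_sq Nel_sq Nel_unit) mul1r. Qed.

Let tr_sgm : \tr (mx2 1 0 0 (-1)) = 0. Proof. by rewrite mx2_tr subrr. Qed.
Let tr_off b c : \tr (mx2 0 b c 0) = 0. Proof. by rewrite mx2_tr addr0. Qed.

Let alt_sg x : alternating false x -> alternating true (sg * x).
Proof. by move=> h; rewrite free_sgnE; apply: AltS. Qed.

(** Inside a reduced word a [sgn] stands next to a letter of the first copy or is absorbed by an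
    off-diagonal letter, and the product with the latter is again off-diagonal, hence of trace 0.
    Which of the product and its multiple by [sgn] is alternating depends on the first letter, so
    the induction follows both. *)
Lemma flips_alternating om (w : seq 'I_3) (i : 'I_3) :
  path (fun i j => i != j) i w ->
  let x := \prod_(j <- i :: w) fl om j in
  match val i with
  | 0 => alternating false x
  | 1 => alternating false (sg * x)
  | _ => alternating true x /\ alternating true (sg * x)
  end.
Proof.
have f0 (j : 'I_3) : val j = 0%N -> fl om j = Wel by rewrite /flips => ->.
have f1 (j : 'I_3) : val j = 1%N -> fl om j = - (sg * Wel * sg) by rewrite /flips => ->.
have f2 (j : 'I_3) : val j = 2%N -> fl om j = emb true (mx2 0 (om^*)%C om 0).
  by rewrite /flips => -> /=; rewrite offE.
have sW x : sg * (- (sg * Wel * sg) * x) = emb false (- mx2 1 0 0 (-1)) * (sg * x).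
  by rewrite embN -/Wel !mulNr mulrN -!mulrA sgM.
have trW : \tr (- mx2 1 0 0 (-1)) = 0 by rewrite mx2N mx2_tr opprK addNr.
have so x : sg * (emb true (mx2 0 (om^*)%C om 0) * x) =
    emb true (mx2 0 (om^*)%C (- om) 0) * x.
  by rewrite mulrA free_sgnE; emb_tac.
elim: w i => [|j w IH] i /=.
  move=> _; rewrite big_seq1; case E: (val i) => [|[|[|k]]].
  - by rewrite f0//; apply: Alt1.
  - by rewrite f1// -[- _]mulr1 sW mulr1 free_sgnE; apply: AltS => //; exact: Alt1.
  - by rewrite f2// -{2}[emb _ _]mulr1 so mulr1; split; exact: Alt1.
  - by have := ltn_ord i; rewrite -[nat_of_ord i]/(val i) E.
move=> /andP[ij /IH hy]; rewrite big_cons; move: hy.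
set y := \prod_(_ <- j :: w) _ => hy.
case E: (val i) => [|[|[|k]]].
- rewrite f0//; apply: AltS => //=; move: hy.
  case Ej: (val j) => [|[|k]].
  + by move: ij; rewrite -val_eqE /= -[nat_of_ord i]/(val i) -[nat_of_ord j]/(val j) E Ej.
  + by rewrite -{2}[y]sgM; exact: alt_sg.
  + by case.
- rewrite f1// sW; apply: AltS => //=; move: hy.
  case Ej: (val j) => [|[|k]].
  + exact: alt_sg.
  + by move: ij; rewrite -val_eqE /= -[nat_of_ord i]/(val i) -[nat_of_ord j]/(val j) E Ej.
  + by case.
- rewrite f2// so; move: hy; case Ej: (val j) => [|[|k]].
  + by move=> hy; split; apply: AltS.
  + rewrite -{2 3}[y]sgM !(mulrA _ sg (sg * y)) free_sgnE; emb_tac; rewrite -free_sgnE => hy.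
    by split; apply: AltS.
  + move: ij (ltn_ord j); rewrite -val_eqE /= -[nat_of_ord i]/(val i) -[nat_of_ord j]/(val j).
    by rewrite E Ej; case: k Ej.
- by have := ltn_ord i; rewrite -[nat_of_ord i]/(val i) E.
Qed.

Lemma flips_freeness om z (w : seq 'I_3) : w != [::] ->
  sorted (fun i j => i != j) w -> tr T (sc z * \prod_(i <- w) fl om i) = 0.
Proof.
case: w => // i w _ /= /flips_alternating -/(_ om) /=.
set x := \prod_(_ <- _) _ => hx.
have [b hb] : exists b, alternating b x.
  move: hx; case: (val i) => [|[|k]].
  - by exists false.
  - by rewrite -{2}[x]sgM; exists true; exact: alt_sg.
  - by case; exists true.
have -> : sc z * x = vn_scalec z x + 0 by rewrite addr0; apply: vn_ext => v.
have c0 : ctr (0 : A) = 0.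
  by rewrite /ctr -[0](emb0 true) (emb_trace (rfp_emb hM true)) mxtrace0 mulr0.
rewrite /= /vn_tr tau_lin c0 addr0 /ctr (alternating_tau hb) mulr0.
by [].
Qed.

Lemma operator_limit (lam : R[i]) d : 0 < complex.Re `|1 - lam ^+ 2| -> 0 < d ->
  exists2 e0 : R, 0 < e0 & forall e, 0 < e -> e <= e0 ->
    `|ldet T (st (Wel + Nel - sc lam) * (Wel + Nel - sc lam) + e *: 1) -
      limit_value (complex.Re `|1 - lam ^+ 2|)| <= d.
Proof.
move=> r0 d0.
apply: (@ldet_regularized_limit R A T sc (@vn_scC _ _ _ _ _ _ _)
  (@vn_sc_star _ _ _ hdot _ _ _ _) (@vn_sc_real _ _ _ _ _ _ _)
  Wel Nel Jel Wel_sq Wel_star Nel_sq Nel_unit _ _ JelW tr_sgn0 _ lam r0 _ erefl d d0).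
- by rewrite Jel_star Jel_sq.
- by rewrite Jel_star Jel_sq.
- by move=> om _ z w; exact: flips_freeness.
Qed.

End FreeProduct.

(** * Integration against a probability carried by a set *)

Lemma lne_measurable (R : realType) :
  measurable_fun [set: R] (fun t : R => lne t%:E).
Proof.
rewrite (_ : (fun t : R => lne t%:E) = (fun t => if t <= 0 then -oo%E else (ln t)%:E)).
  apply: measurable_fun_ifT => //.
  - exact: measurable_fun_ler.
  - by apply/measurable_EFinP; exact: measurable_ln.
by apply/funext => t /=.
Qed.

Section FullMeasure.
Context d (X : measurableType d) (R : realType) (nu : probability X R).
Variable B : set X.
Hypotheses (mB : measurable B) (B1 : nu B = 1%E).

Lemma full_complement : nu (~` B) = 0%E.
Proof. by rewrite probability_setC// B1 subee. Qed.
Local Notation nuC := full_complement.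

Lemma integral_full D (f : X -> \bar R) : measurable D -> measurable_fun [set: X] f ->
  (\int[nu]_(x in D) f x = \int[nu]_(x in D `&` B) f x)%E.
Proof.
move=> mD mf; rewrite integral_mkcondr; apply: ae_eq_integral => //.
- exact: measurable_funTS.
- apply: measurable_funTS; apply/(measurable_restrictT _ mB); exact: measurable_funTS.
- exists (~` B); split; [exact: measurableC|exact: nuC|].
  by move=> x /= h Bx; apply: h => _; rewrite patchE mem_set.
Qed.

Lemma bounded_integrable (f : X -> R) K : measurable_fun [set: X] f ->
  (forall x, B x -> `|f x| <= K) -> nu.-integrable B (EFin \o f).
Proof.
move=> mf fK; apply: measurable_bounded_integrable => //.
- by apply: le_lt_trans (probability_le1 nu mB) _; rewrite ltry.
- exact: measurable_funTS.
- exists K; split; first exact: num_real.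
  by move=> x Kx y By; apply: le_trans (fK y By) (ltW Kx).
Qed.

Lemma Rintegral_full (f : X -> R) : measurable_fun [set: X] f ->
  \int[nu]_(x in setT) f x = \int[nu]_(x in B) f x.
Proof.
move=> mf; rewrite /Rintegral integral_full ?setTI//.
exact/measurable_EFinP.
Qed.

Lemma Rintegral_const (c : R) : \int[nu]_(x in B) c = c.
Proof.
transitivity (c * fine (nu B)); first exact: Rintegral_cst.
by rewrite B1 /= mulr1.
Qed.

End FullMeasure.

Lemma measurable_horner (R : realType) (P : {poly R}) :
  measurable_fun [set: R] (fun t => P.[t]).
Proof.
apply: continuous_measurable_fun; exact: continuous_horner.
Qed.

(** * From the moments of a positive element to its logarithmic integral *)

Section Moments.
Variables (R : realType) (A : algType R) (T : tracial A) (S : A).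
Hypothesis posS : pos T S.
Variable nu : probability (measurableTypeR R) R.
Hypothesis moments : forall n, tr T (S ^+ n) = \int[nu]_(t in setT) (t ^+ n).

Let horner_algZ c (Q : {poly R}) : horner_alg S (c *: Q) = c *: horner_alg S Q.
Proof. by rewrite -mul_polyC rmorphM /= horner_algC mulr_algl. Qed.

Section Support.
Variables (B : set (measurableTypeR R)) (r : R).
Hypotheses (mB : measurable B) (B1 : nu B = 1%E) (Br : forall t, B t -> `|t| <= r).

Lemma poly_integrable (P : {poly R}) : nu.-integrable B (EFin \o (fun t => P.[t])).
Proof.
apply: (@bounded_integrable _ _ _ _ _ mB _ (\sum_(i < size P) `|P`_i| * r ^+ i)).
  exact: measurable_horner.
move=> t /Br tr; rewrite horner_coef; apply: le_trans (ler_norm_sum _ _ _) _.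
apply: ler_sum => i _; rewrite normrM normrX; apply: ler_wpM2l => //.
by apply: lerXn2r; rewrite ?nnegrE ?normr_ge0 ?(le_trans (normr_ge0 _) tr).
Qed.

Lemma tr_horner (P : {poly R}) : tr T (horner_alg S P) = \int[nu]_(t in B) P.[t].
Proof.
pose E (Q : {poly R}) := tr T (horner_alg S Q) = \int[nu]_(t in B) Q.[t]; rewrite -/(E P).
rewrite -(coefK P) poly_def; apply: (big_ind E).
- rewrite /E rmorph0 linear0; under eq_Rintegral do rewrite horner0.
  by rewrite (Rintegral_const mB B1).
- move=> Q1 Q2 h1 h2; rewrite /E rmorphD linearD h1 h2.
  under [RHS]eq_Rintegral do rewrite hornerD.
  by rewrite RintegralD//; exact: poly_integrable.

- move=> i _; rewrite /E horner_algZ trZ rmorphXn /= horner_algX moments.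
  under [RHS]eq_Rintegral do rewrite hornerZ.
  rewrite RintegralZl//; last exact: poly_integrable.
  rewrite (Rintegral_full mB B1); last exact: exprn_measurable.
  by under [in RHS]eq_Rintegral do rewrite hornerXn.
Qed.

(** The partial sums of the logarithmic series are polynomials in [S], on which trace and integral
    agree by the moments; dominated convergence carries this to the limit. *)
Lemma ldet_integral e : 0 < e ->
  [/\ nu.-integrable B (EFin \o (fun t : R => ln (t ^+ 2 + e)))
    & ldet T (S * S + e *: 1) = \int[nu]_(t in B) (ln (t ^+ 2 + e))].
Proof.
move=> e0.
have SS : pos T (S * S).
  have := pos_conj S (pos1 T); rewrite mulr1 (pos_star posS); exact.
have [C0 C01 hC0] := pos_upper (posD SS (pos_scalar T (ltW e0))).
pose C := Num.max C0 (r ^+ 2 + e).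
have C1 : 1 <= C by rewrite le_max C01.
have Cp : 0 < C by exact: lt_le_trans C1.
have hC : bnd T e C (S * S + e *: 1).
  split => //; first by rewrite addrK.
  by apply: pos_le_scalar hC0; rewrite le_max lexx.
pose q t : R := t ^+ 2 + e.
have q0 t : 0 < q t by rewrite ltr_wpDl// sqr_ge0.
have qC t : B t -> q t <= C.
  move=> /Br h; rewrite /C le_max; apply/orP; right; rewrite lerD2r -(@real_normK _ t) ?num_real//.
  by apply: lerXn2r; rewrite ?nnegrE// (le_trans (normr_ge0 _) h).
have bs t : B t -> bnd T (q t) C (q t *: 1) by move=> Bt; apply: bnd_scalar => //; exact: qC.
pose g : {poly R} := 1 - C^-1 *: ('X ^+ 2 + e%:P).
pose P n : {poly R} := \sum_(0 <= k < n) (k.+1%:R^-1) *: g ^+ k.+1.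
have gE : horner_alg S g = gap C (S * S + e *: 1).
  rewrite /gap /g rmorphB rmorph1 /= horner_algZ rmorphD /= rmorphXn /= horner_algX expr2.
  by rewrite horner_algC.
have PE n : ldser T C (S * S + e *: 1) n = \int[nu]_(t in B) (P n).[t].
  rewrite -tr_horner /P rmorph_sum tr_sum; apply: eq_bigr => k _.
  by rewrite /= horner_algZ trZ rmorphXn /= gE mulrC.
have Pt t n : (P n).[t] = ldser T C (q t *: 1) n.
  rewrite /P horner_sum; apply: eq_bigr => k _.
  have -> : gap C (q t *: 1 : A) = g.[t] *: 1.
    by rewrite /gap scalerA -[X in X - _]scale1r -scalerBl !hornerE.
  by rewrite hornerZ horner_exp mulrC exprZn expr1n trZ tr1 mulr1.
have lim_t t : B t -> (fun n => (P n).[t]) @ \oo --> ln C - ln (q t).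
  move=> Bt; have := ldC_scalar T (q0 t) (qC t Bt); rewrite /ldC => h.
  have -> : ln C - ln (q t) = limn (ldser T C (q t *: 1)) by rewrite -h opprB addrC subrK.
  by under eq_fun do rewrite Pt; apply: cvg_ldser (bs t Bt).
have P0 t n : B t -> 0 <= (P n).[t] <= ln C - ln e.
  move=> Bt.
  have gt0 : 0 <= g.[t].
    by rewrite !hornerE subr_ge0 ler_pdivrMl// mulr1; exact: qC.
  have ndec : nondecreasing_seq (fun n => (P n).[t]).
    apply/nondecreasing_seqP => k; rewrite /P big_nat_recr//= hornerD lerDl hornerZ horner_exp.
    by rewrite mulr_ge0 ?exprn_ge0 ?invr_ge0.
  apply/andP; split.
    by have := ndec 0%N n (leq0n n); rewrite {1}/P big_geq// horner0.
  have cv : cvgn (fun n => (P n).[t]) by apply/cvg_ex; exists (ln C - ln (q t)); exact: lim_t.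
  have := nondecreasing_cvgn_le ndec cv n; rewrite (cvg_lim _ (lim_t t Bt))// => h.
  apply: le_trans h _.
  by rewrite lerD2l lerN2 ler_ln ?posrE// lerDr sqr_ge0.
have mq : measurable_fun setT (fun t : R => ln (q t)).
  apply: (measurableT_comp (@measurable_ln R)).
  by apply: measurable_funD => //; exact: exprn_measurable.
have iln : nu.-integrable B (EFin \o (fun t => ln (q t))).
  apply: (@bounded_integrable _ _ _ nu _ mB _ (`|ln e| + `|ln C|) mq) => t Bt.
  have h1 : ln e <= ln (q t) by rewrite ler_ln ?posrE// lerDr sqr_ge0.
  have h2 : ln (q t) <= ln C by rewrite ler_ln ?posrE//; exact: qC.
  have h3 := ler_norm (ln C); have h4 := ler_norm (- ln e); rewrite normrN in h4.
  have h5 := normr_ge0 (ln C); have h6 := normr_ge0 (ln e).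
  by rewrite ler_norml; apply/andP; split; lra.
split=> //.
rewrite (ldetE C1 hC) /ldC.
have [ic h] : nu.-integrable B (fun t => (ln C - ln (q t))%:E) /\
    ((fun n => \int[nu]_(t in B) ((P n).[t])%:E)%E @ \oo -->
    (\int[nu]_(t in B) (ln C - ln (q t))%:E)%E).
  have [] // := @dominated_convergence _ _ _ nu B mB
    (fun n t => ((P n).[t])%:E) (fun t => (ln C - ln (q t))%:E) (cst (ln C - ln e)%:E).
  - by move=> n; apply/measurable_EFinP; apply: measurable_funTS; exact: measurable_horner.
  - by apply/measurable_EFinP; apply: measurable_funTS; exact: measurable_funB.
  - by apply: aeW => t Bt; apply: cvg_EFin; [exact: nearW|exact: lim_t].
  - by apply: (@bounded_integrable _ _ _ nu _ mB _ `|ln C - ln e|).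
  - apply: aeW => t n Bt; rewrite /= lee_fin; have /andP[h1 h2] := P0 t n Bt.
    by rewrite ger0_norm.
rewrite (@cvg_lim _ _ _ \oo _ (ldser T C (S * S + e *: 1)) (\int[nu]_(t in B) (ln C - ln (q t))))//.
  rewrite RintegralB//; first by rewrite (Rintegral_const mB B1) opprB addrC subrK.
  by apply: (@bounded_integrable _ _ _ nu _ mB _ `|ln C|).
have -> : ldser T C (S * S + e *: 1) = fine \o (fun n => \int[nu]_(t in B) ((P n).[t])%:E)%E.
  by apply/funext => n; rewrite PE.
have fin : (\int[nu]_(t in B) (ln C - ln (q t))%:E)%E \is a fin_num.
  exact: integrable_fin_num.
apply: fine_cvg.
by rewrite fineK//.
Qed.

End Support.

Variable r : R.
Hypothesis suppr : nu [set t | - r <= t <= r] = 1%E.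

Let r_ge0 : 0 <= r.
Proof.
case: leP => // r0; move: suppr.
have -> : [set t : R | - r <= t <= r] = set0.
  by apply/seteqP; split => // t /= /andP[h1 h2]; lra.
by rewrite measure0 => /eqP; rewrite eq_sym onee_eq0.
Qed.

Let B : set (measurableTypeR R) := [set` `[- r, r]].

Let mB : measurable B. Proof. exact: measurable_itv. Qed.

Let BE : B = [set t | - r <= t <= r].
Proof. exact: set_itvcc. Qed.

Let B1 : nu B = 1%E. Proof. by rewrite BE. Qed.

Let Br (t : measurableTypeR R) : B t -> `|t| <= r.
Proof. by rewrite BE ler_norml. Qed.

(* Testing [0 <= tau (Q S Q)] on [Q = (r + 1 - S)^m] with [m] large. *)
Lemma spectral_negative a : 0 < a -> nu [set t | t <= - a] = 0%E.
Proof.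
move=> a0; pose N : set (measurableTypeR R) := [set` `]-oo, - a]].
have NE : N = [set t | t <= - a] by exact: (@set_itvNyc _ R).
have mN : measurable N by exact: measurable_itv.
rewrite -NE; have r0 := r_ge0; pose c := r + 1; have c0 : 0 < c by rewrite /c; lra.
pose p := \int[nu]_(t in B) (\1_N t : R).
have pE : nu N = p%:E.
  rewrite /p -(Rintegral_full mB B1); last exact: measurable_indic.
  have e : (\int[nu]_t (\1_N t)%:E = nu N)%E.
    by rewrite -[in RHS](setIT N); exact: integral_indic.
  by rewrite /Rintegral e fineK// fin_num_measure.
have key m : a * (c + a) ^+ m.*2 * p <= r * c ^+ m.*2.
  pose Q : {poly R} := (c%:P - 'X) ^+ m.
  have h0 : 0 <= \int[nu]_(t in B) (Q * 'X * Q).[t].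
    rewrite -(tr_horner mB B1 Br) !rmorphM /= horner_algX.
    set q := horner_alg S Q.
    have sq : star T q = q.
      rewrite /q rmorphXn rmorphB /= horner_algX horner_algC starX starB starZ star1.
      by rewrite (pos_star posS).
    by rewrite -{1}sq; apply: pos_tr; exact: pos_conj.
  have iN : nu.-integrable B (EFin \o (fun t => a * (c + a) ^+ m.*2 * \1_N t)).
    apply: (@bounded_integrable _ _ _ nu _ mB _ `|a * (c + a) ^+ m.*2|).
      by apply: measurable_funM => //; exact: measurable_indic.
    by move=> t Bt; rewrite normrM indicE; case: (_ \in _); rewrite /= ?normr1 ?normr0 ?mulr1 ?mulr0.
  have ip : nu.-integrable B (EFin \o (fun t => ((r * c ^+ m.*2)%:P - Q * 'X * Q).[t])).
    exact: (poly_integrable mB Br).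
  have : \int[nu]_(t in B) (a * (c + a) ^+ m.*2 * \1_N t) <=
         \int[nu]_(t in B) ((r * c ^+ m.*2)%:P - Q * 'X * Q).[t].
    apply: le_Rintegral => // t Bt; rewrite hornerD hornerN hornerC !hornerM hornerX.
    have -> : Q.[t] * t * Q.[t] = t * (c - t) ^+ m.*2.
      by rewrite /Q horner_exp !hornerE -addnn exprD; ring.
    have := Bt; rewrite BE /= => /andP[t1 t2].
    have h1 : 0 <= (c - t) ^+ m.*2 by apply: exprn_ge0; rewrite /c; lra.
    rewrite indicE; case: (boolP (t \in N)) => tN /=.
      have tN' : t <= - a by move: tN; rewrite inE NE.
      have h2 : (c + a) ^+ m.*2 <= (c - t) ^+ m.*2.
        by apply: lerXn2r; rewrite ?nnegrE /c; lra.
      have h3 : 0 <= r * c ^+ m.*2 by rewrite mulr_ge0// exprn_ge0// ltW.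
      have h4 : a * (c + a) ^+ m.*2 <= - t * (c - t) ^+ m.*2.
        apply: ler_pM => //; [exact: ltW| |by lra].
        by apply: exprn_ge0; rewrite /c; lra.
      by rewrite mulr1; lra.
    rewrite mulr0 subr_ge0; case: (leP 0 t) => t0.
      apply: ler_pM => //; apply: lerXn2r; rewrite ?nnegrE /c; lra.
    apply: (@le_trans _ _ 0); last by rewrite mulr_ge0// exprn_ge0// ltW.
    by rewrite mulr_le0_ge0// ltW.
  rewrite RintegralZl//; last first.
    apply: (@bounded_integrable _ _ _ nu _ mB _ 1); first exact: measurable_indic.
    by move=> t Bt; rewrite indicE; case: (_ \in _); rewrite /= ?normr1 ?normr0.
  move=> h; apply: (le_trans h); under eq_Rintegral do rewrite hornerD hornerN hornerC.
  rewrite RintegralB//; last 2 first.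
  - by apply: (@bounded_integrable _ _ _ nu _ mB _ `|r * c ^+ m.*2|).
  - exact: (poly_integrable mB Br).
  by rewrite (Rintegral_const mB B1) gerBl.
have p0 : 0 <= p by rewrite -lee_fin -pE measure_ge0.
suff : p <= 0 by move=> h; rewrite pE; congr EFin; apply: le_anti; rewrite h.
pose x := (c / (c + a)) ^+ 2.
have ca : 0 < c + a by lra.
have x01 : `|x| < 1.
  rewrite /x ger0_norm ?sqr_ge0// exprn_ilt1//; first by rewrite divr_ge0// ltW.
  by rewrite ltr_pdivrMr// mul1r; lra.
have cx : (fun m => (r / a) * x ^+ m) @ \oo --> (r / a) * 0.
  by apply: cvgMr; exact: cvg_expr.
rewrite mulr0 in cx; rewrite -(cvg_lim _ cx)//.
apply: limr_ge; first by apply/cvg_ex; exists 0.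
apply: nearW => m; rewrite /x -exprM mul2n expr_div_n mulrA ler_pdivlMr ?exprn_gt0//.
rewrite mulrAC ler_pdivlMr//.
by have := key m; rewrite mulrC mulrA; lra.
Qed.

Let D : set (measurableTypeR R) := [set` `[0, r]].

(** The given distribution is only known to sit in a symmetric interval; its negative half is a
    countable union of the null sets of [spectral_negative]. *)
Lemma spectral_support : nu D = 1%E.
Proof.
have mD : measurable D by exact: measurable_itv.
pose N n : set (measurableTypeR R) := [set` `]-oo, - (n.+1%:R^-1)]].
have N0 : nu.-negligible (\bigcup_n N n).
  apply: negligible_bigcup => n; apply/negligibleP; first exact: measurable_itv.
  have -> : N n = [set t | t <= - (n.+1%:R^-1)] by exact: (@set_itvNyc _ R).
  by apply: spectral_negative; rewrite invr_gt0.
have C0 : nu.-negligible (~` B).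
  apply/negligibleP; first exact: measurableC.
  exact: full_complement.
have E0 : nu (~` D) = 0%E.
  apply/(negligibleP _ (measurableC mD)); apply: negligibleS (negligibleU C0 N0) => t.
  move=> tD; case: (pselect (B t)) => Bt; [right|by left].
  move: Bt; rewrite BE /= => /andP[_ t2].
  have t0 : t < 0 by rewrite ltNge; apply/negP => t0; apply: tD; rewrite /D set_itvcc /= t0.
  have [n hn] := ltr_add_invr t0.
  exists n => //; rewrite /N set_itvNyc /=; apply: ltW; by rewrite -[ltRHS]add0r ltrBrDr.
have h : (1 - nu D = 0)%E.
  by transitivity (nu (~` D)); [exact: esym (probability_setC nu mD)|exact: E0].
have : nu D \is a fin_num by exact: fin_num_measure.
by move: h; case: (nu D) => // x [] h _; congr EFin; lra.
Qed.

(** Monotone convergence along the regularisations 1 / (n + 1). The finite limit [v] also shows that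
    the logarithm is integrable, so an atom at 0 is excluded. *)
Lemma spectral_log v :
  (forall d, 0 < d -> exists2 e0, 0 < e0 &
    forall e, 0 < e -> e <= e0 -> `|ldet T (S * S + e *: 1) - v| <= d) ->
  (\int[nu]_(t in `[0%R, +oo[) lne t%:E = (v / 2)%:E)%E.
Proof.
move=> hv; have mD : measurable D by exact: measurable_itv.
have D1 := spectral_support.
have DE (t : R) : D t -> 0 <= t <= r by rewrite /D set_itvcc.
have Dr (t : measurableTypeR R) : D t -> `|t| <= r.
  by move=> /DE /andP[t0 tr]; rewrite ger0_norm.
rewrite (integral_full mD D1); last 2 first.
- exact: measurable_itv.
- exact: lne_measurable.
have -> : `[0%R, +oo[%classic `&` D = D.
  by apply: setIidr => t /DE /andP[t0 _]; rewrite set_itvcy.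
(* An upper bound of all regularised logarithms on the support, as every regularisation is at most
   1; subtracting from it makes the integrands nonnegative and increasing in n. *)
pose K := ln (r ^+ 2 + 1) / 2.
pose e n : R := n.+1%:R^-1.
have e0 n : 0 < e n by rewrite invr_gt0.
have q0 t n : 0 < t ^+ 2 + e n by rewrite ltr_wpDl// sqr_ge0.
pose g n (t : R) := K - ln (t ^+ 2 + e n) / 2.
pose G (t : R) := (K%:E - lne t%:E)%E.
have il n := (ldet_integral mD D1 Dr (e0 n)).
have mg n : measurable_fun setT (g n).
  apply: measurable_funB => //; apply: measurable_funM => //.
  apply: (measurableT_comp (@measurable_ln R)).
  by apply: measurable_funD => //; exact: exprn_measurable.
have Ig n : (\int[nu]_(t in D) (g n t)%:E = (K - ldet T (S * S + e n *: 1) / 2)%:E)%E.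
  have [i1 i2] := il n.
  have i3 : nu.-integrable D (EFin \o (fun t => 2^-1 * ln (t ^+ 2 + e n))).
    exact: (integrableZl mD 2^-1 i1).
  under eq_integral do rewrite /g mulrC EFinB.
  rewrite integralB_EFin//; last by apply: (@bounded_integrable _ _ _ nu _ mD _ `|K|).
  have -> : (\int[nu]_(t in D) K%:E = K%:E)%E.
    transitivity (K%:E * nu D)%E; first exact: integral_cst.
    by rewrite D1 mule1.
  rewrite EFinB; congr (_ - _)%E; rewrite i2 mulrC -RintegralZl//.
  by rewrite /Rintegral fineK//; exact: integrable_fin_num.
have glim t : D t -> (fun n => (g n t)%:E) @ \oo --> G t.
  move=> /DE /andP[t0 _]; rewrite /G; move: t0; rewrite le_eqVlt => /predU1P[<-|t0].
    rewrite /= lexx /=; apply/cvgeyPge => B'.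
    have p : 0 < expR (2 * (K - B')) by exact: expR_gt0.
    near=> n; rewrite lee_fin /g expr0n add0r.
    have h : e n <= expR (2 * (K - B')).
      by apply/ltW; near: n; exact: (near_infty_natSinv_lt (PosNum p)).
    have : ln (e n) <= 2 * (K - B') by rewrite -[leRHS]expRK ler_ln ?posrE.
    by lra.
  rewrite lne_EFin// -EFinB; apply: cvg_EFin; first exact: nearW.
  have -> : K - ln t = K - ln (t ^+ 2 + 0) / 2.
    by rewrite addr0 lnXn// mulr2n; lra.
  apply: cvgB; first exact: cvg_cst.
  apply: cvgMl; apply: continuous_cvg.
    by apply: continuous_ln; rewrite addr0 exprn_gt0.
  by apply: cvgD; [exact: cvg_cst|exact: cvg_harmonic].
have g_ge0 n t : D t -> (0 <= (g n t)%:E)%E.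
  move=> /DE /andP[t0 tr]; rewrite lee_fin /g /K.
  have : ln (t ^+ 2 + e n) <= ln (r ^+ 2 + 1).
    rewrite ler_ln ?posrE//; last by rewrite ltr_wpDl// sqr_ge0.
    apply: lerD; first by apply: lerXn2r; rewrite ?nnegrE// (le_trans t0).
    by rewrite /e invf_le1// ler1n.
  by lra.
have g_nd t : D t -> {homo (fun n => (g n t)%:E) : n m / (n <= m)%N >-> (n <= m)%E}.
  move=> _ n m nm; rewrite lee_fin /g.
  have : ln (t ^+ 2 + e m) <= ln (t ^+ 2 + e n).
    by rewrite ler_ln ?posrE// lerD2l lef_pV2 ?posrE// ler_nat ltnS.
  by lra.
have mG : measurable_fun D G.
  apply: measurable_funTS; apply: emeasurable_funB => //; exact: lne_measurable.
have G_ge0 t : D t -> (0 <= G t)%E.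
  move=> Dt; apply: (closed_cvg (fun x => (0 <= x)%E)) (glim t Dt) => //.
    exact: closed_ereal_le_ereal.
  by apply: nearW => n; exact: g_ge0.
have IG : (\int[nu]_(t in D) G t = (K - v / 2)%:E)%E.
  have mge n : measurable_fun D (fun t => (g n t)%:E).
    by apply: measurable_funTS; apply/measurable_EFinP; exact: mg.
  have h1 := @cvg_monotone_convergence _ _ _ nu D mD (fun n t => (g n t)%:E) mge g_ge0 g_nd.
  have h2 : (fun n => \int[nu]_(t in D) (g n t)%:E)%E @ \oo --> (K - v / 2)%:E.
    under eq_fun do rewrite Ig.
    apply: cvg_EFin; [exact: nearW|rewrite /=].
    apply: cvgB; first exact: cvg_cst.
    apply: cvgMl; apply/cvgrPdist_le => x x0.
    have [e1 e10 he] := hv _ x0.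
    near=> n; rewrite distrC; apply: he => //; apply/ltW; near: n.
    exact: (near_infty_natSinv_lt (PosNum e10)).
  rewrite -(cvg_unique _ h1 h2) //; apply: eq_integral => t /set_mem Dt.
  by rewrite (cvg_lim _ (glim t Dt)).
have iG : nu.-integrable D G.
  apply/integrableP; split => //.
  suff -> : (\int[nu]_(t in D) `|G t| = \int[nu]_(t in D) G t)%E by rewrite IG ltry.
  by apply: eq_integral => t /set_mem Dt; rewrite gee0_abs// G_ge0.
have iK : nu.-integrable D (EFin \o cst K).
  by apply: (@bounded_integrable _ _ _ nu _ mD _ `|K|).
transitivity (\int[nu]_(t in D) (K%:E - G t))%E.
  apply: eq_integral => t _; rewrite /G; case: (lne t%:E) => [x| |] //=.
  by congr EFin; ring.
rewrite (integralB mD iK iG) IG.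
transitivity (K%:E * nu D - (K - v / 2)%:E)%E.
  by congr (_ - _)%E; exact: (integral_cst nu mD K%:E).
by rewrite D1 mule1 -EFinB; congr EFin; ring.
Unshelve. all: by end_near.
Qed.

End Moments.

(** * The Fuglede-Kadison determinant from regularised log-determinants *)

Section Determinant.
Variables (R : realType) (H : completeNormedModType R[i]).
Variable dot : {dot H for Num.conj}.
Hypothesis hdot : hilbert_norm dot.
Variables (M : set (H -> H)) (tau : (H -> H) -> R[i]).
Variables (vn : von_neumann_algebra dot M) (ft : faithful_normal_trace dot M tau).
Local Notation A := (vnelt vn ft).
Local Notation T := (vn_tracial hdot vn ft).

(** [FK_determinant] provides some absolute value and some distribution of it; the regularised limit
    determines the integral whichever they are. *)
Lemma FK_determinant_log (b : A) d v :
  (forall x, 0 < x -> exists2 e0, 0 < e0 & forall e, 0 < e -> e <= e0 ->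
    `|ldet T (star T b * b + e *: 1) - v| <= x) ->
  FK_determinant dot M tau b d -> lne d%:E = (v / 2)%:E.
Proof.
move=> hv [S [nu [[MS pS [b' ab eS]] [[r hr] mom] ->]]].
pose S' : A := mkvn vn ft MS.
have sS : S' * S' = star T b * b.
  apply: vn_ext => x; rewrite !vnME; have := congr1 (fun f => f x) eS; rewrite /= => ->.
  by apply: (dot_inj hdot) => z; rewrite -ab -vn_starP.
have powS n : vnval (S' ^+ n) = iter n S.
  by elim: n => [|n IH] //; rewrite exprS; apply/funext => x; rewrite vnME IH.
have mom' n : tr T (S' ^+ n) = \int[nu]_(t in setT) (t ^+ n).
  by rewrite -[LHS]/(complex.Re (tau (vnval (S' ^+ n)))) powS mom.
have := @spectral_log R A T S' pS nu mom' r hr v.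
by rewrite sS => /(_ hv) ->; rewrite expeRK.
Qed.

End Determinant.

(** * The complex modulus as a real number, its topology and measurability *)

Section ComplexModulus.
Variable R : realType.
Implicit Types z w : R[i].

Definition cmod z : R := complex.Re `|z|.

Lemma cmodE z : `|z| = (cmod z)%:C.
Proof.
have := normr_ge0 z; rewrite /cmod; case: `|z| => a b /=.
by rewrite lecE /= => /andP[/eqP -> _].
Qed.

Lemma cmod_ge0 z : 0 <= cmod z.
Proof. by rewrite -lecR -cmodE normr_ge0. Qed.

Lemma cmodM z w : cmod (z * w) = cmod z * cmod w.
Proof. by apply: (@complexI R); rewrite rmorphM /= -!cmodE normrM. Qed.

Lemma cmod1 : cmod 1 = 1.
Proof. by rewrite /cmod normr1. Qed.

Lemma cmod0 : cmod 0 = 0.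
Proof. by rewrite /cmod normr0. Qed.

Lemma cmodX z n : cmod (z ^+ n) = cmod z ^+ n.
Proof. by elim: n => [|n IH]; rewrite ?expr0 ?cmod1// !exprS cmodM IH. Qed.

Lemma cmodN z : cmod (- z) = cmod z.
Proof. by rewrite /cmod normrN. Qed.

Lemma cmodBC z w : cmod (z - w) = cmod (w - z).
Proof. by rewrite -cmodN opprB. Qed.

Lemma cmodD z w : cmod (z + w) <= cmod z + cmod w.
Proof. by rewrite -lecR rmorphD /= -!cmodE ler_normD. Qed.

Lemma cmod_real (x : R) : cmod x%:C = `|x|.
Proof. by rewrite /cmod normc_def /= expr0n addr0 sqrtr_sqr. Qed.

Lemma cmod_dist z w : `|cmod z - cmod w| <= cmod (z - w).
Proof.
rewrite ler_norml; apply/andP; split.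
  by have := cmodD (w - z) z; rewrite subrK (cmodBC w z); lra.
by have := cmodD (z - w) w; rewrite subrK; lra.
Qed.

Lemma cmod_eq0 z : cmod z = 0 -> z = 0.
Proof. by move=> h; apply/eqP; rewrite -normr_eq0 cmodE h. Qed.

Lemma cmod_prod (s : seq R[i]) z :
  cmod (\prod_(l <- s) (z - l)) = \prod_(l <- s) cmod (z - l).
Proof. by elim: s => [|l s IH]; rewrite ?big_nil ?cmod1// !big_cons cmodM IH. Qed.

Lemma cmod_ball_open l e : open [set z : R[i]^o | cmod (z - l) < e].
Proof.
case: (leP e 0) => e0.
  rewrite (_ : mkset _ = set0) ?open0//; apply/seteqP; split => // z /=.
  by have := cmod_ge0 (z - l); lra.
have -> : [set z : R[i]^o | cmod (z - l) < e] = ball (l : R[i]^o) e%:C.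
  apply/seteqP; split => z /=; rewrite -ball_normE /= distrC cmodE ltcR//.
by apply: ball_open; rewrite ltcR.
Qed.

Lemma open_cmod (U : set R[i]^o) z : open U -> U z ->
  exists2 e : R, 0 < e & forall w, cmod (w - z) < e -> U w.
Proof.
move=> oU Uz; have /nbhs_ballP[e /= e0 he] : nbhs (z : R[i]^o) U by apply: open_nbhs_nbhs.
have eE : e = (cmod e)%:C by rewrite -cmodE ger0_norm// ltW.
exists (cmod e); first by rewrite -ltcR -eE.
move=> w wz; apply: he; rewrite -ball_normE /= distrC cmodE eE ltcR; exact: wz.
Qed.

(** Superlevel sets are unions of open discs: around [w], the disc of radius [cmod (w - l) - x]
    stays above the level x. *)
Lemma measurable_cmod l : measurable_fun [set: borelC R] (fun z => cmod ((z : R[i]) - l)).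
Proof.
apply: (measurability _ (RGenOInfty.measurableE R)) => _ [_ [x ->] <-].
rewrite setTI; apply: sub_sigma_algebra; rewrite /=.
have -> : (fun z : borelC R => cmod ((z : R[i]) - l)) @^-1` `]x, +oo[%classic =
    \bigcup_(w in [set w : R[i] | x < cmod (w - l)])
      [set z : R[i]^o | cmod (z - w) < cmod (w - l) - x].
  apply/seteqP; split => z /=.
    rewrite in_itv /= andbT => h; exists z => //=.
    by rewrite subrr cmod0; lra.
  move=> [w /= h1 h2]; rewrite in_itv /= andbT.
  by have := cmod_dist (w - l) (z - l); rewrite opprB addrA subrK (cmodBC w z) ler_norml => /andP[]; lra.
by apply: bigcup_open => w _; exact: cmod_ball_open.
Qed.

Lemma compact_cmod (K : set R[i]^o) : compact K -> exists2 r : R, 0 <= r &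
  forall z, K z -> cmod z <= r.
Proof.
move=> cK; have cc : continuous (fun z : R[i]^o => cmod z).
  move=> z A /nbhs_ballP[e /= e0 hA].
  have h : nbhs (z : R[i]^o) [set w : R[i]^o | cmod (w - z) < e].
    apply: open_nbhs_nbhs; split; first exact: cmod_ball_open.
    by rewrite /= subrr cmod0.
  apply: (@filterS _ _ (nbhs_filter (z : R[i]^o)) _ _ _ h) => w /= {}h.
  apply: hA; rewrite -ball_normE /=; apply: le_lt_trans (cmod_dist _ _) _.
  by rewrite (cmodBC z w).
have /compact_bounded [r [_ hr]] := continuous_compact (continuous_subspaceT cc) cK.
exists (`|r| + 1); first by rewrite addr_ge0.
move=> z Kz; have := hr (`|r| + 1); rewrite -[cmod z]ger0_norm ?cmod_ge0//; apply.
  by rewrite (le_lt_trans (ler_norm r))// ltrDl.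
by exists z.
Qed.

End ComplexModulus.

(** * Points near which a distribution has little mass *)

Section NestedPoint.
Context d (X : measurableType d) (R : realType) (mu : probability X R).
Variable y : X -> R.
Hypothesis my : measurable_fun [set: X] y.

Let I a b : set X := [set z | a <= y z < b].
Let p S : R := fine (mu S).

Let mI a b : measurable (I a b).
Proof.
have -> : I a b = setT `&` y @^-1` `[a, b[%classic.
  by rewrite setTI; apply/seteqP; split => z; rewrite /I /= in_itv.
by apply: my => //; exact: measurable_itv.
Qed.

Let p_le S S' : measurable S -> measurable S' -> S `<=` S' -> p S <= p S'.
Proof.
by move=> mS mS' h; apply: fine_le; rewrite ?fin_num_measure//; apply: le_measure; rewrite ?inE.
Qed.

Let p_split a b c : a <= b -> b <= c -> p (I a c) = p (I a b) + p (I b c).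
Proof.
move=> ab bc; have -> : I a c = I a b `|` I b c.
  apply/seteqP; split => z; rewrite /I /=.
    by case: (ltP (y z) b) => h /andP[h1 h2]; [left|right]; apply/andP.
  by case=> /andP[h1 h2]; apply/andP; split; lra.
rewrite /p measureU//; first by rewrite fineD// fin_num_measure.
by apply/seteqP; split => // z [] /andP[h1 h2] /andP[h3 h4]; lra.
Qed.

(** The lightest third has length 3 e; keeping only its middle piece, of length e, leaves a margin e
    on both sides, so that a full neighbourhood of the limit point is controlled. *)
Let third l e q : 0 < e -> p (I l (l + 9 * e)) <= q -> exists l',
  [/\ l <= l', l' + e <= l + 9 * e & p (I (l' - e) (l' + 2 * e)) <= q / 3].
Proof.
move=> e0 h.
have s1 := @p_split l (l + 3 * e) (l + 9 * e); have s2 := @p_split (l + 3 * e) (l + 6 * e) (l + 9 * e).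
have a1 : l <= l + 3 * e by lra.
have a2 : l + 3 * e <= l + 9 * e by lra.
have a3 : l + 3 * e <= l + 6 * e by lra.
have a4 : l + 6 * e <= l + 9 * e by lra.
have {}s1 := s1 a1 a2; have {}s2 := s2 a3 a4.
have E1 : I l (l + 3 * e) = I (l + e - e) (l + e + 2 * e) by congr (I _ _); lra.
have E2 : I (l + 3 * e) (l + 6 * e) = I (l + 4 * e - e) (l + 4 * e + 2 * e) by congr (I _ _); lra.
have E3 : I (l + 6 * e) (l + 9 * e) = I (l + 7 * e - e) (l + 7 * e + 2 * e) by congr (I _ _); lra.
case: (leP (p (I l (l + 3 * e))) (q / 3)) => c1.
  by exists (l + e); split; [lra|lra|rewrite -E1].
case: (leP (p (I (l + 3 * e) (l + 6 * e))) (q / 3)) => c2.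
  by exists (l + 4 * e); split; [lra|lra|rewrite -E2].
by exists (l + 7 * e); split; [lra|lra|rewrite -E3; lra].
Qed.

(* A point around which [mu] has log-summable mass on the scale of [9^-k], obtained
   by repeatedly passing to the middle of the lightest third of an interval. *)
Lemma nested_point : exists2 x : R, 2^-1 <= x <= 1 &
  forall k, (mu [set z | (`|y z - x| < 18^-1 * 9^-1 ^+ k)%R] <= (3^-1 ^+ k)%:E)%E.
Proof.
pose e k : R := 2^-1 * 9^-1 ^+ k.
have e0 k : 0 < e k by rewrite /e mulr_gt0 ?exprn_gt0 ?invr_gt0.
have eS k : e k = 9 * e k.+1 by rewrite /e exprS; field.
pose good k l l' := [/\ l <= l', l' + e k.+1 <= l + e k
  & p (I (l' - e k.+1) (l' + 2 * e k.+1)) <= 3^-1 ^+ k.+1].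
have [f hf] : exists f : nat -> R -> R, forall k l,
    p (I l (l + e k)) <= 3^-1 ^+ k -> good k l (f k l).
  exists (fun k l => xget 0 [set l' | good k l l']) => k l h.
  apply: (@xgetPex _ 0 [set l' | good k l l']).
  rewrite eS in h; have [l' [h1 h2 h3]] := third (e0 k.+1) h.
  exists l'; split; [exact: h1|by rewrite (eS k)|by rewrite exprSr].
pose l := nat_rect (fun=> R) 2^-1 f.
have inv k : p (I (l k) (l k + e k)) <= 3^-1 ^+ k.
  elim: k => [|k IH].
    by rewrite expr0 /p -lee_fin fineK ?fin_num_measure// probability_le1.
  have [_ _] := hf k _ IH; apply: le_trans; apply: p_le => //.
  by move=> z /andP[h1 h2]; apply/andP; have := e0 k.+1; split; rewrite /= in h1 h2 *; lra.
have g k : good k (l k) (l k.+1) by exact: hf (inv k).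
have up : {homo l : i j / (i <= j)%N >-> i <= j}.
  by apply/nondecreasing_seqP => k; case: (g k).
have dn : {homo (fun k => l k + e k) : i j / (i <= j)%N >-> j <= i}.
  by apply/nonincreasing_seqP => k; case: (g k).
have cross i j : l i <= l j + e j.
  have := up i (maxn i j) (leq_maxl _ _); have := dn j (maxn i j) (leq_maxr _ _).
  by have := e0 (maxn i j); rewrite /=; lra.
have S : has_sup (range l).
  split; first by exists (l 0%N); exists 0%N.
  by exists (l 0%N + e 0%N) => _ [i _ <-]; exact: cross.
pose x := sup (range l).
have xl k : l k <= x by apply: ub_le_sup; [case: S|exists k].
have xu k : x <= l k + e k by apply: sup_le_ub; [case: S|move=> _ [i _ <-]; exact: cross].
exists x.
  have := xl 0%N; have := xu 0%N; rewrite /l /= /e expr0 => h1 h2.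
  by apply/andP; split; lra.
move=> k; have -> : 18^-1 * 9^-1 ^+ k = e k.+1 by rewrite /e exprS; field.
set S' := mkset _.
have mS' : measurable S'.
  have -> : S' = setT `&` y @^-1` `](x - e k.+1), (x + e k.+1)[%classic.
    by rewrite setTI; apply/seteqP; split => z; rewrite /S' /= in_itv /= ltr_distl.
  by apply: my => //; exact: measurable_itv.
have [_ _ h] := g k.
move: (xl k.+1) (xu k.+1) h; move: (l k.+1) => a h3 h4 h.
have : p S' <= 3^-1 ^+ k.+1.
  apply: le_trans h; apply: p_le => // z; rewrite /S' /I /= ltr_distl => /andP[h1 h2].
  by apply/andP; split; lra.
rewrite -lee_fin /p fineK ?fin_num_measure// => h1; apply: (le_trans h1).
rewrite lee_fin exprS ler_piMl ?exprn_ge0 ?invr_ge0//.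
by rewrite invf_le1// ler1n.
Qed.

End NestedPoint.

(** * Logarithmic potentials and their sums over finitely many points *)

Section Potential.
Variables (R : realType) (mu : probability (borelC R) R).
Variable K : set R[i]^o.
Hypotheses (cK : compact K) (muK : mu K = 1%E).
Variable g : R[i] -> R.

Definition potential_at l := (\int[mu]_z lne (cmod ((z : R[i]) - l))%:E = (g l)%:E)%E.

Let measurable_lne_cmod l :
  measurable_fun [set: borelC R] (fun z => lne (cmod ((z : R[i]) - l))%:E).
Proof. exact: measurableT_comp (@lne_measurable R) (measurable_cmod l). Qed.

(** On the compact carrier the logarithm is bounded above; a finite value of the potential then
    excludes an infinite negative part. *)
Lemma log_integrable l : potential_at l ->
  mu.-integrable setT (fun z => lne (cmod ((z : R[i]) - l))%:E).
Proof.
move=> hl; have [r r0 hr] := compact_cmod cK.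
pose B : set (borelC R) := [set z | cmod ((z : R[i]) - 0) <= r].
have mB : measurable B.
  have -> : B = setT `&` (fun z => cmod ((z : R[i]) - 0)) @^-1` `]-oo, r]%classic.
    by rewrite setTI; apply/seteqP; split => z; rewrite /B /= in_itv.
  by apply: measurable_cmod => //; exact: measurable_itv.
have mK : measurable (K : set (borelC R)).
  rewrite -(setCK K); apply: measurableC; apply: sub_sigma_algebra; apply: closed_openC.
  by apply: compact_closed cK; exact: norm_hausdorff.
have B1 : mu B = 1%E.
  apply/eqP; rewrite eq_le probability_le1//= -[leLHS]muK.
  by apply: le_measure; rewrite ?inE// => z Kz; rewrite /B /= subr0; exact: hr.
pose f z : \bar R := lne (cmod ((z : R[i]) - l))%:E.
have mf : measurable_fun [set: borelC R] f by exact: measurable_lne_cmod.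
have fp : (\int[mu]_z f^\+ z < +oo)%E.
  rewrite (integral_full mB B1)//; last exact: measurable_funepos.
  pose C := ln (r + cmod l + 1).
  apply: (@le_lt_trans _ _ (\int[mu]_(z in setT `&` B) (cst `|C|%:E z))%E).
    apply: ge0_le_integral => //; first exact: measurableI.
    - by apply: measurable_funTS; exact: measurable_funepos.
    - move=> z [_ Bz]; rewrite funeposE /f ge_max lee_fin normr_ge0 andbT.
      have h : cmod (z - l) <= r + cmod l + 1.
        by have := cmodD z (- l); move: Bz; rewrite /B /= subr0 cmodN; lra.
      rewrite /lne; case: (leP (cmod _) 0) => p; first by rewrite leNye.
      rewrite lee_fin; apply: le_trans (ler_norm C).
      by rewrite ler_ln ?posrE//; exact: lt_le_trans p h.
  rewrite (_ : (\int[mu]_(z in _) _ = `|C|%:E * mu (setT `&` B))%E); last first.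
    by apply: integral_cst; exact: measurableI.
  by rewrite setTI B1 mule1 ltry.
have fn : (\int[mu]_z f^\- z < +oo)%E.
  rewrite ltNge leye_eq; apply/negP => /eqP h.
  have := hl; rewrite /potential_at integralE -/f h.
  by move: fp; case: (\int[mu]_z f^\+ z)%E.
apply/integrableP; split => //.
under eq_integral do rewrite -/(f _) -[(`|f _|)%E]/((abse \o f) _) fune_abse.
rewrite ge0_integralD//; first exact: lte_add_pinfty.
- exact: measurable_funepos.
- exact: measurable_funeneg.
Qed.

Lemma lne_mul (x y : R) : 0 <= x -> 0 <= y -> (lne (x * y)%:E = lne x%:E + lne y%:E)%E.
Proof.
rewrite le_eqVlt => /predU1P[<-|x0]; first by rewrite mul0r /= lexx.
rewrite le_eqVlt => /predU1P[<-|y0]; first by rewrite mulr0 /= lexx leNgt x0.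
by rewrite !lne_EFin ?mulr_gt0// lnM ?posrE.
Qed.

Lemma log_product (s : seq R[i]) : (forall l, l \in s -> potential_at l) ->
  mu.-integrable setT (fun z => lne (\prod_(l <- s) cmod ((z : R[i]) - l))%:E) /\
  (\int[mu]_z lne (\prod_(l <- s) cmod ((z : R[i]) - l))%:E = (\sum_(l <- s) g l)%:E)%E.
Proof.
elim: s => [|l s IH] hs.
  have E : (fun z : borelC R => lne (\prod_(l <- [::]) cmod ((z : R[i]) - l))%:E) = cst 0%E.
    by apply/funext => z; rewrite big_nil lne_EFin// ln1.
  by rewrite E big_nil integral0; split => //; exact: integrable0.
have [i1 e1] : _ /\ _ := IH (fun l' h => hs l' (@mem_behead _ (l :: s) l' h)).
have hl := hs l (mem_head l s); have i2 := log_integrable hl.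
have E : (fun z : borelC R => lne (\prod_(l' <- l :: s) cmod ((z : R[i]) - l'))%:E) =
   (fun z => lne (cmod ((z : R[i]) - l))%:E + lne (\prod_(l <- s) cmod ((z : R[i]) - l))%:E)%E.
  apply/funext => z; rewrite big_cons lne_mul ?cmod_ge0//.
  by apply: prodr_ge0 => l' _; exact: cmod_ge0.
by rewrite E big_cons integralD// e1 hl; split => //; exact: integrableD.
Qed.

End Potential.

(** If m is the first index with 18^-1 9^-m <= t, then ln t >= -ln 18 - m ln 9. So the number of
    scales that [t] falls below measures its logarithmic singularity; for t = 0 it is infinite. *)
Lemma lne_ge_count (R : realType) (b : \bar R) (t : R) : 0 <= t ->
  (forall m : nat, (forall k, (k < m)%N -> t < 18^-1 * 9^-1 ^+ k) ->
    ((m%:R * ln 9)%:E <= b)%E) ->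
  ((- ln 18)%:E - b <= lne t%:E)%E.
Proof.
move=> t0 h; have l9 : 0 < ln (9 : R) by rewrite ln_gt0// ltr1n.
have b0 : (0 <= b)%E by rewrite -[0%E]/(0%:E) -(mul0r (ln 9)); apply: (h 0%N).
have e0 k : 0 < 18^-1 * 9^-1 ^+ k :> R by rewrite mulr_gt0 ?exprn_gt0 ?invr_gt0.
move: t0 h; rewrite le_eqVlt => /predU1P[<-|t0] h.
  suff -> : b = +oo%E by rewrite addeNy leNye.
  apply/eqyP => A A0; have [n _ hn] := near_infty_natSinv_lt (PosNum (divr_gt0 l9 A0)).
  have := hn n (leqnn n); rewrite /= => hn'.
  apply: le_trans (h n.+1 (fun k _ => e0 k)); rewrite lee_fin.
  by move: hn'; rewrite ltr_pdivlMr// ltr_pdivrMl ?ltr0n// => /ltW.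
have ex : exists k, 18^-1 * 9^-1 ^+ k <= t.
  have [k hk] := ltr_add_invr t0; exists k; rewrite add0r in hk.
  apply: le_trans (ltW hk); rewrite exprVn -invfM lef_pV2 ?posrE ?mulr_gt0 ?exprn_gt0//.
  apply: (@le_trans _ _ (9 ^+ k)); first by rewrite -natrX ler_nat ltn_expl.
  by rewrite ler_peMl ?exprn_ge0// ler1n.
case: (ex_minnP ex) => m hm min.
have lt k : (k < m)%N -> t < 18^-1 * 9^-1 ^+ k.
  by move=> km; rewrite ltNge; apply/negP => /min; rewrite leqNgt km.
have hb := h m lt; rewrite lne_EFin//.
have lnt : - ln 18 - m%:R * ln 9 <= ln t.
  have <- : ln (18^-1 * 9^-1 ^+ m) = - ln 18 - m%:R * ln 9 :> R.
    rewrite lnM ?posrE ?exprn_gt0 ?invr_gt0// exprVn !lnV ?posrE ?exprn_gt0//.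
    by rewrite lnXn// mulr_natl.
  by rewrite ler_ln ?posrE.
move: hb b0; case: b {h} => [x| |] //= hb b0; last by rewrite addeNy leNye.
by move: hb b0; rewrite -EFinD !lee_fin => h1 h2; lra.
Qed.

Lemma lne_mono (R : realType) (a b : R) : a <= b -> (lne a%:E <= lne b%:E)%E.
Proof.
move=> ab; case: (leP a 0) => a0; first by rewrite /= a0 leNye.
by rewrite !lne_EFin ?(lt_le_trans a0 ab)// lee_fin ler_ln ?posrE ?(lt_le_trans a0 ab).
Qed.

Lemma limit_value_outside (R : realType) (r : R) : 2^-1 <= r ^+ 2 -> limit_value r = ln r.
Proof. by move=> h; rewrite /limit_value ?div1r h. Qed.

(** * The support determined from the potential *)

Section Support.
Variables (R : realType) (mu : probability (borelC R) R).
Variable K : set R[i]^o.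
Hypotheses (cK : compact K) (muK : mu K = 1%E).

Definition gauge (z : R[i]) : R := cmod (1 - z ^+ 2).
Definition half_limit l : R := limit_value (gauge l) / 2.
Hypothesis pot : forall l, 0 < gauge l -> potential_at mu half_limit l.

Lemma log_polynomial (P : {poly R[i]}) : P \is monic ->
  (forall l, root P l -> 0 < gauge l) ->
  exists s : seq R[i], [/\ size s = (size P).-1, forall l, l \in s -> root P l,
    mu.-integrable setT (fun z => lne (cmod P.[z : R[i]])%:E) &
    (\int[mu]_z lne (cmod P.[z : R[i]])%:E = (\sum_(l <- s) half_limit l)%:E)%E].
Proof.
move=> mP hP; have [s hs] := closed_field_poly_normal P; exists s.
rewrite (monicP mP) scale1r in hs.
have rs l : l \in s -> root P l by rewrite hs root_prod_XsubC.
have E (z : borelC R) : cmod P.[z : R[i]] = \prod_(l <- s) cmod ((z : R[i]) - l).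
  rewrite hs horner_prod -cmod_prod; congr cmod.
  by apply: eq_bigr => l _; rewrite hornerXsubC.
have [] := @log_product R mu K cK muK half_limit s; first by move=> l /rs /hP; exact: pot.
have -> : (fun z : borelC R => lne (\prod_(l <- s) cmod ((z : R[i]) - l))%:E) =
  (fun z : borelC R => lne (cmod P.[z : R[i]])%:E) by apply/funext => z; rewrite E.
move=> h1 h2; split => //; first by rewrite hs size_prod_XsubC.
Qed.

Let measurable_gauge : measurable_fun [set: borelC R] (fun z => gauge z).
Proof.
have -> : (fun z : borelC R => gauge z) =
    (fun z : borelC R => cmod ((z : R[i]) - 1) * cmod ((z : R[i]) - (- 1))).
  by apply/funext => z; rewrite /gauge -cmodM cmodBC; congr cmod; ring.
by apply: measurable_funM; exact: measurable_cmod.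
Qed.

Section Outside.
Variables (r kap : R).
Hypotheses (r0 : 0 < r) (r2 : 2^-1 < r ^+ 2) (kap1 : 1 < kap).

Let E : set (borelC R) := [set z | kap * r <= gauge z].

Let mE : measurable E.
Proof.
have -> : E = setT `&` (fun z : borelC R => gauge z) @^-1` `[kap * r, +oo[%classic.
  by rewrite setTI; apply/seteqP; split => z; rewrite /E /= in_itv /= andbT.
by apply: measurable_gauge => //; exact: measurable_itv.
Qed.

(** Test mu against P = (z^2 - 1)^n - x r^n. Its 2 n roots lie on one level curve of [gauge], where
    the potential is half of ln [gauge], so ln |P| integrates to ln (x r^n). Pointwise |P| >= r^n |y
    - x| with y = (gauge / r)^n: on [E] this gains n ln kap, and elsewhere the loss is the
    singularity at y = x, whose integral is bounded independently of n by the choice of x in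
    [nested_point]. *)
Let outside_bound n : 4 <= (2 * r ^+ 2) ^+ n -> 2 <= kap ^+ n ->
  n%:R * ln kap * fine (mu E) <= ln 18 + 2 * ln 9.
Proof.
move=> n4 n2.
have n0 : (0 < n)%N by case: n n4 {n2} => //; rewrite expr0; lra.
have l9 : 0 < ln (9 : R) by rewrite ln_gt0// ltr1n.
pose y (z : borelC R) := (gauge z / r) ^+ n.
have my : measurable_fun [set: borelC R] y.
  by apply: measurable_funX; apply: measurable_funM.
have [x /andP[x2 x1] hx] := nested_point mu my.
have x0 : 0 < x by apply: lt_le_trans x2; rewrite invr_gt0.
have rn0 : 0 < r ^+ n by rewrite exprn_gt0.
have xr0 : 0 < x * r ^+ n by rewrite mulr_gt0.
pose P : {poly R[i]} := ('X^2 - 1%:P) ^+ n - ((x * r ^+ n)%:C)%:P.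
have mQ : ('X^2 - 1%:P : {poly R[i]}) ^+ n \is monic by apply: monic_exp; exact: monicXnsubC.
have sQ : size (('X^2 - 1%:P : {poly R[i]}) ^+ n) = (n.*2).+1.
  rewrite -[LHS]prednK ?size_poly_gt0 ?monic_neq0// size_exp size_XnsubC//.
  by rewrite mul2n.
have sc : (size (- ((x * r ^+ n)%:C)%:P : {poly R[i]}) < (n.*2).+1)%N.
  by rewrite size_polyN; apply: (leq_ltn_trans (size_polyC_leq1 _)); rewrite ltnS double_gt0.
have mP : P \is monic by rewrite monicE lead_coefDl ?sQ// (monicP mQ).
have sP : size P = (n.*2).+1 by rewrite size_polyDl ?sQ.
have PE z : P.[z] = (z ^+ 2 - 1) ^+ n - (x * r ^+ n)%:C by rewrite /P !hornerE.
have rt l : root P l -> gauge l ^+ n = x * r ^+ n.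
  rewrite rootE PE subr_eq0 => /eqP e; rewrite /gauge cmodBC -cmodX e cmod_real.
  by rewrite gtr0_norm.
have rt0 l : root P l -> 0 < gauge l.
  move=> /rt e; rewrite lt_neqAle cmod_ge0 andbT; apply/eqP => h.
  by move: xr0; rewrite -e -h expr0n eqn0Ngt n0 /= ltxx.
(* As x may be as small as 1/2, the roots may lie below the level r; the hypothesis with the
   constant 4 compensates x^2 >= 1/4. *)
have rt2 l : root P l -> 2^-1 <= gauge l ^+ 2.
  move=> /rt e; rewrite leNgt; apply/negP => h.
  have a0 : 0 <= 2 * gauge l ^+ 2 by have := sqr_ge0 (gauge l); lra.
  have a1 : 2 * gauge l ^+ 2 < 1 by lra.
  have a2 : (2 * gauge l ^+ 2) ^+ n < 1.
    exact: le_lt_trans (ler_iXnr n0 a0 (ltW a1)) a1.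
  move: a2; have -> : (2 * gauge l ^+ 2) ^+ n = x ^+ 2 * (2 * r ^+ 2) ^+ n.
    rewrite exprMn -(exprM (gauge l)) (mulnC 2%N n) (exprM (gauge l)) e.
    rewrite [(2 * r ^+ 2) ^+ n]exprMn -(exprM r) (mulnC 2%N n) (exprM r).
    by ring.
  have x4 : 4^-1 <= x ^+ 2 by rewrite expr2; nra.
  have q1 : (0 : R) <= 4^-1 by lra.
  have q2 : (0 : R) <= 4 by lra.
  by have := ler_pM q1 q2 x4 n4; rewrite mulVf//; lra.
have [s [ss rs iP IP]] := log_polynomial mP rt0.
have sumE : \sum_(l <- s) half_limit l = ln (x * r ^+ n).
  transitivity (\sum_(l <- s) ln (x * r ^+ n) / (n.*2)%:R).
    apply: eq_big_seq => l /rs hl; rewrite -(rt _ hl) lnXn ?rt0// /half_limit.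
    rewrite limit_value_outside ?rt2// -mulr_natl -mul2n natrM.
    by field; rewrite pnatr_eq0 -lt0n n0.
  rewrite big_const_seq count_predT iter_addr addr0 ss sP /= -[LHS]mulr_natl.
  by field; rewrite pnatr_eq0 -lt0n double_gt0.
pose S k : set (borelC R) := [set z | `|y z - x| < 18^-1 * 9^-1 ^+ k].
have mS k : measurable (S k).
  have -> : S k = setT `&` y @^-1` `](x - 18^-1 * 9^-1 ^+ k), (x + 18^-1 * 9^-1 ^+ k)[%classic.
    by rewrite setTI; apply/seteqP; split => z; rewrite /S /= in_itv /= ltr_distl.
  by apply: my => //; exact: measurable_itv.
pose f k (z : borelC R) : \bar R := (ln 9 * \1_(S k) z)%:E.
have f0 k z : (0 <= f k z)%E by rewrite lee_fin mulr_ge0// ltW.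
have mf k : measurable_fun [set: borelC R] (f k).
  by apply/measurable_EFinP; apply: measurable_funM => //; exact: measurable_indic.
(* ln 9 times the number of scales at which y(z) is close to x. The masses 3^-k of these events sum
   to 3/2, which is estimated by 2. *)
pose bad (z : borelC R) : \bar R := (\sum_(0 <= k <oo) f k z)%E.
have bad0 z : (0 <= bad z)%E by apply: nneseries_ge0 => k _ _.
have mbad : measurable_fun [set: borelC R] bad.
  by apply: ge0_emeasurable_sum => // k z _ _.
have Ibad : (\int[mu]_z bad z <= (2 * ln 9)%:E)%E.
  rewrite integral_nneseries//; apply: lime_le.
    by apply: is_cvg_nneseries => k _ _; exact: integral_ge0.
  apply: nearW => m; apply: (@le_trans _ _ (\sum_(0 <= k < m) (ln 9 * 3^-1 ^+ k)%:E)%E).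
    apply: lee_sum => k _; rewrite /f; under eq_integral do rewrite EFinM.
    rewrite ge0_integralZl_EFin//; last 2 first.
    - by apply/measurable_EFinP; exact: measurable_indic.
    - exact: ltW.
    rewrite EFinM; apply: lee_wpmul2l; first by rewrite lee_fin ltW.
    rewrite (_ : (\int[mu]_z _)%E = mu (S k)) ?hx//.
    by rewrite -[S k in RHS](setIT); exact: integral_indic.
  rewrite sumEFin lee_fin -mulr_sumr mulrC ler_wpM2r// ?ltW//.
  suff -> : \sum_(0 <= k < m) 3^-1 ^+ k = 3 / 2 * (1 - 3^-1 ^+ m) :> R.
    by have : (0 : R) <= 3^-1 ^+ m; [rewrite exprn_ge0 ?invr_ge0|]; lra.
  elim: m => [|m IH]; first by rewrite big_geq// expr0 subrr mulr0.
  by rewrite big_nat_recr//= IH exprS; field.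
have ibad : mu.-integrable setT bad.
  apply/integrableP; split => //; under eq_integral do rewrite gee0_abs//.
  by apply: le_lt_trans Ibad _; rewrite ltry.
pose c0 := n%:R * ln r - ln 18.
pose h (z : borelC R) := n%:R * ln kap * \1_E z + c0.
have ih : mu.-integrable setT (EFin \o h).
  have mh : measurable_fun [set: borelC R] h.
    apply: measurable_funD => //; apply: measurable_funM => //; exact: measurable_indic.
  apply: (@bounded_integrable _ _ _ mu setT measurableT _ (`|n%:R * ln kap| + `|c0|) mh).
  move=> z _; rewrite /h; apply: le_trans (ler_normD _ _) _; rewrite lerD2r normrM.
  by rewrite indicE; case: (_ \in _); rewrite /= ?normr1 ?normr0 ?mulr1 ?mulr0.
have low (z : borelC R) : ((h z)%:E - bad z <= lne (cmod P.[z : R[i]])%:E)%E.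
  have t0 : 0 <= `|y z - x| by exact: normr_ge0.
  have d1 : r ^+ n * `|y z - x| <= cmod P.[z : R[i]].
    rewrite PE; apply: le_trans (cmod_dist _ _); rewrite cmod_real cmodX (gtr0_norm xr0).
    rewrite -[r ^+ n in leLHS]gtr0_norm// -normrM (cmodBC _ 1) -/(gauge z); apply: le_of_eq.
    by rewrite /y expr_div_n; congr `|_|; move: (r ^+ n) rn0 => q q0; field; rewrite gt_eqF.
  have d2 : ((n%:R * ln r)%:E + lne `|y z - x|%:E <= lne (cmod P.[z : R[i]])%:E)%E.
    have -> : (n%:R * ln r)%:E = lne (r ^+ n)%:E by rewrite lne_EFin// lnXn// mulr_natl.
    rewrite -(lne_mul (ltW rn0) t0); exact: lne_mono.
  apply: le_trans d2; rewrite /h /c0; case: (boolP (z \in E)) => zE.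
    have -> : \1_E z = 1 :> R by rewrite indicE zE.
    have kr : kap <= gauge z / r by rewrite ler_pdivlMr//; move: zE; rewrite inE.
    have kp : 0 <= kap by exact: le_trans ler01 (ltW kap1).
    have yk : kap ^+ n <= y z.
      by rewrite /y; apply: lerXn2r; rewrite ?nnegrE// (le_trans kp kr).
    have ty : kap ^+ n / 2 <= `|y z - x| by rewrite ger0_norm; lra.
    have k0 : 0 < kap ^+ n by lra.
    rewrite lne_EFin; last by lra.
    have lt : ln (kap ^+ n) - ln 2 <= ln `|y z - x|.
      by rewrite -ln_div ?posrE// ler_ln ?posrE//; lra.
    have l2 : ln 2 <= ln 18 :> R by rewrite ler_ln ?posrE// ler_nat.
    have e1 : ln (kap ^+ n) = n%:R * ln kap.
      by rewrite lnXn ?mulr_natl// (lt_trans ltr01 kap1).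
    rewrite e1 in lt.
    move: (bad0 z); case: (bad z) => [b| |] b0; [|by rewrite addeNy leNye|by []].
    by move: b0; rewrite -EFinB -EFinD !lee_fin mulr1 => b0; lra.
  have -> : \1_E z = 0 :> R by rewrite indicE (negbTE zE).
  rewrite mulr0 add0r EFinD -addeA; have hc := @lne_ge_count R (bad z) _ t0.
  apply: leeD => //; apply: hc => m hm.
  apply: le_trans (@nneseries_lim_ge R (f^~ z) xpredT 0 m (fun k _ _ => f0 k z)).
  rewrite (eq_big_nat _ _ (F2 := fun=> (ln 9)%:E)); last first.
    by move=> k /andP[_ km]; rewrite /f indicE mem_set ?mulr1//; exact: hm.
  by rewrite sumEFin lee_fin sumr_const_nat subn0 mulr_natl.
have I1 : (\int[mu]_z ((h z)%:E - bad z) <= (ln (x * r ^+ n))%:E)%E.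
  rewrite -sumE -IP; apply: le_integral => //; exact: integrableB.
have I2 : (\int[mu]_z ((h z)%:E - bad z) = \int[mu]_z (h z)%:E - \int[mu]_z bad z)%E.
  exact: (integralB measurableT ih ibad).
have Ih : (\int[mu]_z (h z)%:E = (n%:R * ln kap * fine (mu E) + c0)%:E)%E.
  have e1 : (\int[mu]_z (\1_E z)%:E = mu E)%E.
    by rewrite -[E in RHS](setIT); exact: integral_indic.
  have i1 : mu.-integrable setT (EFin \o (\1_E : borelC R -> R)).
    apply: (@bounded_integrable _ _ _ mu setT measurableT _ 1); first exact: measurable_indic.
    by move=> z _; rewrite indicE; case: (_ \in _); rewrite /= ?normr1 ?normr0.
  have ic : mu.-integrable setT (EFin \o cst c0).
    by apply: (@bounded_integrable _ _ _ mu setT measurableT _ `|c0|).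
  rewrite /h; under eq_integral do rewrite EFinD EFinM.
  rewrite integralD//; last exact: integrableZl.
  rewrite integralZl// e1 (_ : (\int[mu]_z c0%:E = c0%:E)%E); last first.
    transitivity (c0%:E * mu setT)%E; first exact: integral_cst.
    by rewrite probability_setT mule1.
  have : mu E \is a fin_num by exact: fin_num_measure.
  by case: (mu E) => [b| |].
have lx : ln (x * r ^+ n) <= n%:R * ln r.
  rewrite lnM ?posrE// lnXn// mulr_natl gerDr.
  by rewrite -[leRHS]ln1 ler_ln ?posrE.
have E2 := fineK (integrable_fin_num measurableT ibad).
rewrite I2 Ih -E2 -EFinB lee_fin in I1; rewrite -E2 lee_fin in Ibad.
by move: I1 Ibad; rewrite /c0; lra.
Qed.

(** The right-hand side of [outside_bound] is independent of n, while a positive mass of [E] would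
    make the left-hand side grow linearly. *)
Lemma outside_null : mu E = 0%E.
Proof.
have lk : 0 < ln kap by exact: ln_gt0.
have pE : mu E = (fine (mu E))%:E by rewrite fineK// fin_num_measure.
have p0 : 0 <= fine (mu E) by rewrite fine_ge0.
rewrite pE; congr EFin; apply/eqP; rewrite eq_le p0 andbT leNgt; apply/negP => pp.
have grow (a : R) : 1 < a -> forall b, 0 <= b -> exists N, forall n, (N <= n)%N -> b <= a ^+ n.
  move=> a1 b b0; have [N hN] : exists N : nat, b / (a - 1) <= N%:R.
    exists (Num.bound (b / (a - 1))); apply/ltW/archi_boundP.
    by rewrite divr_ge0// subr_ge0 ltW.
  have a0 : 0 <= a - 1 by rewrite subr_ge0 ltW.
  exists N => n Nn; apply: (@le_trans _ _ (1 + n%:R * (a - 1))).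
    move: hN; rewrite ler_pdivrMr ?subr_gt0// => h1.
    have h2 : N%:R * (a - 1) <= n%:R * (a - 1) by apply: ler_wpM2r => //; rewrite ler_nat.
    by lra.
  elim: n {Nn} => [|n IH]; first by rewrite expr0 mul0r addr0.
  have h1 : a * (1 + n%:R * (a - 1)) <= a * a ^+ n.
    by apply: ler_wpM2l => //; exact: le_trans ler01 (ltW a1).
  have h2 : 0 <= n%:R * (a - 1) ^+ 2 by rewrite mulr_ge0// sqr_ge0.
  rewrite exprS -natr1; apply: le_trans h1; rewrite -subr_ge0.
  by apply: le_trans h2 _; apply: le_of_eq; ring.
have r21 : 1 < 2 * r ^+ 2 by rewrite -ltr_pdivrMl ?mulr1.
have [N1 h1] := grow (2 * r ^+ 2) r21 4 (ler0n _ _).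
have [N2 h2] := grow kap kap1 2 (ler0n _ _).
have [N3 h3] : exists N : nat, (ln 18 + 2 * ln 9 + 1) / (ln kap * fine (mu E)) <= N%:R.
  eexists; apply/ltW/archi_boundP; rewrite divr_ge0//; last by apply: mulr_ge0; exact: ltW.
  by rewrite !addr_ge0// ?mulr_ge0// ln_ge0// ler1n.
pose n := maxn N1 (maxn N2 N3).
have := @outside_bound n (h1 n (leq_maxl _ _)).
move=> /(_ (h2 n _)); rewrite leq_max leq_maxl orbT => /(_ isT).
have : (N3%:R : R) <= n%:R by rewrite ler_nat /n !leq_max leqnn !orbT.
move: h3; rewrite ler_pdivrMr ?mulr_gt0// => a1 a2 a3.
rewrite -mulrA in a3; have h4 := ler_wpM2r (ltW (mulr_gt0 lk pp)) a2.
have : ln 18 + 2 * ln 9 + 1 <= ln 18 + 2 * ln 9 :> R.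
  exact: le_trans a1 (le_trans h4 a3).
by rewrite gerDl leNgt ltr01.
Qed.

End Outside.

Lemma cmod_sq (z : R[i]) : cmod z ^+ 2 = complex.Re z ^+ 2 + complex.Im z ^+ 2.
Proof.
by case: z => a b; rewrite /cmod normc_def /= sqr_sqrtr// addr_ge0// sqr_ge0.
Qed.

Lemma gauge_sq (x y : R) : gauge (x +i* y) ^+ 2 =
  (1 - (x ^+ 2 - y ^+ 2)) ^+ 2 + (2 * x * y) ^+ 2.
Proof. by rewrite /gauge cmod_sq /=; ring. Qed.

Lemma gauge_lipschitz z w : cmod (w - z) <= 1 ->
  `|gauge w - gauge z| <= cmod (w - z) * (2 * cmod z + 1).
Proof.
move=> wz; apply: le_trans (cmod_dist _ _) _.
have -> : 1 - w ^+ 2 - (1 - z ^+ 2) = (w - z) * - (2%:R * z + (w - z)) by ring.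
rewrite cmodM cmodN; apply: ler_wpM2l; first exact: cmod_ge0.
apply: le_trans (cmodD _ _) _; rewrite cmodM; apply: lerD => //.
have -> : (2%:R : R[i]) = (2 : R)%:C by rewrite rmorph_nat.
by rewrite cmod_real ger0_norm.
Qed.

Lemma ln_le_sub1 (y : R) : 0 < y -> ln y <= y - 1.
Proof.
move=> y0; rewrite -[leRHS]expRK ler_ln ?posrE ?expR_gt0//.
by apply: le_trans (expR_ge1Dx _); lra.
Qed.

Let half_limit_inside l : gauge l ^+ 2 < 2^-1 ->
  half_limit l = (- ln 2 - ln (1 - gauge l ^+ 2) / 2) / 2.
Proof.
by move=> h; rewrite /half_limit /limit_value ?div1r leNgt h.
Qed.

(* Inside the region the potential is strictly subharmonic, whereas off the support it
   is harmonic: compare the mean over [l0 + h i^j] with the value at [l0]. *)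
Lemma inside_charged l0 (r : R) : 0 < r -> 0 < gauge l0 -> gauge l0 ^+ 2 < 2^-1 ->
  mu [set z : R[i] | cmod (z - l0) < r] <> 0%E.
Proof.
move=> r0 q0 q2 null.
pose B : set (borelC R) := [set z | cmod ((z : R[i]) - l0) < r].
have mB : measurable B by apply: sub_sigma_algebra; exact: cmod_ball_open.
have mC : measurable (~` B) by exact: measurableC.
have C1 : mu (~` B) = 1%E.
  have -> : mu (~` B) = (1 - mu B)%E by exact: probability_setC.
  by rewrite (_ : mu B = 0%E) ?sube0.
have l00 : 0 < cmod l0.
  rewrite lt_neqAle cmod_ge0 andbT; apply/eqP => /esym/cmod_eq0 e.
  by move: q2; rewrite e /gauge expr0n subr0 cmod1 expr1n; lra.
set q := gauge l0 in q0 q2 *; set a := cmod l0 in l00 *.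
have q1 : q < 1 by rewrite ltNge; apply/negP => h; nra.
(* [eta] is the variation of [gauge] allowed for the four points: they must keep [gauge] positive
   and its square below 1/2. *)
pose eta := Num.min (q / 2) ((2^-1 - q ^+ 2) / 4).
have eta0 : 0 < eta by rewrite lt_min; apply/andP; split; lra.
have eta1 : eta <= q / 2 by rewrite ge_min lexx.
have eta2 : eta <= (2^-1 - q ^+ 2) / 4 by rewrite ge_min lexx orbT.
(* The first two bounds serve [gauge_lipschitz]. The last contradicts 4 a^2 r^4 < h^2, to which a
   null disc of radius r would lead. *)
pose h := Num.min (Num.min 1 (eta / (2 * a + 1))) (a * r ^+ 2).
have a1 : 0 < 2 * a + 1 by lra.
have h0 : 0 < h.
  rewrite !lt_min ltr01 /= divr_gt0//=; apply: mulr_gt0 => //; exact: exprn_gt0.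
have h1 : h <= 1 by rewrite /h !ge_min lexx.
have h2 : h * (2 * a + 1) <= eta by rewrite -ler_pdivlMr// /h !ge_min lexx orbT.
have h3 : h <= a * r ^+ 2 by rewrite /h ge_min lexx orbT.
have near_l0 l : cmod (l - l0) = h -> 0 < gauge l /\ gauge l ^+ 2 < 2^-1.
  move=> hl; have := gauge_lipschitz (z := l0) (w := l); rewrite hl => /(_ h1).
  rewrite ler_norml -/q -/a => /andP[g1 g2].
  have g3 : gauge l <= q + eta by lra.
  have g4 : 0 < gauge l by lra.
  split => //; apply: (@le_lt_trans _ _ ((q + eta) ^+ 2)).
    by apply: lerXn2r; rewrite ?nnegrE; lra.
  have : eta * (2 * q + eta) <= eta * 3 by apply: ler_wpM2l; lra.
  by rewrite sqrrD -mulr_natl; lra.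
pose s := [:: l0 + h%:C; l0 - h%:C; l0 + h%:C * 'i%C; l0 - h%:C * 'i%C].
have ci : cmod ('i%C : R[i]) = 1.
  have : cmod ('i%C : R[i]) ^+ 2 == 1 by rewrite cmod_sq /=; apply/eqP; ring.
  rewrite sqrf_eq1 => /orP[/eqP//|/eqP e]; have := cmod_ge0 ('i%C : R[i]).
  by rewrite e; lra.
have ch : cmod h%:C = h by rewrite cmod_real gtr0_norm.
have sd l : l \in s -> cmod (l - l0) = h.
  rewrite !inE => /or4P[] /eqP ->; rewrite (addrC l0) addrK ?cmodN ?cmodM ?ci ?ch ?mulr1//.
have [i1 e1] : _ /\ _ := @log_product R mu K cK muK half_limit s
  (fun l hl => pot (proj1 (near_l0 l (sd l hl)))).
pose s0 := [:: l0; l0; l0; l0].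
have [i2 e2] : _ /\ _ := @log_product R mu K cK muK half_limit s0 (ltac:(
  by move=> l; rewrite !inE !orbb => /eqP ->; apply: pot)).
pose c := (h / r) ^+ 4.
have hr0 : 0 <= h / r by rewrite divr_ge0// ltW.
have ic : mu.-integrable (~` B) (EFin \o cst c).
  by apply: (@bounded_integrable _ _ _ mu _ mC _ `|c|).
have leI : (\sum_(l <- s) half_limit l <= \sum_(l <- s0) half_limit l + c)%R.
  rewrite -lee_fin EFinD -e1 -e2.
  have mi f : mu.-integrable setT f -> measurable_fun [set: borelC R] f by case/integrableP.
  rewrite (integral_full mC C1 measurableT (mi _ i1)) (integral_full mC C1 measurableT (mi _ i2)).
  rewrite setTI.
  have -> : c%:E = (\int[mu]_(z in ~` B) (c%:E))%E.
    transitivity (c%:E * mu (~` B))%E; first by rewrite C1 mule1.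
    by apply: esym; exact: integral_cst.
  have j1 := integrableS measurableT mC (@subsetT _ _) i1.
  have j2 := integrableS measurableT mC (@subsetT _ _) i2.
  rewrite -integralD//; apply: le_integral => //; first exact: integrableD.
  move=> z /set_mem; rewrite /B /= => /negP; rewrite -leNgt => hz.
  have w0 : 0 < cmod (z - l0) by exact: lt_le_trans hz.
  have -> : \prod_(l <- s0) cmod ((z : R[i]) - l) = cmod ((z : R[i]) - l0) ^+ 4.
    by rewrite /s0 !big_cons big_nil; ring.
  have -> : \prod_(l <- s) cmod ((z : R[i]) - l) = cmod (((z : R[i]) - l0) ^+ 4 - (h ^+ 4)%:C).
    rewrite /s !big_cons big_nil mulr1 -!cmodM; congr cmod.
    have i2' : ('i%C : R[i]) ^+ 2 = -1 by exact: sqr_i.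
    have i4 : ('i%C : R[i]) ^+ 4 = 1 by rewrite (exprM _ 2 2) i2' sqrrN expr1n.
    rewrite rmorphXn /=; move: (z : R[i]) (h%:C) => v k.
    have -> : (v - (l0 + k)) * ((v - (l0 - k)) * ((v - (l0 + k * 'i%C)) * (v - (l0 - k * 'i%C)))) =
      ((v - l0) ^+ 2 - k ^+ 2) * ((v - l0) ^+ 2 - k ^+ 2 * 'i%C ^+ 2) by ring.
    by rewrite i2'; ring.
  set w := cmod _ in hz w0 *.
  have le4 : cmod ((z - l0) ^+ 4 - (h ^+ 4)%:C) <= w ^+ 4 * (1 + c).
    apply: le_trans (cmodD _ _) _; rewrite cmodN cmodX -/w cmod_real.
    rewrite mulrDr mulr1 lerD2l ger0_norm ?exprn_ge0 ?(ltW h0)// /c expr_div_n.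
    rewrite mulrCA ler_peMr ?exprn_ge0 ?(ltW h0)// ler_pdivlMr ?exprn_gt0// mul1r.
    by apply: lerXn2r; rewrite ?nnegrE// ltW.
  have c0 : 0 <= c by rewrite exprn_ge0.
  have p1 : 0 < 1 + c by lra.
  have p2 : 0 < w ^+ 4 by rewrite exprn_gt0.
  have p3 : 0 < w ^+ 4 * (1 + c) by exact: mulr_gt0.
  have le5 : (lne (w ^+ 4 * (1 + c))%:E <= lne (w ^+ 4)%:E + c%:E)%E.
    rewrite (lne_EFin p3) (lne_EFin p2) -EFinD lee_fin lnM ?posrE// lerD2l.
    by have := ln_le_sub1 p1; lra.
  exact: le_trans (lne_mono le4) le5.
(* As a function of u = gauge^2 the potential is -ln (1 - u) / 4 up to a constant, which is convex;
   this is its tangent at q^2. *)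
have tj l : l \in s -> half_limit l0 + (gauge l ^+ 2 - q ^+ 2) / 4 / (1 - q ^+ 2) <= half_limit l.
  move=> /sd /near_l0 [_ t2]; rewrite !half_limit_inside// -/q.
  have u0 : 0 < 1 - q ^+ 2 by lra.
  have v0 : 0 < 1 - gauge l ^+ 2 by lra.
  have := ln_le_sub1 (divr_gt0 v0 u0); rewrite ln_div ?posrE//.
  have -> : (1 - gauge l ^+ 2) / (1 - q ^+ 2) - 1 = - (gauge l ^+ 2 - q ^+ 2) / (1 - q ^+ 2).
    by field; rewrite gt_eqF.
  move: (ln _) (ln _) => A1 A2; rewrite mulNr.
  have -> : (gauge l ^+ 2 - q ^+ 2) / 4 / (1 - q ^+ 2) = (gauge l ^+ 2 - q ^+ 2) / (1 - q ^+ 2) / 4.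
    by field; rewrite gt_eqF.
  by lra.
have lower : \sum_(l <- s0) half_limit l + \sum_(l <- s) (gauge l ^+ 2 - q ^+ 2) / 4 / (1 - q ^+ 2)
    <= \sum_(l <- s) half_limit l.
  have := tj _ (_ : l0 + h%:C \in s); have := tj _ (_ : l0 - h%:C \in s).
  have := tj _ (_ : l0 + h%:C * 'i%C \in s); have := tj _ (_ : l0 - h%:C * 'i%C \in s).
  rewrite !inE !eqxx !orbT => /(_ isT) b1 /(_ isT) b2 /(_ isT) b3 /(_ isT) b4.
  by rewrite /s /s0 !big_cons !big_nil !addr0; lra.
(* The discrete form of the Laplacian 16 |z|^2 of gauge^2. It is positive at [l0], since 0 has gauge
   1 and is not in the region. *)
have sumt : \sum_(l <- s) (gauge l ^+ 2 - q ^+ 2) = 16 * a ^+ 2 * h ^+ 2 + 4 * h ^+ 4.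
  rewrite /s !big_cons big_nil /q /a cmod_sq; case: (l0) => x y.
  have -> : x +i* y + h%:C = (x + h) +i* y by apply/eqP; rewrite eq_complex /= addr0 !eqxx.
  have -> : x +i* y - h%:C = (x - h) +i* y by apply/eqP; rewrite eq_complex /= subr0 !eqxx.
  have -> : x +i* y + h%:C * 'i%C = x +i* (y + h).
    by apply/eqP; rewrite eq_complex /=; apply/andP; split; apply/eqP; ring.
  have -> : x +i* y - h%:C * 'i%C = x +i* (y - h).
    by apply/eqP; rewrite eq_complex /=; apply/andP; split; apply/eqP; ring.
  by rewrite !gauge_sq /=; ring.
have : (\sum_(l <- s) (gauge l ^+ 2 - q ^+ 2)) / 4 / (1 - q ^+ 2) <= c.
  rewrite !mulr_suml; lra.
rewrite sumt ler_pdivrMr; last by lra.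
move=> fin; have c0 : 0 <= c by rewrite exprn_ge0.
have fin2 : 4 * a ^+ 2 * h ^+ 2 + h ^+ 4 <= c.
  apply: (@le_trans _ _ (c * (1 - q ^+ 2))); first by lra.
  by rewrite ler_piMr//; have := sqr_ge0 q; lra.
have h40 : 0 < h ^+ 4 by rewrite exprn_gt0.
have : (4 * a ^+ 2 * h ^+ 2) * r ^+ 4 < h ^+ 4.
  by rewrite -ltr_pdivlMr ?exprn_gt0// -expr_div_n -/c; lra.
have -> : h ^+ 4 = h ^+ 2 * h ^+ 2 by ring.
have h20 : 0 < h ^+ 2 by rewrite exprn_gt0.
have -> : 4 * a ^+ 2 * h ^+ 2 * r ^+ 4 = (4 * (a * r ^+ 2) ^+ 2) * h ^+ 2 by ring.
rewrite ltr_pM2r// => bad.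
have : h ^+ 2 <= (a * r ^+ 2) ^+ 2 by apply: lerXn2r; rewrite ?nnegrE ?(ltW h0) ?(le_trans (ltW h0) h3).
by have := sqr_ge0 (a * r ^+ 2); lra.
Qed.

(** Where [gauge] vanishes, scaling by 1 + t makes it positive. Elsewhere a fraction t of the Newton
    step for 1 - z^2 multiplies it by 1 - t up to second order, which moves a boundary point
    strictly inside. *)
Lemma inside_approximation z (e : R) : gauge z ^+ 2 <= 2^-1 -> 0 < e ->
  exists l, [/\ cmod (l - z) < e, 0 < gauge l & gauge l ^+ 2 < 2^-1].
Proof.
move=> q2 e0; pose t := Num.min (e / 2) 8^-1.
have t0 : 0 < t by rewrite lt_min; apply/andP; split; lra.
have te : t <= e / 2 by rewrite ge_min lexx.
have t8 : t <= 8^-1 by rewrite ge_min lexx orbT.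
have ct : cmod t%:C = t by rewrite cmod_real gtr0_norm.
case: (eqVneq (gauge z) 0) => [/cmod_eq0 z1|qn].
  have zz : z ^+ 2 = 1 by apply/eqP; rewrite eq_sym -subr_eq0 z1.
  have cz : cmod z = 1 by apply: (@pexpIrn _ 2); rewrite ?nnegrE ?cmod_ge0// -cmodX zz cmod1 expr1n.
  have gE : gauge (z * (1 + t%:C)) = 2 * t + t ^+ 2.
    rewrite /gauge cmodBC exprMn zz mul1r.
    have -> : (1 + t%:C) ^+ 2 - 1 = (2 * t + t ^+ 2)%:C :> R[i].
      by rewrite rmorphD rmorphM rmorphXn rmorph_nat /=; ring.
    by rewrite cmod_real ger0_norm// addr_ge0 ?sqr_ge0// mulr_ge0// ltW.
  exists (z * (1 + t%:C)); rewrite gE mulrDr mulr1 addrAC subrr add0r cmodM cz ct mul1r.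
  by split; [lra|nra|nra].
have q0 : 0 < gauge z by rewrite lt_neqAle eq_sym qn cmod_ge0.
set q := gauge z in q0 q2 *.
have qs : q <= 3 / 4 by rewrite leNgt; apply/negP => h; nra.
have cz2 : 1 - q <= cmod z ^+ 2.
  have := cmod_dist 1 (1 - z ^+ 2).
  have -> : 1 - (1 - z ^+ 2) = z ^+ 2 by ring.
  rewrite cmodX cmod1 -/(gauge z) -/q.
  by rewrite ler_norml => /andP[]; lra.
have cz : 0 < cmod z by rewrite lt_neqAle cmod_ge0 andbT; apply/eqP => h; rewrite -h expr0n /= in cz2; lra.
have zn : z != 0 by apply/eqP => h; rewrite h cmod0 ltxx in cz.
pose d : R[i] := t%:C * (1 - z ^+ 2) / (2%:R * z).
have c2 : cmod (2%:R : R[i]) = 2.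
  have -> : (2%:R : R[i]) = (2 : R)%:C by rewrite rmorph_nat.
  by rewrite cmod_real ger0_norm.
have dE : cmod d * (2 * cmod z) = t * q.
  rewrite -c2 -cmodM -cmodM -/d /q /gauge -ct -cmodM; congr cmod.
  by rewrite /d; field; rewrite zn.
have d0 := cmod_ge0 d.
have dt : cmod d <= t.
  have : t * q <= t * (2 * cmod z) by apply: ler_wpM2l; [exact: ltW|nra].
  by rewrite -dE ler_pM2r// mulr_gt0.
have dd : cmod d ^+ 2 <= t ^+ 2 * q.
  have : (cmod d * (2 * cmod z)) ^+ 2 = cmod d ^+ 2 * (4 * cmod z ^+ 2) by ring.
  rewrite dE => E; have : cmod d ^+ 2 * 1 <= cmod d ^+ 2 * (4 * cmod z ^+ 2).
    by apply: ler_wpM2l; [exact: sqr_ge0|lra].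
  rewrite -E mulr1 exprMn => E2; apply: le_trans E2 _.
  by apply: ler_wpM2l; [exact: sqr_ge0|nra].
have gE : 1 - (z + d) ^+ 2 = (1 - z ^+ 2) * (1 - t%:C) - d ^+ 2.
  by rewrite /d; field; rewrite zn.
have c1t : cmod (1 - t%:C) = 1 - t.
  have -> : 1 - t%:C = (1 - t)%:C :> R[i] by rewrite rmorphB.
  by rewrite cmod_real ger0_norm; lra.
have := cmod_dist ((1 - z ^+ 2) * (1 - t%:C)) (d ^+ 2).
have := cmodD ((1 - z ^+ 2) * (1 - t%:C)) (- d ^+ 2).
rewrite cmodN -gE cmodM c1t cmodX -/(gauge z) -/(gauge (z + d)) -/q => g1.
rewrite ler_norml => /andP[_ g2].
have t2 : t ^+ 2 * q <= t * q / 8 by nra.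
have tq : 0 < t * q by exact: mulr_gt0.
have tq8 : t * q <= q / 8 by nra.
exists (z + d); rewrite (addrC z) addrK (addrC d); split; [lra|lra|].
have g3 : gauge (z + d) < q by lra.
have := cmod_ge0 (1 - (z + d) ^+ 2); rewrite -/(gauge (z + d)) => g4.
by nra.
Qed.

Lemma support_gauge (z : R[i]) : measure_support mu z <-> gauge z ^+ 2 <= 2^-1.
Proof.
split=> [hz|q2 U oU Uz].
  rewrite leNgt; apply/negP => q2.
  have q0 : 0 < gauge z.
    by rewrite lt_neqAle cmod_ge0 andbT; apply/eqP => h; move: q2; rewrite -h expr0n /=; lra.
  set q := gauge z in q0 q2.
  pose m := 2^-1 / q ^+ 2; have q20 : 0 < q ^+ 2 by rewrite exprn_gt0.
  have m1 : m < 1 by rewrite /m ltr_pdivrMr// mul1r.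
  have m0 : 0 < m by rewrite divr_gt0.
  (* Since s^2 > m, the level s q still lies outside the threshold, and [kap] is chosen so that kap
     s q = (1 + s) q / 2, strictly below q; a whole disc around [z] then lies in the null set. *)
  pose s := (1 + m) / 2.
  have s1 : s < 1 by rewrite /s; lra.
  have s0 : 0 < s by rewrite /s; lra.
  have sm : m < s ^+ 2 by rewrite /s; nra.
  have r2 : 2^-1 < (s * q) ^+ 2 by rewrite exprMn -ltr_pdivrMr.
  pose kap := (1 + s) / (2 * s).
  have kE : kap * (s * q) = (1 + s) / 2 * q by rewrite /kap; field; rewrite gt_eqF.
  have k1 : 1 < kap by rewrite /kap ltr_pdivlMr ?mulr_gt0//; lra.
  have null := outside_null (mulr_gt0 s0 q0) r2 k1; rewrite kE in null.
  have kq : (1 + s) / 2 * q < q by nra.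
  pose e := Num.min 1 ((q - (1 + s) / 2 * q) / (2 * cmod z + 1)).
  have a1 : 0 < 2 * cmod z + 1 by have := cmod_ge0 z; lra.
  have e0 : 0 < e by rewrite lt_min ltr01 divr_gt0// subr_gt0.
  have e1 : e <= 1 by rewrite ge_min lexx.
  have e2 : e * (2 * cmod z + 1) <= q - (1 + s) / 2 * q.
    by rewrite -ler_pdivlMr// ge_min lexx orbT.
  have := hz _ (@cmod_ball_open R z e); rewrite /= subrr cmod0 => /(_ e0).
  rewrite (_ : mu _ = 0%E) ?ltxx//.
  apply: (subset_measure0 _ _ _ null) => [||w /= wz].
  - by apply: sub_sigma_algebra; exact: cmod_ball_open.
  - have -> : [set w : borelC R | (1 + s) / 2 * q <= gauge w] =
      setT `&` (fun w : borelC R => gauge w) @^-1` `[(1 + s) / 2 * q, +oo[%classic.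
      by rewrite setTI; apply/seteqP; split => w; rewrite /= in_itv /= andbT.
    by apply: measurable_gauge => //; exact: measurable_itv.
  have := gauge_lipschitz (z := z) (w := w); rewrite (le_trans (ltW wz) e1) => /(_ isT).
  have : cmod (w - z) * (2 * cmod z + 1) <= e * (2 * cmod z + 1).
    by rewrite ler_pM2r// ltW.
  by rewrite -/q ler_norml => h1 /andP[h2 _]; lra.
have [e e0 he] := open_cmod oU Uz.
have e20 : 0 < e / 2 by lra.
have [l [lz l0 l2]] := inside_approximation q2 e20.
rewrite lt_neqAle measure_ge0 andbT; apply/eqP => h.
apply: (inside_charged e20 l0 l2).
apply: (subset_measure0 _ _ _ (esym h)) => [||w /= wl].
- by apply: sub_sigma_algebra; exact: cmod_ball_open.
- exact: sub_sigma_algebra.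
apply: he; have := cmodD (w - l) (l - z); rewrite addrA subrK.
by lra.
Qed.

End Support.

Theorem corollary5p13 (R : realType) (H : completeNormedModType R[i])
    (dot : {dot H for Num.conj}) (hdot : hilbert_norm dot)
    (M : set (H -> H)) (tau : (H -> H) -> R[i])
    (iota : bool -> 'M[R[i]]_2 -> H -> H)
    (hM : reduced_free_product dot M tau iota)
    (E F : 'I_2 -> 'I_2 -> H -> H)
    (hE : forall i j, E i j = iota false (delta_mx i j))
    (hF : forall i j, F i j = iota true (delta_mx i j))
    (W1 : H -> H) (hW1 : W1 = E ord0 ord0 - E ord_max ord_max)
    (mu : probability (borelC R) R)
    (hmu : Brown_measure dot M tau (W1 + F ord0 ord_max) mu) :
  measure_support mu =
  [set z : R[i] | `|z ^+ 2 - 1| <= ((Num.sqrt (2 : R))^-1)%:C].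
Proof.
case: hmu => [[K cK muK] hlog].
have WE : vnval (Wel hM) = W1.
  rewrite hW1 !hE; have := emb_linear (rfp_emb hM false) (-1) (delta_mx ord_max ord_max)
    (delta_mx ord0 ord0).
  have -> : -1 *: delta_mx ord_max ord_max + delta_mx ord0 ord0 = mx2 1 0 0 (-1) :> 'M[R[i]]_2.
    apply/matrixP => i j; rewrite !mxE.
    by case: i => [[|[|i]] hi] //; case: j => [[|[|j]] hj] //=; rewrite ?mulr1 ?mulr0 ?addr0 ?add0r.
  rewrite -[vnval _]/(iota false (mx2 1 0 0 (-1))) => ->; apply/funext => x.
  by rewrite !fctE scaleN1r addrC.
have NE : vnval (Nel hM) = F ord0 ord_max.
  rewrite hF -[vnval _]/(iota true (mx2 0 1 0 0)); congr (iota true _).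
  apply/matrixP => i j; rewrite !mxE.
  by case: i => [[|[|i]] hi] //; case: j => [[|[|j]] hj].
have pot l : 0 < gauge l -> potential_at mu (@half_limit R) l.
  move=> l0; have [d FK dE] := hlog l.
  transitivity (lne d%:E); first exact: esym dE.
  apply: (@FK_determinant_log R H dot hdot M tau _ _ (Wel hM + Nel hM - vn_sc (rfp_vn hM) (rfp_trace hM) l) d
    (limit_value (gauge l))).
    by move=> x x0; exact: (operator_limit hdot hM l0 x0).
  have -> // : vnval (Wel hM + Nel hM - vn_sc (rfp_vn hM) (rfp_trace hM) l) =
    W1 + F ord0 ord_max - l *: (id : H -> H).
  by apply/funext => x; rewrite vnBE vnDE vn_scE WE NE.
apply/funext => z; apply/propext.
apply: (iff_trans (support_gauge cK muK pot z)).
rewrite /= cmodE lecR cmodBC -/(gauge z).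
have -> : (2^-1 : R) = (Num.sqrt 2)^-1 ^+ 2 by rewrite exprVn sqr_sqrtr.
by rewrite ler_pXn2r// nnegrE ?cmod_ge0// invr_ge0 sqrtr_ge0.
Qed.
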